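(* Let $0\le p_-<p_+\le\infty$ and let $\mathcal{F}$ be a family of pairs $(f,g)$ of non-negative measurable functions on $\mathbb{R}^n$. Suppose that for some $p_0,q_0\in(0,\infty)$ such that $p_-\le p_0\le p_+$ and $\frac1{q_0}-\frac1{p_0}+\frac1{p_+}\ge 0$, and all weights $w$ such that $w^{p_0}\in A_{\frac{p_0}{p_-}}\cap RH_{\left(\frac{p_+}{p_0}\right)'}$, $$\left(\int_{\mathbb{R}^n}f^{q_0}w^{q_0}\,dx\right)^{\frac1{q_0}}\le C\left(\int_{\mathbb{R}^n}g^{p_0}w^{p_0}\,dx\right)^{\frac1{p_0}}$$ for all $(f,g)\in\mathcal{F}$ (whether or not the left-hand side is finite), where the constant $C$ depends on $n$, $p_0$, $q_0$, $[w^{p_0}]_{A_{p_0/p_-}}$, $[w^{p_0}]_{RH_{(p_+/p_0)'}}$. Then for every $p,q$ such that $p_-<p<p_+$, $0<q<\infty$ and $\frac1p-\frac1q=\frac1{p_0}-\frac1{q_0}$, and every weight $w$ such that $w^p\in A_{\frac{p}{p_-}}\cap RH_{\left(\frac{p_+}{p}\right)'}$, $$\left(\int_{\mathbb{R}^n}f^{q}w^{q}\,dx\right)^{\frac1{q}}\le C\left(\int_{\mathbb{R}^n}g^{p}w^{p}\,dx\right)^{\frac1{p}}$$ for all $(f,g)\in\mathcal{F}$ (whether or not the left-hand side is finite), and $C$ depends on $n$, $p$, $q$, $[w^p]_{A_{p/p_-}}$, $[w^p]_{RH_{(p_+/p)'}}$.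
   Context: Weights: a weight is a measurable function $v$ on $\mathbb{R}^n$ with $0<v(x)<\infty$ a.e. All suprema below are over cubes $Q\subset\mathbb{R}^n$ with sides parallel to the axes, and $\langle v\rangle_Q=|Q|^{-1}\int_Q v\,dx$. For $1<p<\infty$, $v\in A_p$ if $[v]_{A_p}=\sup_Q\langle v\rangle_Q\,\langle v^{1-p'}\rangle_Q^{\,p-1}<\infty$. Also $v\in A_1$ if $[v]_{A_1}=\sup_Q\langle v\rangle_Q\,\operatorname{ess\,sup}_{x\in Q}v(x)^{-1}<\infty$. Set $A_\infty=\bigcup_{1\le p<\infty}A_p$. For $1<s<\infty$, a locally integrable weight $v$ is in $RH_s$ if $[v]_{RH_s}=\sup_Q\langle v^s\rangle_Q^{1/s}\langle v\rangle_Q^{-1}<\infty$. Also $v\in RH_\infty$ if $[v]_{RH_\infty}=\sup_Q\left(\operatorname{ess\,sup}_{x\in Q}v(x)\right)\langle v\rangle_Q^{-1}<\infty$. Set $RH_1=\bigcup_{1<s\le\infty}RH_s$; it is known that $RH_1=A_\infty$. Conventions: $p'$ is the conjugate exponent, $\frac1p+\frac1{p'}=1$; $\frac1\infty=0$, $\frac10=\infty$, $1'=\infty$, $\infty'=1$. Thus a Muckenhoupt class with index $\frac{p}{0}$ is $A_\infty$, and a reverse Hölder class with index $\left(\frac{\infty}{p}\right)'$ is $RH_1=A_\infty$, while index $\left(\frac{p}{p}\right)'=1'$ gives $RH_\infty$. For $v\in A_\infty=RH_1$ the constant $[v]_{A_\infty}=[v]_{RH_1}$ is the usual $A_\infty$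 constant $\sup_Q\left(\int_Q v\right)^{-1}\int_Q M(v\chi_Q)\,dx$, $M$ the Hardy–Littlewood maximal operator. Constants: ''C depends on'' given quantities means that $C$ may depend on $n$, the underlying exponents/parameters (such as $p_\pm,p_0,q_0,p,q$) and the indicated weight constants, but not otherwise on the specific weight nor on the functions in $\mathcal{F}$ (so for fixed parameters, one $C$ works for all weights whose indicated constants are at most a given bound). *)

(* Defs.v *)
From HB Require Import structures.
From mathcomp Require Import all_boot all_order all_algebra.
From mathcomp Require Import all_classical all_reals all_analysis measurable_realfun.
Set Implicit Arguments.
Unset Strict Implicit.
Unset Printing Implicit Defensive.
Import Order.TTheory GRing.Theory Num.Theory.
Import numFieldNormedType.Exports.
Local Open Scope classical_set_scope.
Local Open Scope ring_scope.

(* The ambient space is R^d with d = n.+1 >= 1, carried by ['rV[R]_n.+1]. *)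

Section lebesgue_Rn.
Context {R : realType} {n : nat}.
Implicit Types (A : set 'rV[R]_n.+1) (a b : 'rV[R]_n.+1).

Definition box a b : set 'rV[R]_n.+1 :=
  [set x | forall i, a 0 i < x 0 i < b 0 i].

Definition box_vol a b : R := \prod_(i < n.+1) Num.max 0 (b 0 i - a 0 i).

Lemma box_vol_ge0 a b : 0 <= box_vol a b.
Proof. by apply: prodr_ge0 => i _; rewrite le_max lexx. Qed.

Local Open Scope ereal_scope.

Definition lebesgue_outer A : \bar R :=
  ereal_inf [set \sum_(0 <= k <oo) (box_vol (F k).1 (F k).2)%:E |
    F in [set F : ('rV[R]_n.+1 * 'rV[R]_n.+1)^nat |
            A `<=` \bigcup_k box (F k).1 (F k).2]].

Lemma lebesgue_outer_ge0 A : 0 <= lebesgue_outer A.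
Proof.
apply: le_ereal_inf_tmp => x [F _ <-].
by apply: nneseries_ge0 => k _ _; rewrite lee_fin box_vol_ge0.
Qed.

Lemma lebesgue_outer0 : lebesgue_outer set0 = 0.
Proof.
apply/eqP; rewrite eq_le lebesgue_outer_ge0 andbT.
apply: ereal_inf_lbound; exists (fun=> (0%R, 0%R)) => //=.
apply: eseries0 => k _ _.
by rewrite /box_vol big_ord_recl subrr maxxx mul0r.
Qed.

Lemma lebesgue_outer_subadditive A (F : (set 'rV[R]_n.+1)^nat) :
  subset_sigma_subadditive lebesgue_outer A F.
Proof.
move=> AF; have [[i ioo]|] := pselect (exists i, lebesgue_outer (F i) = +oo).
  rewrite (eseries_pinfty _ _ ioo) ?leey// => k _.
  by rewrite -ltNye (lt_le_trans _ (lebesgue_outer_ge0 _)).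
rewrite -forallNE => Foo; apply/lee_addgt0Pr => e e0.
rewrite (le_trans _ (epsilon_trick _ _ (ltW e0)))//; last first.
  by move=> k; exact: lebesgue_outer_ge0.
pose V (p : 'rV[R]_n.+1 * 'rV[R]_n.+1) := (box_vol p.1 p.2)%:E.
have V0 p : 0 <= V p by rewrite lee_fin box_vol_ge0.
pose P k (G : ('rV[R]_n.+1 * 'rV[R]_n.+1)^nat) :=
  F k `<=` \bigcup_j box (G j).1 (G j).2 /\
  \sum_(0 <= j <oo) V (G j) <= lebesgue_outer (F k) + (e / (2 ^ k.+1)%:R)%:E.
have [G PG] : {G & forall k, P k (G k)}.
  apply: (@choice _ _ P) => k.
  have ek : (0 < e / (2 ^ k.+1)%:R)%R by rewrite divr_gt0// ltr0n expn_gt0.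
  have fink : lebesgue_outer (F k) \is a fin_num.
    by rewrite ge0_fin_numE ?lebesgue_outer_ge0// ltey; exact/eqP/Foo.
  have [x [H FH <-] /ltW Hle] := lb_ereal_inf_adherent ek fink.
  by exists H.
have /card_esym/ppcard_eqP[f] := card_nat2.
apply: (@le_trans _ _ (\esum_(i in setT) (V \o uncurry G) i)).
  apply: ereal_inf_lbound; exists (uncurry G \o f).
    apply: (subset_trans AF) => t [i _] /(PG i).1 [j _ Gijt].
    by exists (f^-1%FUN (i, j)) => //=; rewrite invK ?inE.
  rewrite -(esum_pred_image (V \o uncurry G) _ xpredT) ?[fun=> _]set_true//.
    by rewrite image_eq.
  by move=> k _; exact: V0.
rewrite (_ : esum _ _ = \sum_(0 <= i <oo) \sum_(0 <= j <oo) V (G i j)); last first.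
  pose J : nat -> set (nat * nat) := fun i => [set (i, j) | j in setT].
  rewrite (_ : setT = \bigcup_k J k); last first.
    by rewrite predeqE => -[a b]; split => // _; exists a => //; exists b.
  rewrite esum_bigcupT /=; last 2 first.
    - apply/trivIsetP => i j _ _ ij.
      rewrite predeqE => -[u v] /=; split => //= -[] [_] _ [<-{u} _].
      by move=> [v' _] [] /esym/eqP; rewrite (negbTE ij).
    - by move=> /= [u v]; exact: V0.
  rewrite -(image_id [set: nat]) -fun_true esum_pred_image//; last first.
    by move=> u _; exact: esum_ge0.
  apply: eq_eseriesr => /= j _.
  rewrite -(esum_pred_image (V \o uncurry G) (pair j) predT)//=; last first.
    by move=> ? ? _ _; exact: (@can_inj _ _ _ snd).
  by congr esum; rewrite predeqE => -[a b]; split; move=> [i _ <-]; exists i.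
apply: lee_nneseries => [k _ _|k _]; last exact: (PG k).2.
by apply: nneseries_ge0.
Qed.

HB.instance Definition _ := isSubsetOuterMeasure.Build R 'rV[R]_n.+1
  lebesgue_outer lebesgue_outer0 lebesgue_outer_ge0 lebesgue_outer_subadditive.

End lebesgue_Rn.

(* R^(n+1) with the sigma-algebra of all Lebesgue measurable sets *)
Definition Rn (R : realType) (n : nat) : Type :=
  caratheodory_type (@lebesgue_outer R n).
HB.instance Definition _ (R : realType) (n : nat) := Measurable.on (Rn R n).

Section lebesgue_measure_Rn.
Context {R : realType} {n : nat}.

Definition lebesgue_Rn : set (Rn R n) -> \bar R := @lebesgue_outer R n.

Let lebesgue_Rn0 : lebesgue_Rn set0 = 0%E.
Proof. exact: lebesgue_outer0. Qed.

Let lebesgue_Rn_ge0 (A : set (Rn R n)) : (0 <= lebesgue_Rn A)%E.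
Proof. exact: lebesgue_outer_ge0. Qed.

Let lebesgue_Rn_sigma_additive : semi_sigma_additive lebesgue_Rn.
Proof. exact: (@caratheodory_measure_sigma_additive _ _ (@lebesgue_outer R n)). Qed.

HB.instance Definition _ := isMeasure.Build _ (Rn R n) R lebesgue_Rn
  lebesgue_Rn0 lebesgue_Rn_ge0 lebesgue_Rn_sigma_additive.

End lebesgue_measure_Rn.

Section weights.
Context {R : realType} {n : nat}.
Local Notation T := (Rn R n).
Local Notation mu := (@lebesgue_Rn R n).
Implicit Types (Q : set T) (v f : T -> \bar R).
Local Open Scope ereal_scope.

(* Cubes are taken open; their boundaries are null, so averages and essential
   suprema are the same over closed cubes. *)
Definition cubes : set (set T) :=
  [set Q | exists (a : 'rV[R]_n.+1) (l : R),
     (0 < l)%R /\ Q = box a (a + const_mx l)%R].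

Definition avg Q f : \bar R := (mu Q)^-1 * \int[mu]_(x in Q) f x.

Definition ess_sup_in Q f : \bar R :=
  ereal_inf [set y | {ae mu, forall x, Q x -> f x <= y}].

Definition weight v : Prop :=
  measurable_fun [set: T] v /\ {ae mu, forall x, 0 < v x < +oo}.

Definition locally_integrable_Rn v : Prop := measurable_fun [set: T] v /\
  forall K : set 'rV[R]_n.+1, compact K -> \int[mu]_(x in (K : set T)) `|v x| < +oo.

(* uncentred, over cubes *)
Definition maximal f (x : T) : \bar R :=
  ereal_sup [set avg Q (fun y => `|f y|) | Q in [set Q | cubes Q /\ Q x]].

Definition Ainfty_const v : \bar R :=
  ereal_sup [set (\int[mu]_(x in Q) v x)^-1 *
                 \int[mu]_(x in Q) maximal (v \_ Q) x | Q in cubes].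

(* junk value when r < 1 *)
Definition A_const (r : \bar R) v : \bar R :=
  match r with
  | r%:E => if (r == 1)%R then
      ereal_sup [set avg Q v * ess_sup_in Q (fun x => (v x)^-1) | Q in cubes]
    else let r' := fine (hoelder_conjugate r%:E) in
      ereal_sup [set avg Q v * (avg Q (fun x => v x `^ (1 - r'))) `^ (r - 1)
                | Q in cubes]
  | _ => Ainfty_const v
  end.

Definition A_class (r : \bar R) v : Prop :=
  match r with
  | r%:E => [/\ (1 <= r)%R, weight v & A_const r%:E v < +oo]
  | +oo => exists r : R, [/\ (1 <= r)%R, weight v & A_const r%:E v < +oo]
  | -oo => False
  end.

(* junk value when s < 1 *)
Definition RH_const (s : \bar R) v : \bar R :=
  if s == 1 then Ainfty_const v else
  match s with
  | s%:E =>
      ereal_sup [set (avg Q (fun x => v x `^ s)) `^ s^-1 * (avg Q v)^-1 | Q in cubes]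
  | _ => ereal_sup [set ess_sup_in Q v * (avg Q v)^-1 | Q in cubes]
  end.

Definition RH_class_gt1 (s : \bar R) v : Prop :=
  [/\ 1 < s, weight v, locally_integrable_Rn v & RH_const s v < +oo].

Definition RH_class (s : \bar R) v : Prop :=
  if s == 1 then exists s' : \bar R, RH_class_gt1 s' v else RH_class_gt1 s v.

(* The inequality holds for every weight of the given classes, with a constant
   depending on the weight only through upper bounds on its two constants;
   indices follow the ereal conventions r / 0 = +oo and +oo / r = +oo. *)
Definition weighted_estimate (pm pp : \bar R) (p q : R)
    (F : set ((T -> \bar R) * (T -> \bar R))) : Prop :=
  let r := p%:E / pm in
  let s := hoelder_conjugate (pp / p%:E) in
  forall K1 K2 : R, exists2 C : R, (0 < C)%R &
    forall w : T -> \bar R, weight w ->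
      let wp := fun x => w x `^ p in
      A_class r wp -> RH_class s wp ->
      A_const r wp <= K1%:E -> RH_const s wp <= K2%:E ->
      forall f g, F (f, g) ->
        (\int[mu]_x (f x `^ q * w x `^ q)) `^ q^-1 <=
        C%:E * (\int[mu]_x (g x `^ p * w x `^ p)) `^ p^-1.

End weights.

(* Main.v *)
(* Write t = 1/p, t0 = 1/p0, s = 1/q, a = 1/p_-, b = 1/p_+, |u|_c = <u^(1/c)>_Q^c (an essential
   supremum when c = 0). By Hoelder, w^p lies in the intersection of the Muckenhoupt and
   reverse Hoelder classes iff |w|_(t-b) |1/w|_(a-t) is bounded over cubes, i.e. iff
   W = w^(1/(t-b)) is an A_P weight with P = (a-b)/(t-b). For such W the maximal operator
   is bounded on L^P(W) (Lerner's pointwise argument on the dyadic maximal functions of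
   finitely many shifted grids), so the Rubio de Francia algorithm turns
   (g w)^(1/t) into a majorant h = H^P W of comparable integral with H in A_1. If t > t0,
   the weight w h^(t0-t) = w^k H^(-e) satisfies the t0-condition, because A_1 bounds 1/H by
   the inverse of its average; the hypothesis for it and Hoelder's inequality give the
   estimate for w. If t < t0, the same is done with 1/w in place of w and with truncations
   of (f w)^(1/s) in place of (g w)^(1/t), and the extra factor is absorbed.
   When p_+ is infinite or p_- = 0 the hypotheses only involve the A_infinity constant:
   A_P weights have bounded A_infinity constant and satisfy a reverse Hoelder inequality,
   and conversely a weight with bounded A_infinity constant is in A_r for some r depending
   on the bound only; both follow from one stopping time argument. *)

Require Import Defs.
From mathcomp Require Import all_boot all_order all_algebra.
From mathcomp Require Import all_classical all_reals all_analysis measurable_realfun.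
From mathcomp Require Import ring lra.
Set Implicit Arguments.
Unset Strict Implicit.
Unset Printing Implicit Defensive.
Import Order.TTheory GRing.Theory Num.Theory.
Import numFieldNormedType.Exports.
Local Open Scope classical_set_scope.
Local Open Scope ring_scope.
Local Open Scope ereal_scope.

(** Membership of [w] in the two classes is read off a pair of orders, al = t - b for [w] and be = a
    - t for [1/w]. Multiplying [w] by [h^(-eps)] moves (al, be) to (al - eps, be + eps) and keeps al
    + be fixed, which is why 1/p and 1/q can only move by the same amount. The algorithm is always
    run for the target exponent, where both orders are positive; an order can vanish, and an average
    become an essential supremum, only at p0. If p_- = 0 there is no a: be is then produced from the
    bound on the A_infinity constant and enlarged so that be - eps stays nonnegative.

    The absorption for t < t0 divides by a power of the mass of [(f w)^(1/s)], which may be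
    infinite. Truncations have finite mass, and the constant obtained for them does not depend on
    the truncation.

    Since Lebesgue measure is given as an outer measure through box covers, volumes of cubes and
    differentiation of integrals are derived from covers as well. Nested partitions into half-open
    cubes serve three purposes: Doob's inequality, stopping times, and differentiation. *)

Lemma split_length (R : realFieldType) (a b c dl : R) : (0 <= dl ->
  Num.max 0 (Num.min b c - a) + Num.max 0 (b - Num.max a (c - dl)) <=
  Num.max 0 (b - a) + dl)%R.
Proof.
move=> dl0; case: (leP b c) => bc.
  by rewrite lerD2l ge_max dl0/= lerBlDl -lerBlDr le_max lerD2r bc orbT.
have M1 : (a <= Num.max a (c - dl))%R by rewrite le_max lexx.
have M2 : (c - dl <= Num.max a (c - dl))%R by rewrite le_max lexx orbT.
move: (Num.max a _) M1 M2 => M M1 M2.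
have m0 : (0 <= Num.max 0 (b - a))%R by rewrite le_max lexx.
have m1 : (b - a <= Num.max 0 (b - a))%R by rewrite le_max lexx orbT.
move: (Num.max 0 (b - a))%R m0 m1 => m m0 m1.
have [ca|ac] := leP c a.
  by rewrite max_l ?subr_le0// add0r ge_max; apply/andP; split; lra.
rewrite max_r ?subr_ge0; last exact: ltW.
by rewrite -lerBrDl ge_max; apply/andP; split; lra.
Qed.

(** * Lebesgue measure of boxes *)

Section lebesgue_boxes.
Context {R : realType}.

Let L (a b : R) : R := Num.max 0%R (b - a)%R.

Let L_ge0 a b : (0 <= L a b)%R. Proof. by rewrite le_max lexx. Qed.

Let ind (a b x : R) : R := \1_(`]a, b[%classic : set R) x.

Let ind_ge0 a b x : (0 <= ind a b x)%R.
Proof. by rewrite /ind indicE. Qed.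

Let integral_ind a b :
  \int[lebesgue_measure]_x (ind a b x)%:E = (L a b)%:E.
Proof.
rewrite integral_indic// setIT; have := lebesgue_measure_itv (`]a, b[ : interval R);
  rewrite /= => ->; rewrite lte_fin /L.
case: ltP => ab; first by rewrite -EFinB max_r// subr_ge0 ltW.
by rewrite max_l// subr_le0.
Qed.

(* Integrating out one coordinate at a time keeps the right-hand side a series
   of indicators of boxes. *)
Lemma box_vol_le_series_aux m (a b : 'I_m -> R) (A B : nat -> 'I_m -> R)
    (C : R) (c : nat -> \bar R) : (0 <= C)%R -> (forall k, 0 <= c k) ->
  (forall x : 'I_m -> R, (C * \prod_i ind (a i) (b i) (x i))%:E <=
     \sum_(0 <= k <oo) c k * (\prod_i ind (A k i) (B k i) (x i))%:E) ->
  (C * \prod_i L (a i) (b i))%:E <=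
     \sum_(0 <= k <oo) c k * (\prod_i L (A k i) (B k i))%:E.
Proof.
elim: m a b A B C c => [|m IH] a b A B C c C0 c0 H.
  have := H (fun _ => 0%R); rewrite !big_ord0 => /le_trans; apply.
  by apply: lee_nneseries => k _; rewrite !big_ord0// mule1.
rewrite big_ord_recl mulrA.
under eq_eseriesr do rewrite big_ord_recl EFinM muleA.
apply: (IH (fun i => a (lift ord0 i)) (fun i => b (lift ord0 i))
  (fun k i => A k (lift ord0 i)) (fun k i => B k (lift ord0 i))
  (C * L (a ord0) (b ord0))%R
  (fun k => c k * (L (A k ord0) (B k ord0))%:E)) => [||y].
- by rewrite mulr_ge0.
- by move=> k; rewrite mule_ge0// lee_fin.
pose x y0 (i : 'I_m.+1) : R := if unlift ord0 i is Some j then y j else y0.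
set P := (\prod_(i < m) _)%R.
have P0 : (0 <= P)%R by apply: prodr_ge0 => i _.
have -> : (C * L (a ord0) (b ord0) * P)%:E =
    \int[lebesgue_measure]_y0 ((C * P)%:E * (ind (a ord0) (b ord0) y0)%:E).
  rewrite ge0_integralZl_EFin//; last 3 first.
  - by move=> z _; rewrite lee_fin.
  - by apply/measurable_EFinP; exact: measurable_indic.
  - by rewrite mulr_ge0.
  by rewrite integral_ind -EFinM mulrAC.
have mI k : measurable_fun [set: measurableTypeR R]
    (fun z : measurableTypeR R => (ind (A k ord0) (B k ord0) z)%:E).
  by apply/measurable_EFinP; exact: measurable_indic.
pose Q k := (\prod_(i < m) ind (A k (lift ord0 i)) (B k (lift ord0 i)) (y i))%R.
have Q0 k : (0 <= Q k)%R by apply: prodr_ge0 => i _.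
have -> : \sum_(0 <= k <oo) c k * (L (A k ord0) (B k ord0))%:E * (Q k)%:E =
   \int[lebesgue_measure]_y0
      \sum_(0 <= k <oo) (c k * (Q k)%:E * (ind (A k ord0) (B k ord0) y0)%:E).
  rewrite integral_nneseries//; last 2 first.
  - by move=> k; apply: emeasurable_funM; [exact: measurable_cst|exact: mI].
  - by move=> k z _; rewrite !mule_ge0// lee_fin.
  apply: eq_eseriesr => k _; rewrite ge0_integralZl//; last 2 first.
  - by move=> z _; rewrite lee_fin.
  - by rewrite mule_ge0// lee_fin.
  by rewrite integral_ind muleAC.
apply: ge0_le_integral => //.
- by move=> z _; rewrite -EFinM lee_fin !mulr_ge0.
- apply: emeasurable_funM; first exact: measurable_cst.
  by apply/measurable_EFinP; exact: measurable_indic.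
- apply: ge0_emeasurable_sum => [k z _ _|k _].
    by rewrite !mule_ge0// lee_fin.
  by apply: emeasurable_funM; [exact: measurable_cst|exact: mI].
move=> z _; have := H (x z); rewrite big_ord_recl -EFinM.
have x0 : x z ord0 = z by rewrite /x unlift_none.
have xS i : x z (lift ord0 i) = y i by rewrite /x liftK.
rewrite x0; under eq_bigr do rewrite xS.
rewrite -/P mulrCA mulrC => /le_trans; apply.
apply: lee_nneseries => k _; first by rewrite mule_ge0// lee_fin prodr_ge0.
rewrite big_ord_recl x0; under eq_bigr do rewrite xS.
by rewrite -/(Q k) EFinM muleCA -muleA muleC muleA.
Qed.

End lebesgue_boxes.

Section lebesgue_Rn_boxes.
Context {R : realType} {n : nat}.
Local Notation T := (Rn R n).
Local Notation mu := (@lebesgue_Rn R n).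

(** Subadditivity comes from integrating the pointwise inequality between the indicator of the box
    and the sum of the indicators of the covering boxes; no compact approximation enters. *)
Lemma box_vol_le_series (a b : 'rV[R]_n.+1) (F : ('rV[R]_n.+1 * 'rV[R]_n.+1)^nat) :
  box a b `<=` \bigcup_k box (F k).1 (F k).2 ->
  (box_vol a b)%:E <= \sum_(0 <= k <oo) (box_vol (F k).1 (F k).2)%:E.
Proof.
move=> abF.
have := @box_vol_le_series_aux R n.+1 (fun i => a 0%R i) (fun i => b 0%R i)
  (fun k i => (F k).1 0%R i) (fun k i => (F k).2 0%R i) 1%R (fun=> 1) ler01.
rewrite mul1r /box_vol; under eq_eseriesr do rewrite mul1e.
apply; first by [].
move=> x; rewrite mul1r; under eq_eseriesr do rewrite mul1e.
have ind01 (c d : 'rV[R]_n.+1) : (\prod_i \1_(`]c 0%R i, d 0%R i[%classic : set R) (x i) =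
    \1_(box c d) (\row_i x i) :> R)%R.
  rewrite [RHS]indicE; have [|] := boolP ((\row_i x i)%R \in box c d).
    rewrite inE /box/= => xcd; rewrite big1// => i _.
    by rewrite indicE mem_set//=; have := xcd i; rewrite mxE in_itv.
  rewrite notin_setE /box/= => /existsNP[i xi].
  rewrite (bigD1 i)//= indicE memNset ?mul0r//= in_itv/=.
  by move: xi; rewrite mxE.
under eq_eseriesr do rewrite ind01.
rewrite ind01 [X in X%:E <= _]indicE.
have [|_] := boolP ((\row_i x i)%R \in box a b); last first.
  by apply: nneseries_ge0 => k _ _; rewrite lee_fin indicE.
rewrite inE => /abF[k _ xk].
rewrite (@nneseriesD1 _ _ k xpredT)//.
rewrite indicE mem_set//= leeDl//.
by apply: nneseries_ge0 => j _ _; rewrite lee_fin indicE.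
Qed.

Lemma lebesgue_Rn_box (a b : 'rV[R]_n.+1) : mu (box a b) = (box_vol a b)%:E.
Proof.
apply/eqP; rewrite eq_le; apply/andP; split; last first.
  by apply: le_ereal_inf_tmp => x [F abF <-]; exact: box_vol_le_series.
apply: ereal_inf_lbound.
(* The cover is padded with the degenerate box at the origin, of volume zero. *)
exists (fun k => if k == 0%N then (a, b) else (0%R, 0%R)) => /=.
  by move=> x abx; exists 0%N.
rewrite (@nneseriesD1 _ _ 0%N xpredT)//=; last first.
  by move=> k _; rewrite lee_fin box_vol_ge0.
rewrite eseries0 ?adde0// => k _ /=; case: ifP => //= _ _.
by rewrite /box_vol big_ord_recl subrr maxxx mul0r.
Qed.

Let set_coord (a : 'rV[R]_n.+1) i (r : R) : 'rV[R]_n.+1 :=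
  \row_j (if j == i then r else a 0%R j).

Let others (a b : 'rV[R]_n.+1) i : R :=
  (\prod_(j < n.+1 | j != i) Num.max 0 (b 0 j - a 0 j))%R.

Let box_volE a b i : box_vol a b = (Num.max 0 (b 0 i - a 0 i) * others a b i)%R.
Proof. by rewrite /box_vol (bigD1 i). Qed.

(** Caratheodory's criterion is checked on box covers of [X] by cutting each box at the hyperplane.
    The right-hand piece has to be an open box that still covers the hyperplane, so it is extended
    to the left by [del k]. *)
Lemma measurable_lt_coord (i : 'I_n.+1) (c : R) :
  measurable ([set x : 'rV[R]_n.+1 | x 0%R i < c]%R : set T).
Proof.
apply: le_caratheodory_measurable => X.
change (lebesgue_outer (X `&` [set x | x 0%R i < c]%R) +
  lebesgue_outer (X `&` ~` [set x | x 0%R i < c]%R) <= lebesgue_outer X).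
have [->|Xoo] := eqVneq (lebesgue_outer X) +oo; first by rewrite leey.
have Xfin : lebesgue_outer X \is a fin_num.
  by rewrite ge0_fin_numE ?lebesgue_outer_ge0// ltey.
apply/lee_addgt0Pr => e e0.
have e20 : (0 < e / 2)%R by rewrite divr_gt0.
have [_ [F XF <-] /ltW Fe] := lb_ereal_inf_adherent e20 Xfin.
(* The extension of the k-th box adds at most [e / 2 / 2 ^ k.+1] of volume, and the 1 avoids a
   division by zero. The other half of [e] is spent on the choice of the cover. *)
pose del k := (e / 2 / (2 ^ k.+1)%:R / (1 + others (F k).1 (F k).2 i))%R.
have o0 a b : (0 <= others a b i)%R.
  by apply: prodr_ge0 => j _; rewrite le_max lexx.
have del0 k : (0 < del k)%R.
  by rewrite !divr_gt0// ?ltr0n ?expn_gt0// ltr_pwDl.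
pose FL k := ((F k).1, set_coord (F k).2 i (Num.min ((F k).2 0%R i) c)).
pose FR k := (set_coord (F k).1 i (Num.max ((F k).1 0%R i) (c - del k)%R), (F k).2).
have HL : lebesgue_outer (X `&` [set x | x 0%R i < c]%R) <=
    \sum_(0 <= k <oo) (box_vol (FL k).1 (FL k).2)%:E.
  apply: ereal_inf_lbound; exists FL => // x [/XF[k _ xk] /= xc].
  exists k => //= j; rewrite mxE; case: eqP => [->|_]; last exact: xk.
  by have /andP[-> xb] := xk i; rewrite lt_min xb xc.
have HR : lebesgue_outer (X `&` ~` [set x | x 0%R i < c]%R) <=
    \sum_(0 <= k <oo) (box_vol (FR k).1 (FR k).2)%:E.
  apply: ereal_inf_lbound; exists FR => // x [/XF[k _ xk] /= xc].
  exists k => //= j; rewrite mxE; case: eqP => [->|_]; last exact: xk.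
  have /andP[ax ->] := xk i; rewrite gt_max ax/= andbT.
  rewrite ltrBlDr (@le_lt_trans _ _ (x 0%R i))// ?ltrDl//.
  by rewrite leNgt; apply/negP.
apply: (le_trans (leeD HL HR)).
have V0 (H : ('rV[R]_n.+1 * 'rV[R]_n.+1)^nat) k :
  0 <= (box_vol (H k).1 (H k).2)%:E by rewrite lee_fin; exact: box_vol_ge0.
rewrite -nneseriesD//.
have -> : lebesgue_outer X + e%:E = lebesgue_outer X + (e / 2)%:E + (e / 2)%:E.
  by rewrite -addeA -EFinD -splitr.
apply: (@le_trans _ _ (\sum_(0 <= k <oo) ((box_vol (F k).1 (F k).2)%:E +
    (e / 2 / (2 ^ k.+1)%:R)%:E))); last first.
  apply: (le_trans (epsilon_trick _ _ _)) => //; first exact: ltW.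
  by rewrite leeD2r.
apply: lee_nneseries => [k _ _|k _]; first by rewrite adde_ge0.
rewrite -!EFinD lee_fin !(box_volE _ _ i).
have oL : others (FL k).1 (FL k).2 i = others (F k).1 (F k).2 i.
  by apply: eq_bigr => j /negbTE ji; rewrite mxE ji.
have oR : others (FR k).1 (FR k).2 i = others (F k).1 (F k).2 i.
  by apply: eq_bigr => j /negbTE ji; rewrite mxE ji.
rewrite oL oR !mxE eqxx /= -mulrDl.
set O := others _ _ _; set a := (F k).1 _ _; set b := (F k).2 _ _.
apply: (@le_trans _ _ ((Num.max 0 (b - a) + del k) * O)%R).
  by rewrite ler_wpM2r ?o0//; apply: split_length; exact/ltW/del0.
rewrite mulrDl lerD2l /del -[leLHS]mulrA ler_piMr//.
  by rewrite divr_ge0 ?ltW// ltr0n expn_gt0.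
by rewrite mulrC ler_pdivrMr ?ltr_pwDl// mul1r lerDr.
Qed.

Lemma measurable_coord (i : 'I_n.+1) :
  measurable_fun [set: T] (fun x : T => (x : 'rV[R]_n.+1) 0%R i).
Proof.
apply: (measurability (@RGenCInfty.G R)); first exact: RGenCInfty.measurableE.
move=> _ [_ [r ->] <-]; rewrite setTI.
rewrite (_ : _ @^-1` _ = ~` [set x : 'rV[R]_n.+1 | x 0%R i < r]%R); last first.
  by apply/seteqP; split=> x /=; rewrite in_itv/= andbT leNgt => /negP.
by apply: measurableC; exact: measurable_lt_coord.
Qed.

Lemma measurable_box (a b : 'rV[R]_n.+1) : measurable (box a b : set T).
Proof.
rewrite (_ : box a b = \bigcap_(i in [set: 'I_n.+1])
    ((fun x : T => (x : 'rV[R]_n.+1) 0%R i) @^-1` `]a 0%R i, b 0%R i[)); last first.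
  apply/seteqP; split=> x /= abx i; last by have := abx i I; rewrite /= in_itv.
  by move=> _ /=; rewrite in_itv; exact: abx.
apply: fin_bigcap_measurable => // i _.
by rewrite -[_ @^-1` _]setTI; exact: measurable_coord.
Qed.

End lebesgue_Rn_boxes.

(** * Positivity tactics and Young's inequality *)

Ltac rpos := first [done | exact: ltW | exact: powR_ge0 |
  apply: powR_gt0; rpos | apply: mulr_gt0; rpos | apply: mulr_ge0; rpos |
  rewrite invr_gt0; rpos | rewrite invr_ge0; rpos | apply: addr_ge0; rpos |
  apply: ltW; rpos].

Ltac epos := first [done | rewrite lee_fin; rpos | exact: poweR_ge0 |
  apply: mule_ge0; epos | apply: adde_ge0; epos | rewrite inve_ge0; epos |
  match goal with H : forall _, is_true (0%R <= _) |- _ => exact: H end ].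

Lemma young_powR {R : realType} (t x y : R) : (0 < t < 1 -> 0 <= x -> 0 <= y ->
  x `^ t * y `^ (1 - t) <= t * x + (1 - t) * y)%R.
Proof.
move=> /andP[t0 t1] x0 y0.
have t1' : (0 < 1 - t)%R by rewrite subr_gt0.
have := @conjugate_powR R (x `^ t)%R (y `^ (1 - t))%R t^-1%R (1 - t)^-1%R.
rewrite !invr_gt0 !powR_ge0 !invrK -!powRrM !divff ?gt_eqF// !powRr1//.
move=> /(_ isT isT t0 t1'); rewrite [(t + _)%R]addrC subrK => /(_ erefl).
by rewrite [(x * t)%R]mulrC [(y * _)%R]mulrC.
Qed.

Lemma eyoung_poweR {R : realType} (t : R) (x y : \bar R) : (0 < t < 1)%R ->
  0 <= x -> 0 <= y -> x `^ t * y `^ (1 - t) <= t%:E * x + (1 - t)%:E * y.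
Proof.
move=> t01; have /andP[t0 t1] := t01.
have t1' : (0 < 1 - t)%R by rewrite subr_gt0.
case: x => [x| |]//; case: y => [y| |]//; rewrite ?lee_fin.
- by move=> x0 y0; exact: young_powR.
- move=> x0 _; rewrite [t'E in _ + t'E]gt0_muley ?lte_fin// addey ?leey//.
- move=> _ y0; rewrite [X in X + _]gt0_muley ?lte_fin// addye ?leey//.
- by move=> _ _; rewrite !gt0_muley ?lte_fin// addye// leey.
Qed.

Lemma lee_poweR {R : realType} (r : R) (x y : \bar R) : (0 <= r)%R ->
  0 <= x -> x <= y -> x `^ r <= y `^ r.
Proof.
move=> r0 x0 xy; apply: gt0_ler_poweR => //; rewrite in_itv/= leey andbT//.
exact: le_trans xy.
Qed.

Fact nnm_key : unit. Proof. exact: tt. Qed.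

(** * Nonnegative measurable functions *)

Section nonneg_measurable.
Context d (T : measurableType d) (R : realType) (mu : {measure set T -> \bar R}).
Implicit Types (f g : T -> \bar R) (u : T -> R) (D : set T).

(* locked because conversion on concrete measurability goals is expensive *)
Definition nnm f : Prop :=
  locked_with nnm_key (measurable_fun [set: T] f /\ forall x, 0 <= f x).

Lemma nnmP f : nnm f <-> measurable_fun [set: T] f /\ forall x, 0 <= f x.
Proof. by rewrite /nnm unlock. Qed.

Lemma nnm_m f : nnm f -> measurable_fun [set: T] f.
Proof. by move=> /nnmP[]. Qed.

Lemma nnm_ge0 f : nnm f -> forall x, 0 <= f x.
Proof. by move=> /nnmP[]. Qed.

Lemma nnm_mul f g : nnm f -> nnm g -> nnm (fun x => f x * g x).
Proof.
by move=> /nnmP[? f0] /nnmP[? g0]; apply/nnmP; split=> [|x]; [exact: emeasurable_funM|exact: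
  mule_ge0].
Qed.

Lemma nnm_add f g : nnm f -> nnm g -> nnm (fun x => f x + g x).
Proof.
by move=> /nnmP[? f0] /nnmP[? g0]; apply/nnmP; split=> [|x]; [exact: emeasurable_funD|exact:
  adde_ge0].
Qed.

Lemma nnm_pow f r : nnm f -> nnm (fun x => f x `^ r).
Proof.
move=> /nnmP[mf f0]; apply/nnmP; split=> [|x]; last exact: poweR_ge0.
exact: (measurableT_comp (measurable_poweR r)).
Qed.

Lemma nnm_cst (c : \bar R) : 0 <= c -> nnm (fun=> c).
Proof. by move=> c0; apply/nnmP; split. Qed.

Lemma nnm_EFin u : measurable_fun [set: T] u -> (forall x, (0 <= u x)%R) ->
  nnm (fun x => (u x)%:E).
Proof. by move=> mu0 u0; apply/nnmP; split=> [|x]; [exact/measurable_EFinP|rewrite lee_fin]. Qed.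

Lemma nnm_restrict f D : measurable D -> nnm f -> nnm (f \_ D).
Proof.
move=> mD /nnmP[mf f0]; apply/nnmP; split=> [|x]; last exact: erestrict_ge0.
by apply/(measurable_restrictT _ mD)/measurable_funTS.
Qed.

Lemma nnm_sup (F : nat -> T -> \bar R) : (forall k, nnm (F k)) ->
  nnm (fun x => ereal_sup (range (F ^~ x))).
Proof.
move=> F0; apply/nnmP; split=> [|x]; last first.
  by apply: (@le_trans _ _ (F 0%N x)); [exact: (nnm_ge0 (F0 _))|exact: ereal_sup_ubound].
have -> : (fun x => ereal_sup (range (F ^~ x))) = (fun x => esups (F ^~ x) 0%N).
  apply/funext => x; congr ereal_sup; apply/seteqP; split=> y /=.
    by move=> [k _ <-]; exists k.
  by move=> [k _ <-]; exists k.
by apply: measurable_fun_esups => k; exact: (nnm_m (F0 k)).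
Qed.

Lemma nnm_series (F : nat -> T -> \bar R) : (forall k, nnm (F k)) ->
  nnm (fun x => \sum_(0 <= k <oo) F k x).
Proof.
move=> F0; apply/nnmP; split=> [|x]; last by apply: nneseries_ge0 => k _ _; exact: (nnm_ge0 (F0 k)).
apply: ge0_emeasurable_sum => [k x _ _|k _]; [exact: (nnm_ge0 (F0 k))|exact: (nnm_m (F0 k))].
Qed.

Lemma nnm_int_ge0 f D : nnm f -> 0 <= \int[mu]_(x in D) f x.
Proof. by move=> /nnmP[_ f0]; apply: integral_ge0. Qed.

Lemma le_int f g D : measurable D -> nnm f -> nnm g ->
  (forall x, D x -> f x <= g x) ->
  \int[mu]_(x in D) f x <= \int[mu]_(x in D) g x.
Proof.
move=> mD /nnmP[mf f0] /nnmP[mg g0] fg.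
by apply: ge0_le_integral => //; exact: measurable_funTS.
Qed.

Lemma le_intT f g : nnm f -> nnm g -> (forall x, f x <= g x) ->
  \int[mu]_x f x <= \int[mu]_x g x.
Proof. by move=> ? ? ?; exact: le_int. Qed.

Lemma intD f g D : measurable D -> nnm f -> nnm g ->
  \int[mu]_(x in D) (f x + g x) = \int[mu]_(x in D) f x + \int[mu]_(x in D) g x.
Proof.
move=> mD /nnmP[mf f0] /nnmP[mg g0].
by apply: ge0_integralD => //; exact: measurable_funTS.
Qed.

Lemma intZ f D (k : \bar R) : measurable D -> nnm f -> 0 <= k ->
  \int[mu]_(x in D) (k * f x) = k * \int[mu]_(x in D) f x.
Proof.
by move=> mD /nnmP[mf f0] k0; apply: ge0_integralZl => //; exact: measurable_funTS.
Qed.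

Lemma le_int_set f A B : measurable A -> measurable B -> nnm f -> A `<=` B ->
  \int[mu]_(x in A) f x <= \int[mu]_(x in B) f x.
Proof.
move=> mA mB /nnmP[mf f0] AB; apply: ge0_subset_integral => //.
exact: measurable_funTS.
Qed.

Lemma int_eq0 f D : measurable D -> nnm f -> \int[mu]_(x in D) f x = 0 ->
  {ae mu, forall x, D x -> f x = 0}.
Proof.
move=> mD /nnmP[mf f0] I0; apply/(ae_eq_integral_abs mu mD (measurable_funTS mf)).
by rewrite -[RHS]I0; apply: eq_integral => x _; rewrite gee0_abs.
Qed.

Lemma int_ae0 f D : measurable D -> nnm f -> {ae mu, forall x, D x -> f x = 0} ->
  \int[mu]_(x in D) f x = 0.
Proof.
move=> mD /nnmP[mf f0] I0.
rewrite (@ae_eq_integral _ _ _ mu D (cst 0))//; last exact: measurable_funTS.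
by rewrite integral0.
Qed.

(** Young's inequality is applied pointwise to [f / a] and [g / b], where [a] and [b] are the two
    integrals. Vanishing integrals are treated before infinite ones, so that no product of 0 and
    [+oo] arises. *)
Lemma int_hoelder f g D t : measurable D -> nnm f -> nnm g -> (0 < t < 1)%R ->
  \int[mu]_(x in D) (f x `^ t * g x `^ (1 - t)) <=
  (\int[mu]_(x in D) f x) `^ t * (\int[mu]_(x in D) g x) `^ (1 - t).
Proof.
move=> mD nf ng t01; have /andP[t0 t1] := t01.
have t1' : (0 < 1 - t)%R by rewrite subr_gt0.
have nfg : nnm (fun x => f x `^ t * g x `^ (1 - t)) by apply: nnm_mul; exact: nnm_pow.
have R0 : 0 <= (\int[mu]_(x in D) f x) `^ t * (\int[mu]_(x in D) g x) `^ (1 - t).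
  by rewrite mule_ge0// poweR_ge0.
have [F0|F0] := eqVneq (\int[mu]_(x in D) f x) 0.
  rewrite int_ae0//; have := int_eq0 mD nf F0; apply: filterS => x /[apply] ->.
  by rewrite poweR0r ?gt_eqF// mul0e.
have [G0|G0] := eqVneq (\int[mu]_(x in D) g x) 0.
  rewrite int_ae0//; have := int_eq0 mD ng G0; apply: filterS => x /[apply] ->.
  by rewrite poweR0r ?gt_eqF// mule0.
have Fp : 0 < \int[mu]_(x in D) f x by rewrite lt0e F0/= nnm_int_ge0.
have Gp : 0 < \int[mu]_(x in D) g x by rewrite lt0e G0/= nnm_int_ge0.
have [Fy|Fy] := eqVneq (\int[mu]_(x in D) f x) +oo.
  by rewrite Fy poweRyr ?gt_eqF// gt0_mulye ?leey// poweR_gt0.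
have [Gy|Gy] := eqVneq (\int[mu]_(x in D) g x) +oo.
  by rewrite Gy poweRyr ?gt_eqF// gt0_muley ?leey// poweR_gt0.
move: Fp Gp Fy Gy F0 G0 R0.
case EF : (\int[mu]_(x in D) f x) => [a| |]//; case EG : (\int[mu]_(x in D) g x) => [b| |]//.
rewrite !lte_fin => a0 b0 _ _ _ _ _; rewrite !poweR_EFin -EFinM.
set K := (a `^ t * b `^ (1 - t))%R.
have K0 : (0 <= K)%R by rewrite mulr_ge0 ?powR_ge0.
have Kt : (0 <= K * t / a)%R by rpos.
have Kt' : (0 <= K * (1 - t) / b)%R by rpos.
have nZ h c : nnm h -> (0 <= c)%R -> nnm (fun x => c%:E * h x).
  by move=> nh c0; apply: nnm_mul => //; apply: nnm_cst.
apply: (@le_trans _ _ (\int[mu]_(x in D)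
   ((K * t / a)%:E * f x + (K * (1 - t) / b)%:E * g x))).
  apply: le_int => //; first by apply: nnm_add; exact: nZ.
  move=> x _; have f0 := (nnm_ge0 nf) x; have g0 := (nnm_ge0 ng) x.
  have h (c e : R) (y : \bar R) : (0 < c)%R -> (0 < e)%R -> 0 <= y ->
      y `^ e = (c `^ e)%:E * ((c^-1)%:E * y) `^ e.
    move=> c0 e0 y0; have c1 : 0 <= (c^-1)%:E by rewrite lee_fin invr_ge0 ltW.
    rewrite (poweRM _ c1 y0) poweR_EFin muleA -EFinM -powRM ?divff ?gt_eqF//.
      by rewrite powR1 mul1e.
    exact: ltW.
  rewrite (h a t)// (h b (1 - t)%R)// muleACA -EFinM -/K.
  apply: (@le_trans _ _ (K%:E * (t%:E * ((a^-1)%:E * f x) +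
      (1 - t)%:E * ((b^-1)%:E * g x)))).
    apply: lee_wpmul2l; first by rewrite lee_fin.
    by apply: eyoung_poweR => //; rewrite mule_ge0// lee_fin invr_ge0 ltW.
  by rewrite ge0_muleDr ?muleA -?EFinM//; apply: mule_ge0 => //;
    rewrite lee_fin mulr_ge0// ?invr_ge0; exact: ltW.
rewrite intD//; [|exact: nZ|exact: nZ].
rewrite !intZ ?lee_fin// EF EG -!EFinM -EFinD lee_fin !mulfVK ?gt_eqF//.
by rewrite -mulrDr [(t + _)%R]addrC subrK mulr1.
Qed.

End nonneg_measurable.

Lemma powR_diff_le {R : realType} (p r s : R) : (1 < p -> 0 <= r -> r <= s ->
  s `^ p - r `^ p <= p / (p - 1) * (s * (s `^ (p - 1) - r `^ (p - 1))))%R.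
Proof.
move=> p1 r0 rs; have s0 : (0 <= s)%R := le_trans r0 rs.
have p0 : (0 < p)%R by lra.
have p10 : (0 < p - 1)%R by lra.
have := @conjugate_powR R s (r `^ (p - 1))%R p (p / (p - 1))%R s0 (powR_ge0 _ _) p0.
rewrite divr_gt0// invf_div => /(_ isT); have -> : (p^-1 + (p - 1) / p = 1)%R.
  by field; rewrite gt_eqF.
move=> /(_ erefl); rewrite -powRrM.
have -> : ((p - 1) * (p / (p - 1)) = p)%R by field; rewrite gt_eqF.
have ss : (s * s `^ (p - 1) = s `^ p)%R.
  rewrite -{1}(powRr1 s0) -powRD; first by rewrite addrC subrK.
  by rewrite addrC subrK gt_eqF.
set x := (s * _)%R => H.
rewrite mulrBr ss -/x -subr_ge0.
move: H; rewrite -subr_ge0 => H.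
have -> : (p / (p - 1) * (s `^ p - x) - (s `^ p - r `^ p) =
  (p - 1)^-1 * p * (s `^ p / p + r `^ p * ((p - 1) / p) - x))%R.
  by field; rewrite !gt_eqF.
by rewrite !mulr_ge0// ?invr_ge0 ltW.
Qed.

Lemma powR_absorb {R : realType} (p q x y : R) :
  (1 < p -> 0 < q -> 0 <= x -> 0 <= y ->
  x <= q * (y `^ p^-1 * x `^ (1 - p^-1)) -> x <= q `^ p * y)%R.
Proof.
move=> p1 q0; rewrite le_eqVlt => /predU1P[<- y0 _|x0 y0 H].
  by rewrite mulr_ge0 ?powR_ge0.
have p0 : (0 < p)%R by lra.
have {}H : (x `^ p^-1 <= q * y `^ p^-1)%R.
  rewrite -(ler_pM2r (powR_gt0 (1 - p^-1) x0)) -mulrA -powRD; last first.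
    by rewrite (gt_eqF x0) implybT.
  by rewrite addrC subrK powRr1// ltW.
have := ge0_ler_powR (ltW p0) _ _ H.
rewrite !nnegrE powR_ge0 mulr_ge0 ?powR_ge0 ?(ltW q0)// => /(_ isT isT).
rewrite powRM ?powR_ge0 ?(ltW q0)// -!powRrM mulVf ?gt_eqF// !powRr1//.
exact: ltW.
Qed.

(** * Doob's maximal inequality on nested partitions *)

Section filtration.
Context d (T : measurableType d) (R : realType) (mu : {measure set T -> \bar R}).
Context (g : nat -> T -> nat).
Hypothesis mg : forall k j, measurable [set x | g k x = j].
Hypothesis ng : forall k x y, g k.+1 x = g k.+1 y -> g k x = g k y.

(** A filtration is encoded by labels: [g k x] names the piece of generation [k] that contains [x],
    and [fib k x] is this piece. Labels are natural numbers, so each generation has countably many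
    pieces. *)
Definition fib k x := [set y | g k y = g k x].

Lemma measurable_fib k x : measurable (fib k x). Proof. exact: mg. Qed.

Lemma fib_refl k x : fib k x x. Proof. by []. Qed.

Lemma fib_eq k x y : g k x = g k y -> fib k x = fib k y.
Proof. by rewrite /fib => ->. Qed.

Lemma nested_le k m x y : (k <= m)%N -> g m x = g m y -> g k x = g k y.
Proof.
move=> /subnK <-; elim: (m - k)%N => [//|i IH]; rewrite addSn => /ng; exact: IH.
Qed.

Lemma measurable_fiberwise k d' (T' : measurableType d') (h : T -> T') :
  (forall x y, g k x = g k y -> h x = h y) -> measurable_fun [set: T] h.
Proof.
move=> hg _ B mB.
rewrite (_ : _ `&` _ = \bigcup_(j in [set j | exists2 x, g k x = j & B (h x)])
    [set x | g k x = j]); first by apply: bigcup_measurable => j _; exact: mg.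
apply/seteqP; split=> x /=.
  by move=> [_ Bx]; exists (g k x) => //; exists x.
by move=> [j [y <- By]] /= gxy; split=> //; rewrite /preimage/= (hg _ _ gxy).
Qed.

Lemma int_fibers k (h : T -> \bar R) : nnm h ->
  \int[mu]_x h x = \sum_(0 <= j <oo) \int[mu]_(x in [set x | g k x = j]) h x.
Proof.
move=> /nnmP[mh h0]; rewrite -ge0_integral_bigcup//.
- by congr integral; apply/seteqP; split=> // x _; exists (g k x).
- exact: measurable_funTS.
- by move=> i j _ _ [x [/= <- <-]].
Qed.

Section weighted.
Context (u : T -> R).
Hypothesis mu_ : measurable_fun [set: T] u.
Hypothesis u0 : forall x, (0 < u x)%R.
Hypothesis ufib : forall k x, 0 < \int[mu]_(y in fib k x) (u y)%:E < +oo.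

Let nu : nnm (fun x => (u x)%:E).
Proof. by apply: nnm_EFin => // x; exact: ltW. Qed.

Definition cav k (f : T -> \bar R) x : \bar R :=
  (\int[mu]_(y in fib k x) (u y)%:E)^-1 *
  \int[mu]_(y in fib k x) (f y * (u y)%:E).

Lemma ufibE k x :
  exists2 a : R, (0 < a)%R & \int[mu]_(y in fib k x) (u y)%:E = a%:E.
Proof.
move: (ufib k x); case: (\int[mu]_(y in _) _) => [a| |]//; rewrite ?ltxx ?andbF//.
by move=> /andP[a0 _]; exists a.
Qed.

Lemma cav_ge0 k f x : nnm f -> 0 <= cav k f x.
Proof.
move=> nf; rewrite /cav mule_ge0 ?inve_ge0//; first exact: nnm_int_ge0.
by apply: nnm_int_ge0; exact: nnm_mul.
Qed.

Lemma cav_fiberwise k f x y : g k x = g k y -> cav k f x = cav k f y.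
Proof. by rewrite /cav /fib => ->. Qed.

Lemma nnm_cav k f : nnm f -> nnm (cav k f).
Proof.
move=> nf; apply/nnmP; split; last by move=> x; exact: cav_ge0.
exact: measurable_fiberwise (@cav_fiberwise k f).
Qed.

(** The defining property of conditional expectation: on each piece [c] and the average are
    constant, and the average has the same integral as [f]. Summing over the pieces gives the
    claim. *)
Lemma int_cav k (c f : T -> \bar R) : nnm c ->
  (forall x y, g k x = g k y -> c x = c y) -> nnm f ->
  \int[mu]_x (c x * cav k f x * (u x)%:E) = \int[mu]_x (c x * f x * (u x)%:E).
Proof.
move=> nc cg nf.
have nfu := nnm_mul nf nu.
rewrite (int_fibers k); last by apply: nnm_mul => //; apply: nnm_mul => //; exact: nnm_cav.
rewrite (int_fibers k); last by apply: nnm_mul => //; exact: nnm_mul.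
apply: eq_eseriesr => j _.
have [[x0 x0j]|nex] := pselect (exists x, g k x = j); last first.
  rewrite (_ : [set x | g k x = j] = set0) ?integral_set0//.
  by apply/seteqP; split=> // x xj; apply: nex; exists x.
have -> : [set x | g k x = j] = fib k x0 by rewrite /fib x0j.
transitivity (\int[mu]_(x in fib k x0) (c x0 * cav k f x0 * (u x)%:E)).
  apply: eq_integral => x; rewrite inE => xx0.
  by rewrite (cg _ _ xx0) (cav_fiberwise f xx0).
transitivity (\int[mu]_(x in fib k x0) (c x0 * (f x * (u x)%:E))); last first.
  by apply: eq_integral => x; rewrite inE => xx0; rewrite muleA (cg _ _ xx0).
rewrite !intZ//; [|exact: measurable_fib|exact: (nnm_ge0 nc)|exact: measurable_fib|
  by rewrite mule_ge0// ?(nnm_ge0 nc)// cav_ge0].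
rewrite /cav -!muleA; congr (_ * _).
have [a a0 ->] := ufibE k x0.
by rewrite muleCA mulVe ?mule1// gt_eqF.
Qed.

(** Hoelder's inequality for [f^p u] and [u] with exponents [1/p] and [1 - 1/p]. *)
Lemma cav_jensen k f p x : (1 < p)%R -> nnm f ->
  cav k f x `^ p <= cav k (fun y => f y `^ p) x.
Proof.
move=> p1 nf; have p0 : (0 < p)%R by lra.
have t01 : (0 < p^-1 < 1)%R by rewrite invr_gt0 p0 invf_lt1.
have nfp := nnm_mul (nnm_pow p nf) nu.
have [a a0 ua] := ufibE k x.
have := int_hoelder mu (measurable_fib k x) nfp nu t01; rewrite ua.
have -> : \int[mu]_(y in fib k x) ((f y `^ p * (u y)%:E) `^ p^-1 * (u y)%:E `^ (1 - p^-1))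
   = \int[mu]_(y in fib k x) (f y * (u y)%:E).
  apply: eq_integral => y _; rewrite poweRM ?poweR_ge0//; last first.
    by rewrite lee_fin ltW.
  rewrite -poweRrM divff ?gt_eqF// poweRe1 ?(nnm_ge0 nf)// -muleA; congr (_ * _).
  rewrite !poweR_EFin -EFinM -powRD; last by rewrite addrC subrK oner_eq0.
  by rewrite addrC subrK powRr1// ltW.
rewrite /cav ua inver gt_eqF// => H.
set I := \int[mu]_(y in fib k x) (f y * (u y)%:E) in H *.
set J := \int[mu]_(y in fib k x) (f y `^ p * (u y)%:E) in H *.
have I0 : 0 <= I by apply: nnm_int_ge0; exact: nnm_mul.
have J0 : 0 <= J by exact: nnm_int_ge0.
have ai : 0 <= (a^-1)%:E by rewrite lee_fin invr_ge0 ltW.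
rewrite poweRM//.
apply: (@le_trans _ _ ((a^-1)%:E `^ p * (J `^ p^-1 * a%:E `^ (1 - p^-1)) `^ p)).
  by rewrite lee_wpmul2l ?poweR_ge0// lee_poweR// ltW.
rewrite poweRM ?poweR_ge0// -!poweRrM mulVf ?gt_eqF// poweRe1//.
rewrite muleCA muleC !poweR_EFin -EFinM.
rewrite -powR_inv1 ?(ltW a0)// -powRrM -powRD; last by rewrite (gt_eqF a0) implybT.
have -> : (-1 * p + (1 - p^-1) * p = -1)%R by field; rewrite gt_eqF.
by rewrite powR_inv1 ?(ltW a0).
Qed.

Lemma int_cav_pow k f p : (1 < p)%R -> nnm f ->
  \int[mu]_x (cav k f x `^ p * (u x)%:E) <= \int[mu]_x (f x `^ p * (u x)%:E).
Proof.
move=> p1 nf; have nfp := nnm_pow p nf.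
have := @int_cav k (fun=> 1) (fun y => f y `^ p) (@nnm_cst _ _ _ _ lee01) (fun _ _ _ => erefl) nfp.
under eq_integral do rewrite mul1e.
under [RHS]eq_integral do rewrite mul1e.
move=> <-; apply: le_intT.
- by apply: nnm_mul => //; apply: nnm_pow; exact: nnm_cav.
- by apply: nnm_mul => //; exact: nnm_cav.
- by move=> x; rewrite lee_wpmul2r ?(nnm_ge0 nu)//; exact: cav_jensen.
Qed.

Fixpoint runmax f n x : \bar R :=
  if n is m.+1 then maxe (runmax f m x) (cav m.+1 f x) else cav 0 f x.

Lemma cav_le_runmax f n x k : (k <= n)%N -> cav k f x <= runmax f n x.
Proof.
elim: n => [|n IH]; first by rewrite leqn0 => /eqP ->.
rewrite leq_eqVlt => /orP[/eqP ->|/IH kn] /=; rewrite le_max ?lexx ?orbT//.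
by rewrite kn.
Qed.

Lemma runmax_fiberwise f n x y : g n x = g n y -> runmax f n x = runmax f n y.
Proof.
elim: n x y => [|n IH] x y gxy /=; first exact: cav_fiberwise.
by rewrite (IH x y (ng gxy)) (cav_fiberwise f gxy).
Qed.

Lemma nnm_runmax f n : nnm f -> nnm (runmax f n).
Proof.
move=> nf; apply/nnmP; split.
  by apply: (@measurable_fiberwise n) => x y; exact: runmax_fiberwise.
move=> x; apply: le_trans (cav_ge0 0 x nf) _; exact: cav_le_runmax.
Qed.

Lemma runmax_fin f n x : nnm f -> (forall k, cav k f x < +oo) ->
  runmax f n x \is a fin_num.
Proof.
move=> nf fin; rewrite ge0_fin_numE; last exact: (nnm_ge0 (nnm_runmax n nf)).
by elim: n => [|n IH] /=; rewrite ?gt_max ?IH ?fin.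
Qed.

(** If the maximum does not grow, the increment is zero. If it grows, its new value is the current
    average, and [powR_diff_le] applies with that value as [s]. *)
Lemma runmax_step f n x p : (1 < p)%R -> nnm f -> (forall k, cav k f x < +oo) ->
  0 <= runmax f n.+1 x `^ (p - 1) - runmax f n x `^ (p - 1) /\
  runmax f n.+1 x `^ p <= runmax f n x `^ p + (p / (p - 1))%:E *
    ((runmax f n.+1 x `^ (p - 1) - runmax f n x `^ (p - 1)) * cav n.+1 f x).
Proof.
move=> p1 nf fin; have := runmax_fin n.+1 nf fin; have := runmax_fin n nf fin.
have p10 : (0 <= p - 1)%R by lra.
rewrite /=; have := (nnm_ge0 (nnm_runmax n nf)) x; have := cav_ge0 n.+1 x nf.
have := fin n.+1; move: (runmax f n x) (cav n.+1 f x) => [s| |]// [c| |]// _.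
rewrite !lee_fin => c0 s0 _ _; rewrite -EFin_max !poweR_EFin -EFinB -!EFinM -EFinD !lee_fin.
have [cs|sc] := leP c s; first by rewrite subrr mul0r mulr0 addr0.
rewrite subr_ge0 ge0_ler_powR ?nnegrE ?(ltW sc)//; split=> //.
rewrite -lerBlDl [X in (_ <= _ * X)%R]mulrC; apply: powR_diff_le => //.
exact: ltW.
Qed.

(** The increment [D] of [S^(p-1)] is constant on the pieces of generation [n.+1], so [int_cav]
    replaces the average multiplying it by [f] itself; the increments then telescope. *)
Lemma doob_runmax f n p : (1 < p)%R -> nnm f -> (forall k x, cav k f x < +oo) ->
  \int[mu]_x (runmax f n x `^ p * (u x)%:E) <=
  (p / (p - 1))%:E * \int[mu]_x (runmax f n x `^ (p - 1) * f x * (u x)%:E).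
Proof.
move=> p1 nf fin; have p10 : (0 < p - 1)%R by lra.
have q1 : (1 <= p / (p - 1))%R by rewrite ler_pdivlMr// mul1r; lra.
have q0 : (0 <= p / (p - 1))%R by exact: le_trans q1.
have nS k r : nnm (fun x => runmax f k x `^ r) by apply: nnm_pow; exact: nnm_runmax.
elim: n => [|n IH] /=.
  apply: (@le_trans _ _ (\int[mu]_x (cav 0 f x `^ (p - 1) * f x * (u x)%:E))).
    rewrite -(@int_cav 0 _ f (nS 0%N (p - 1)%R))//; last first.
      by move=> x y gxy /=; rewrite (cav_fiberwise f gxy).
    rewrite le_eqVlt; apply/orP; left; apply/eqP; apply: eq_integral => x _.
    congr (_ * _); rewrite -[X in _ = _ * X]poweRe1 ?cav_ge0//.
    rewrite -poweRD ?subrK// add_neq0_poweRD_def// subrK gt_eqF//; lra.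
  apply: lee_pemull => //; apply: nnm_int_ge0; do 2 apply: nnm_mul => //.
  exact: (nS 0%N).
pose D x := runmax f n.+1 x `^ (p - 1) - runmax f n x `^ (p - 1).
have D0 x : 0 <= D x := (runmax_step n p1 nf (fin^~ x)).1.
have Dg x y : g n.+1 x = g n.+1 y -> D x = D y.
  move=> gxy; rewrite /D (runmax_fiberwise f gxy).
  by rewrite (@runmax_fiberwise f n x y)// (ng gxy).
have nD : nnm D.
  by apply/nnmP; split=> //; exact: measurable_fiberwise Dg.
have nDc : nnm (fun x => D x * cav n.+1 f x) by apply: nnm_mul => //; exact: nnm_cav.
have nZ h : nnm h -> nnm (fun x => (p / (p - 1))%:E * h x).
  by move=> nh; apply: nnm_mul => //; apply: nnm_cst.
apply: (@le_trans _ _ (\int[mu]_x (runmax f n x `^ p * (u x)%:E +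
    (p / (p - 1))%:E * (D x * cav n.+1 f x * (u x)%:E)))).
  apply: le_intT.
  - by apply: nnm_mul => //; exact: (nS n.+1).
  - by apply: nnm_add; [exact: nnm_mul|apply: nZ; exact: nnm_mul].
  move=> x; rewrite muleA -ge0_muleDl ?poweR_ge0//; last first.
    by rewrite mule_ge0//; exact: (nnm_ge0 nDc).
  by rewrite lee_wpmul2r ?(nnm_ge0 nu)//; exact: (runmax_step n p1 nf (fin^~ x)).2.
rewrite intD//; [|exact: nnm_mul|by apply: nZ; exact: nnm_mul].
rewrite intZ//; last exact: nnm_mul.
rewrite (int_cav nD Dg nf) (le_trans (leeD2r _ IH))//.
rewrite -ge0_muleDr; last 2 first.
- by apply: nnm_int_ge0; do 2 apply: nnm_mul => //.
- by apply: nnm_int_ge0; do 2 apply: nnm_mul => //.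
rewrite lee_wpmul2l// -intD//; last 2 first.
- by do 2 apply: nnm_mul => //.
- by do 2 apply: nnm_mul => //.
rewrite le_eqVlt; apply/orP; left; apply/eqP; apply: eq_integral => x _.
rewrite -ge0_muleDl ?mule_ge0 ?poweR_ge0 ?(nnm_ge0 nf)//; congr (_ * _).
rewrite -ge0_muleDl ?poweR_ge0//; congr (_ * _).
rewrite /D addeC subeK// fin_num_poweR//.
exact: (runmax_fin n nf (fin^~ x)).
Qed.

(* Doob's inequality: the increments of [S^(p-1)], where [S] is the running
   maximum, are supported where [S] equals the current average, so that
   [int S^p u <= p' int S^(p-1) f u], and Hoelder's inequality closes. *)
Lemma doob_maximal f n p : (1 < p)%R -> nnm f ->
  \int[mu]_x (runmax f n x `^ p * (u x)%:E) <=
  ((p / (p - 1)) `^ p)%:E * \int[mu]_x (f x `^ p * (u x)%:E).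
Proof.
move=> p1 nf; have p10 : (0 < p - 1)%R by lra.
have p0 : (0 < p)%R by lra.
have q0 : (0 < p / (p - 1))%R by rewrite divr_gt0.
have nfp := nnm_mul (nnm_pow p nf) nu.
set F := \int[mu]_x (f x `^ p * (u x)%:E).
have F0 : 0 <= F by exact: nnm_int_ge0.
have [->|Fy] := eqVneq F +oo; first by rewrite gt0_muley ?leey// lte_fin powR_gt0.
have Ffin : F < +oo by rewrite ltey.
have fin k x : cav k f x < +oo.
  apply: (@lty_poweRy _ _ p); first by rewrite gt_eqF.
  apply: le_lt_trans (cav_jensen k x p1 nf) _.
  have [a a0 ua] := ufibE k x; rewrite /cav ua inver gt_eqF// lte_mul_pinfty//.
    by rewrite lee_fin invr_ge0 ltW.
  apply: le_lt_trans Ffin; apply: le_int_set => //; exact: measurable_fib.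
have nS k r : nnm (fun x => runmax f k x `^ r) by apply: nnm_pow; exact: nnm_runmax.
have nSu k r := nnm_mul (nS k r) nu.
set I := \int[mu]_x (runmax f n x `^ p * (u x)%:E).
have I0 : 0 <= I by exact: nnm_int_ge0.
(* The final absorption divides by a power of [I], so [I] must be finite; this follows crudely by
   bounding the power of a maximum by the sum of the powers. *)
have Ifin : I < +oo.
  rewrite /I; elim: (n) => [|m IH].
    by apply: le_lt_trans Ffin; exact: int_cav_pow.
  have nc := nnm_mul (nnm_pow p (nnm_cav m.+1 nf)) nu.
  apply: (@le_lt_trans _ _ (\int[mu]_x (runmax f m x `^ p * (u x)%:E +
      cav m.+1 f x `^ p * (u x)%:E))).
    apply: le_intT; [exact: (nSu m.+1)|exact: nnm_add|].
    move=> x; rewrite -ge0_muleDl ?poweR_ge0// lee_wpmul2r ?(nnm_ge0 nu)//=.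
    by case: (leP (runmax f m x)) => _; rewrite ?leeDl ?leeDr ?poweR_ge0.
  rewrite intD// lte_add_pinfty//; apply: le_lt_trans Ffin; exact: int_cav_pow.
have t01 : (0 < p^-1 < 1)%R by rewrite invr_gt0 p0 invf_lt1.
have := int_hoelder mu measurableT nfp (nSu n p) t01; rewrite -/F -/I.
under eq_integral => x _.
  rewrite poweRM ?poweR_ge0 ?(nnm_ge0 nu)// -poweRrM divff ?gt_eqF// poweRe1 ?(nnm_ge0 nf)//.
  rewrite poweRM ?poweR_ge0 ?(nnm_ge0 nu)// muleACA.
  rewrite -poweRrM (_ : p * (1 - p^-1) = p - 1)%R; last by field; rewrite gt_eqF.
  rewrite (_ : (u x)%:E `^ p^-1 * (u x)%:E `^ (1 - p^-1) = (u x)%:E); last first.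
    rewrite !poweR_EFin -EFinM -powRD; last by rewrite addrC subrK oner_eq0.
    by rewrite addrC subrK powRr1// ltW.
  rewrite [X in X * _]muleC.
  over.
move=> H; have := doob_runmax n p1 nf fin; rewrite -/I => HI.
have q0' : 0 <= (p / (p - 1))%:E by rewrite lee_fin ltW.
have {H}HI := le_trans HI (lee_wpmul2l q0' H).
move: I0 F0 Ifin Ffin HI; case: (I) => [i| |]//; case: (F) => [b| |]//.
rewrite !poweR_EFin -!EFinM !lee_fin => i0 b0 _ _; exact: powR_absorb.
Qed.

End weighted.
End filtration.

(** * Cubes and dyadic grids *)

Section cubes_measure.
Context {R : realType} {n : nat}.
Local Notation V := ('rV[R]_n.+1).
Local Notation T := (Rn R n).
Local Notation mu := (@lebesgue_Rn R n).

(** Half-open cubes are used because they form partitions; the open cubes of the weight constants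
    differ from them by null sets. *)
Definition hcube (b : V) (s : R) : set V :=
  [set y | forall i, (b 0%R i <= y 0%R i < b 0%R i + s)%R].

Lemma box_vol_cube (a : V) (s : R) : (0 <= s)%R ->
  box_vol a (a + const_mx s)%R = (s ^+ n.+1)%R.
Proof.
move=> s0; rewrite /box_vol (eq_bigr (fun=> s)); last first.
  by move=> i _; rewrite !mxE [(_ + s)%R]addrC addrK max_r.
by rewrite prodr_const card_ord.
Qed.

Lemma measurable_hcube (b : V) s : measurable (hcube b s : set T).
Proof.
rewrite (_ : hcube b s = \bigcap_(i in [set: 'I_n.+1])
    ((fun x : T => (x : V) 0%R i) @^-1` `[b 0%R i, (b 0%R i + s)%R[)); last first.
  apply/seteqP; split=> x /= bx i; last by have := bx i I; rewrite /= in_itv.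
  by move=> _ /=; rewrite in_itv; exact: bx.
apply: fin_bigcap_measurable => // i _.
by rewrite -[_ @^-1` _]setTI; exact: measurable_coord.
Qed.

Lemma box_sub_hcube (b : V) s : box b (b + const_mx s)%R `<=` hcube b s.
Proof.
move=> y by_ i; have /andP[b1 b2] := by_ i; rewrite ltW//=.
by move: b2; rewrite !mxE.
Qed.

(** For the upper bound the cube is enclosed in an open one of side [s + dl / 2], and [dl] comes
    from continuity of the power. *)
Lemma lebesgue_Rn_hcube (b : V) s : (0 < s)%R ->
  mu (hcube b s) = (s ^+ n.+1)%:E.
Proof.
move=> s0; apply/eqP; rewrite eq_le; apply/andP; split; last first.
  rewrite -(box_vol_cube b (ltW s0)) -lebesgue_Rn_box.
  apply: le_measure; rewrite ?inE; [exact: measurable_box|exact: measurable_hcube|].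
  exact: box_sub_hcube.
apply/lee_addgt0Pr => e e0.
have /cvgrPdist_lt/(_ e e0)/nbhs_ballP[dl /= dl0 H] := @exprn_continuous R n.+1 s.
have dl2 : (0 < dl / 2)%R by rewrite divr_gt0.
have /H/= : ball s dl (s + dl / 2)%R.
  rewrite /ball/= opprD addNKr normrN gtr0_norm//; lra.
rewrite distrC => /ltr_distlDr/ltW {}H.
apply: (@le_trans _ _ (mu (box (b - const_mx (dl / 2)) (b + const_mx s))%R)).
  apply: le_measure; rewrite ?inE; [exact: measurable_hcube|exact: measurable_box|].
  move=> y by_ i; have /andP[b1 b2] := by_ i.
  by rewrite !mxE b2 andbT ltrBlDr (le_lt_trans b1)// ltrDl.
rewrite lebesgue_Rn_box -EFinD lee_fin.
rewrite (_ : (b + const_mx s = (b - const_mx (dl / 2)) + const_mx (s + dl / 2))%R).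
  by rewrite box_vol_cube// addr_ge0// ltW.
by apply/rowP => i; rewrite !mxE [(s + _)%R]addrC addrA subrK.
Qed.

Lemma lebesgue_Rn_cube (a : V) s : (0 < s)%R ->
  mu (box a (a + const_mx s)%R) = (s ^+ n.+1)%:E.
Proof. by move=> s0; rewrite lebesgue_Rn_box box_vol_cube// ltW. Qed.

Lemma hcube_diff_null (b : V) s : (0 < s)%R ->
  mu (hcube b s `\` box b (b + const_mx s)%R) = 0.
Proof.
move=> s0; rewrite measureD ?lebesgue_Rn_hcube ?ltry//.
- rewrite setIidr; last exact: box_sub_hcube.
  by rewrite [X in X - _]lebesgue_Rn_hcube// [X in _ - X]lebesgue_Rn_cube// subee.
- exact: measurable_hcube.
- exact: measurable_box.
- by rewrite [X in X < _]lebesgue_Rn_hcube// ltry.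
Qed.

Lemma int_hcube (b : V) s (f : T -> \bar R) : (0 < s)%R -> nnm f ->
  \int[mu]_(x in hcube b s) f x = \int[mu]_(x in box b (b + const_mx s)%R) f x.
Proof.
move=> s0 nf; have mh := measurable_hcube b s.
have mb := measurable_box b (b + const_mx s)%R.
rewrite -{1}(setDUK (@box_sub_hcube b s)) ge0_integral_setU//.
- rewrite [X in _ + X](_ : _ = 0) ?adde0//.
  apply: int_ae0 => //; first exact: measurableD.
  exists (hcube b s `\` box b (b + const_mx s)%R); split.
  + exact: measurableD.
  + exact: hcube_diff_null.
  + by move=> x /= /not_implyP[].
- exact: measurableD.
- by apply: measurable_funTS; exact: (nnm_m nf).
- by move=> x _; exact: (nnm_ge0 nf).
- by apply/disj_setPS => x [bx [_ /(_ bx)]].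
Qed.

End cubes_measure.

Section grid.
Context {R : realType} {n : nat}.
Local Notation V := ('rV[R]_n.+1).
Local Notation T := (Rn R n).
Local Notation mu := (@lebesgue_Rn R n).
Context (a : V) (l : R) (c : nat -> 'I_n.+1 -> R).
Hypothesis l0 : (0 < l)%R.
Hypothesis cE : forall k i, exists z : int, (c k.+1 i = 2 * c k i - z%:~R)%R.

Definition gcoord k (x : V) i : R := ((x 0 i - a 0 i) / l * 2 ^+ k + c k i)%R.

(** The dyadic grid with root side [l], origin [a] and shift [c k] at generation [k], measured in
    units of the side. The vector of integer parts is coded by a natural number to provide a
    label. *)
Definition grid k (x : T) : nat :=
  pickle [ffun i : 'I_n.+1 => Num.floor (gcoord k x i)].

Lemma grid_eqP k x y : grid k x = grid k y <->
  forall i, Num.floor (gcoord k x i) = Num.floor (gcoord k y i).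
Proof.
split=> [/(pcan_inj pickleK)/ffunP H i|H]; first by have := H i; rewrite !ffunE.
by congr pickle; apply/ffunP => i; rewrite !ffunE.
Qed.

(** By [cE] a coordinate doubles up to an integer from one generation to the next, and the integer
    part of [2 * X] determines that of [X]. *)
Lemma grid_nested k x y : grid k.+1 x = grid k.+1 y -> grid k x = grid k y.
Proof.
move=> /grid_eqP H; apply/grid_eqP => i; have := H i.
have [z cz] := cE k i.
have gS w : gcoord k.+1 w i = (2 * gcoord k w i - z%:~R)%R.
  by rewrite /gcoord cz exprS; ring.
rewrite !gS -!mulrNz (@floorDrz _ (2 * gcoord k x i)%R) ?intr_int//.
rewrite (@floorDrz _ (2 * gcoord k y i)%R) ?intr_int// => /addIr.
move: (gcoord k x i) (gcoord k y i) => X Y XY; apply/esym/floor_def.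
have /andP[X1 X2] := floor_itv X.
have : (2 * Num.floor X <= Num.floor (2 * X))%R.
  by rewrite floor_ge_int intrM ler_pM2l.
have : (Num.floor (2 * X) < 2 * (Num.floor X + 1))%R.
  by rewrite floor_lt_int intrM ltr_pM2l.
rewrite XY floor_ge_int floor_lt_int !intrM ltr_pM2l// ler_pM2l//.
by move=> -> ->.
Qed.

Definition corner k (x : V) : V :=
  (\row_i (a 0 i + l / 2 ^+ k * ((Num.floor (gcoord k x i))%:~R - c k i)))%R.

Definition side k : R := (l / 2 ^+ k)%R.

Lemma side_gt0 k : (0 < side k)%R.
Proof. by rewrite divr_gt0// exprn_gt0. Qed.

Lemma fib_grid k x : fib grid k x = hcube (corner k x) (side k).
Proof.
have ge0 : (2 ^+ k != 0 :> R)%R by rewrite expf_neq0.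
have P (y : V) i : (corner k x 0 i <= y 0 i < corner k x 0 i + side k)%R =
    (Num.floor (gcoord k y i) == Num.floor (gcoord k x i)).
  rewrite floor_eq mxE intrD -/(side k); set m := ((Num.floor _)%:~R)%R.
  have -> : (y 0 i = a 0 i + side k * (gcoord k y i - c k i))%R.
    by rewrite /gcoord /side; field; rewrite ge0 gt_eqF.
  have -> : (a 0 i + side k * (m - c k i) + side k =
    a 0 i + side k * (m + 1 - c k i))%R by ring.
  by rewrite lerD2l ltrD2l ler_pM2l ?ltr_pM2l ?side_gt0// lerD2r ltrD2r.
apply/seteqP; split=> y.
  by move=> /grid_eqP H i; rewrite P H.
by move=> H; apply/grid_eqP => i; apply/eqP; rewrite -P; exact: H.
Qed.

Lemma measurable_grid k j : measurable [set x | grid k x = j].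
Proof.
have [[x <-]|nex] := pselect (exists x, grid k x = j).
  by rewrite -/(fib grid k x) fib_grid; exact: measurable_hcube.
rewrite (_ : [set x | _] = set0)//.
by apply/seteqP; split=> // x xj; apply: nex; exists x.
Qed.

Lemma mu_fib k x : mu (fib grid k x) = (side k ^+ n.+1)%:E.
Proof. by rewrite fib_grid lebesgue_Rn_hcube// side_gt0. Qed.

Lemma fib_small (x : V) (e : R) : (0 < e)%R -> exists k, forall y,
  fib grid k x y -> forall i, (`|y 0 i - x 0 i| < e)%R.
Proof.
move=> e0; have [k ke] : exists k, (side k < e)%R.
  exists (Num.truncn (l / e)).+1; rewrite /side ltr_pdivrMr ?exprn_gt0//.
  rewrite -ltr_pdivrMl// mulrC.
  apply: (@lt_trans _ _ ((Num.truncn (l / e)).+1)%:R).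
    by rewrite truncnS_gt.
  by rewrite -natrX ltr_nat ltn_expl.
exists k => y xy i; apply: le_lt_trans ke.
have xx := fib_refl grid k x.
move: xy xx; rewrite !fib_grid => /(_ i) /andP[y1 y2] /(_ i) /andP[x1 x2].
by rewrite ler_norml; apply/andP; split; lra.
Qed.

Lemma fib_sub_open (U : set V) (x : V) : open U -> U x ->
  exists k, fib grid k x `<=` U.
Proof.
rewrite openE => /[apply]; rewrite /interior /= => /nbhs_ballP[e /= e0 H].
have [k ke] := fib_small x e0; exists k => y /ke {}ke; apply: H.
by split=> // i j; rewrite ord1 /ball/= distrC; exact: ke.
Qed.

(** An open set is the union of the grid cubes it contains, and those of one generation form a
    measurable set. *)
Lemma open_measurable (U : set V) : open U -> measurable (U : set T).
Proof.
move=> oU; rewrite (_ : U = \bigcup_k [set x | fib grid k x `<=` U]); last first.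
  apply/seteqP; split=> x; first by move=> /(fib_sub_open oU)[k]; exists k.
  by move=> [k _] /=; apply; exact: fib_refl.
apply: bigcup_measurable => k _.
rewrite -[X in measurable X]setTI.
rewrite (_ : [set x | _] = (fun x => `[<fib grid k x `<=` U>]) @^-1` [set true]).
  apply: (@measurable_fiberwise _ _ grid measurable_grid k) => // x y gxy.
  by rewrite (fib_eq gxy).
by apply/seteqP; split=> x /= /asboolP.
Qed.

End grid.

(** * Monotone limits and powers of suprema and sums *)

Section monotone_sup.
Context d (T : measurableType d) (R : realType) (mu : {measure set T -> \bar R}).

Lemma int_sup_le (h : nat -> T -> \bar R) (B : \bar R) :
  (forall m, nnm (h m)) -> (forall x, {homo h ^~ x : m k / (m <= k)%N >-> m <= k}) ->
  (forall m, \int[mu]_x h m x <= B) ->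
  \int[mu]_x ereal_sup (range (h ^~ x)) <= B.
Proof.
move=> nh hh hB.
have E x : ereal_sup (range (h ^~ x)) = limn (h ^~ x).
  by apply/esym/cvg_lim => //; exact: ereal_nondecreasing_cvgn.
under eq_integral do rewrite E.
have := @cvg_monotone_convergence _ _ _ mu setT measurableT h
  (fun m => (nnm_m (nh m))) (fun m x _ => (nnm_ge0 (nh m)) x) (fun x _ => hh x).
move=> /cvg_lim <-//; apply: lime_le; last by apply: nearW => m; exact: hB.
apply: ereal_nondecreasing_is_cvgn => m k mk; apply: le_intT => //.
by move=> x; exact: hh.
Qed.

(* junk values: [x `^ p] at [x = +oo] is [+oo] for every [p != 0] *)
Lemma poweR_sup_le (S : nat -> \bar R) (p : R) (Y : \bar R) : (0 < p)%R ->
  (forall m, 0 <= S m) -> (forall m, S m `^ p <= Y) ->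
  ereal_sup (range S) `^ p <= Y.
Proof.
move=> p0 S0 H; have Y0 : 0 <= Y := le_trans (poweR_ge0 _ _) (H 0%N).
have pn0 : p != 0%R by rewrite gt_eqF.
rewrite -[leRHS](poweRe1 Y0) -(mulVf pn0) poweRrM.
apply: lee_poweR; [exact: ltW| |].
  by apply: (@le_trans _ _ (S 0%N)) => //; exact: ereal_sup_ubound.
apply: ge_ereal_sup => _ [m _ <-].
rewrite -[leLHS]poweRe1// -(mulfV pn0) poweRrM.
by apply: lee_poweR => //; [rewrite invr_ge0 ltW|exact: poweR_ge0].
Qed.

End monotone_sup.

Lemma poweR_sum_le {R : realType} (I : finType) (x : I -> \bar R) (p : R) :
  (0 < p)%R -> (forall i, 0 <= x i) ->
  (\sum_i x i) `^ p <= ((#|I|)%:R `^ p)%:E * \sum_i x i `^ p.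
Proof.
move=> p0 x0; have [i0|noI] := pickP (@predT I); last first.
  rewrite big_pred0// poweR0r ?gt_eqF// mule_ge0// ?lee_fin ?powR_ge0//.
  by apply: sume_ge0 => i _; exact: poweR_ge0.
move=> _; have [j _ jmax] := @Order.TotalTheory.arg_maxP _ _ I i0 predT x isT.
have : \sum_i x i <= (#|I|)%:R%:E * x j.
  rewrite (_ : (#|I|)%:R%:E * x j = \sum_(i : I) x j).
    by apply: lee_sum => i _; exact: jmax.
  by rewrite sumr_const mule_natl.
move=> H; apply: le_trans (lee_poweR (ltW p0) _ H) _; first exact: sume_ge0.
rewrite poweRM ?lee_fin//; apply: lee_wpmul2l; first by rewrite lee_fin powR_ge0.
rewrite (bigD1 j)//= leeDl// sume_ge0// => i _; exact: poweR_ge0.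
Qed.

(** * Adjacent dyadic grids shifted by one third *)

Section third_grids.
Context {R : realType} {n : nat}.
Local Notation V := ('rV[R]_n.+1).
Local Notation T := (Rn R n).
Local Notation mu := (@lebesgue_Rn R n).
Local Notation dirs := {ffun 'I_n.+1 -> bool}.

(** The directions selected by [al] are shifted by a third of the side. The sign alternates with the
    generation, which makes the grids nested because 2/3 - 1 = -1/3; including [N] in the sign makes
    grids with different root sides compatible. *)
Definition third_shift (al : dirs) N k (i : 'I_n.+1) : R :=
  (if al i then (-1) ^+ (k + N) / 3 else 0)%R.

Lemma third_shiftE al N k i :
  exists z : int, (third_shift al N k.+1 i = 2 * third_shift al N k i - z%:~R)%R.
Proof.
rewrite /third_shift; case: (al i); last by exists 0%R; rewrite subr0 mulr0.
exists ((-1) ^+ (k + N))%R; rewrite addSn exprS rmorphXn/= rmorphN1.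
by field.
Qed.

Definition tgrid al N : nat -> T -> nat :=
  grid 0%R (2 ^+ N)%R (third_shift al N).

Lemma exp2_gt0 N : (0 < 2 ^+ N :> R)%R. Proof. by rewrite exprn_gt0. Qed.

Lemma measurable_tgrid al N k j : measurable [set x | tgrid al N k x = j].
Proof. by rewrite /tgrid; apply: measurable_grid; exact: exp2_gt0. Qed.

Lemma tgrid_nested al N k x y :
  tgrid al N k.+1 x = tgrid al N k.+1 y -> tgrid al N k x = tgrid al N k y.
Proof. exact: (grid_nested (third_shiftE al N)). Qed.

(** Doubling the root and descending one generation gives the same partition: the grids for all [N]
    are parts of a single grid without a root. *)
Lemma tgridS al N k x : tgrid al N.+1 k.+1 x = tgrid al N k x.
Proof.
congr pickle; apply/ffunP => i; rewrite !ffunE; congr Num.floor.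
rewrite /gcoord /third_shift; congr (_ + _)%R.
  by rewrite !exprS; field; rewrite gt_eqF// exp2_gt0.
by case: (al i) => //; rewrite addSn addnS !exprS !mulN1r opprK.
Qed.

Lemma fib_tgridS al N k x : fib (tgrid al N.+1) k.+1 x = fib (tgrid al N) k x.
Proof. by rewrite /fib; apply/seteqP; split=> y /=; rewrite !tgridS. Qed.

Lemma fib_tgridD al N k j x :
  fib (tgrid al (N + j)) (k + j) x = fib (tgrid al N) k x.
Proof. by elim: j => [|j IH]; rewrite ?addn0// !addnS fib_tgridS. Qed.

(** If a grid point separates [X] and [Y], both lie within a third of it, and after a shift by a
    third in either direction no grid point separates them. *)
Lemma third_trick (X Y : R) (e : R) : (e = 1 / 3 \/ e = - (1 / 3) ->
  X <= Y -> Y - X < 1 / 3 ->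
  Num.floor X = Num.floor Y \/ Num.floor (X + e) = Num.floor (Y + e))%R.
Proof.
move=> he XY XY3; have [->|ne] := eqVneq (Num.floor X) (Num.floor Y); first by left.
right; set m := Num.floor Y.
have Xm : (X < m%:~R)%R.
  by rewrite -floor_lt_int lt_neqAle ne le_floor.
have /andP[mY _] := floor_itv Y; rewrite -/m in mY.
case: he => ->.
  transitivity m; last apply/esym; apply: floor_def; rewrite intrD;
    apply/andP; split; lra.
transitivity (m - 1)%R; last apply/esym; apply: floor_def; rewrite ?subrK intrD ?intrN;
  apply/andP; split; lra.
Qed.

Lemma ltr_pow2 k : (k%:R < 2 ^+ k :> R)%R.
Proof. by rewrite -(natrX _ 2) ltr_nat ltn_expl. Qed.

Lemma pow2_between (s : R) : (0 < s)%R ->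
  exists N k, (3 * s < 2 ^+ N / 2 ^+ k <= 6 * s)%R.
Proof.
(* The generation is so fine that [N = 0] gives a side of at most [3 * s]. The least [N] exceeding
   [3 * s] is then positive, and its predecessor gives the upper bound [6 * s]. *)
move=> s0; pose k := (Num.truncn (3 * s)^-1).+1.
have k3 : (2 ^+ 0 / 2 ^+ k <= 3 * s)%R.
  rewrite expr0 mul1r -[leRHS]invrK lef_pV2 ?posrE ?invr_gt0 ?mulr_gt0 ?exp2_gt0//.
  apply/ltW/(@lt_trans _ _ k%:R); first exact: truncnS_gt.
  exact: ltr_pow2.
have ex : exists N, (3 * s < 2 ^+ N / 2 ^+ k)%R.
  exists (Num.truncn (3 * s * 2 ^+ k)).+1; rewrite ltr_pdivlMr ?exp2_gt0//.
  apply: (@lt_trans _ _ (Num.truncn (3 * s * 2 ^+ k)).+1%:R).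
    exact: truncnS_gt.
  exact: ltr_pow2.
case: (ex_minnP ex) => -[|N] hN Nmin; first by rewrite ltNge k3 in hN.
exists N.+1, k; rewrite hN/=.
have : (2 ^+ N / 2 ^+ k <= 3 * s)%R.
  by rewrite leNgt; apply/negP => /Nmin; rewrite ltnn.
by rewrite exprS -mulrA; lra.
Qed.

Lemma cube_sub_tgrid (b : V) (s : R) : (0 < s)%R -> exists al N k,
  (2 ^+ N / 2 ^+ k <= 6 * s)%R /\
  forall x : T, box b (b + const_mx s)%R x ->
    box b (b + const_mx s)%R `<=` fib (tgrid al N) k x.
Proof.
move=> s0; have [N [k /andP[k1 k2]]] := pow2_between s0.
pose e : R := ((-1) ^+ (k + N) / 3)%R.
pose X i : R := (b 0 i / 2 ^+ N * 2 ^+ k)%R.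
pose Y i : R := ((b 0 i + s) / 2 ^+ N * 2 ^+ k)%R.
(* Exactly the directions in which the unshifted grid separates the two ends of the cube are
   shifted. *)
pose al : dirs := [ffun i => Num.floor (X i) != Num.floor (Y i)].
have N0 := exp2_gt0 N; have K0 := exp2_gt0 k.
have m0 : (0 < 2 ^+ k / 2 ^+ N :> R)%R by rewrite divr_gt0.
have XY i : (X i <= Y i)%R.
  by rewrite /X /Y ler_pM2r// ler_pM2r ?invr_gt0// lerDl ltW.
have XY3 i : (Y i - X i < 1 / 3)%R.
  rewrite /X /Y -mulrBl -mulrBl addrC addKr.
  by rewrite mulrAC ltr_pdivrMr//; move: k1; rewrite ltr_pdivlMr//; lra.
have he : (e = 1 / 3 \/ e = - (1 / 3))%R.
  rewrite /e -signr_odd; case: odd; [right|left]; rewrite ?expr1 ?expr0 ?mulN1r//.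
  by rewrite mul1r.
have F i : Num.floor (X i + third_shift al N k i) = Num.floor (Y i + third_shift al N k i).
  rewrite /third_shift ffunE; have [XYi|XYi] := eqVneq; first by rewrite !addr0.
  by have [/eqP|//] := third_trick he (XY i) (XY3 i); rewrite (negbTE XYi).
exists al, N, k; split=> // x bx y by_.
have G (z : V) : box b (b + const_mx s)%R z -> forall i,
    Num.floor (gcoord 0%R (2 ^+ N)%R (third_shift al N) k z i) =
    Num.floor (X i + third_shift al N k i).
  move=> bz i; have /andP[/ltW z1 /ltW] := bz i; rewrite !mxE => z2.
  apply/le_anti/andP; split; [rewrite F|]; apply: le_floor;
    by rewrite /gcoord mxE subr0 lerD2r ler_pM2r// ler_pM2r ?invr_gt0.
by apply/grid_eqP => i; rewrite !G.
Qed.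

End third_grids.

Lemma int_gt0 d (T : measurableType d) (R : realType)
    (mu : {measure set T -> \bar R}) (f : T -> \bar R) D :
  measurable D -> nnm f -> (forall x, D x -> 0 < f x) -> 0 < mu D ->
  0 < \int[mu]_(x in D) f x.
Proof.
move=> mD nf f0 muD; rewrite lt0e nnm_int_ge0// andbT; apply/eqP => I0.
have [N [mN N0 DN]] := int_eq0 mD nf I0.
suff : mu D <= mu N by rewrite N0 leNgt muD.
apply: le_measure; rewrite ?inE// => x Dx; apply: DN => /= /(_ Dx) fx.
by have := f0 x Dx; rewrite fx ltxx.
Qed.

(** * The dyadic maximal function and Lerner's bound *)

Section maximal_function.
Context {R : realType} {n : nat}.
Local Notation V := ('rV[R]_n.+1).
Local Notation T := (Rn R n).
Local Notation mu := (@lebesgue_Rn R n).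
Local Notation dirs := {ffun 'I_n.+1 -> bool}.

Definition locfin (u : T -> R) := [/\ measurable_fun [set: T] u,
  (forall x, (0 < u x)%R) &
  forall (b : V) (s : R), (0 < s)%R -> \int[mu]_(x in hcube b s) (u x)%:E < +oo].

Lemma nnm_locfin u : locfin u -> nnm (fun x => (u x)%:E).
Proof. by move=> [mu_ u0 _]; apply: nnm_EFin => // x; exact: ltW. Qed.

Lemma locfin_hcube u b s : locfin u -> (0 < s)%R ->
  0 < \int[mu]_(x in hcube b s) (u x)%:E < +oo.
Proof.
move=> lu s0; have [_ u0 ufin] := lu; rewrite ufin// andbT.
apply: int_gt0; first exact: measurable_hcube.
- exact: nnm_locfin.
- by move=> x _; rewrite lte_fin.
- by rewrite [ltRHS]lebesgue_Rn_hcube// lte_fin exprn_gt0.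
Qed.

Lemma locfin_fib u al N : locfin u -> forall k x,
  0 < \int[mu]_(y in fib (tgrid al N) k x) (u y)%:E < +oo.
Proof.
move=> lu k x; rewrite /tgrid fib_grid; last exact: exp2_gt0.
by apply: locfin_hcube => //; rewrite side_gt0// exp2_gt0.
Qed.

Lemma locfin1 : locfin (fun=> 1%R).
Proof.
split=> // b s s0; rewrite integral_cst; last exact: measurable_hcube.
by rewrite mul1e [ltLHS]lebesgue_Rn_hcube// ltry.
Qed.

(** With root side [2 ^+ m], the generations up to [2 * m] have sides from [2^m] down to [2^(-m)].
    The running maxima thus increase with [m] and exhaust all scales of the rootless grid. *)
Definition dmax al u f x : \bar R :=
  ereal_sup (range (fun m => runmax mu (tgrid al m) u f (2 * m)%N x)).

Lemma cav_tgridD al N k j u f x :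
  cav mu (tgrid al (N + j)) u (k + j) f x = cav mu (tgrid al N) u k f x.
Proof. by rewrite /cav fib_tgridD. Qed.

Section weight.
Context (u : T -> R) (lu : locfin u).

Lemma runmax_dmax al m f x :
  runmax mu (tgrid al m) u f (2 * m)%N x <= dmax al u f x.
Proof. by apply: ereal_sup_ubound; exists m. Qed.

Lemma nnm_runmax_tgrid al m j f : nnm f -> nnm (runmax mu (tgrid al m) u f j).
Proof.
move=> nf; apply: nnm_runmax => //.
- exact: measurable_tgrid.
- exact: tgrid_nested.
- by have [] := lu.
- by have [] := lu.
Qed.

Lemma nnm_dmax al f : nnm f -> nnm (dmax al u f).
Proof. by move=> nf; apply: nnm_sup => m; exact: nnm_runmax_tgrid. Qed.

Lemma cav_le_dmax al N k f x : cav mu (tgrid al N) u k f x <= dmax al u f x.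
Proof.
(* The same cube occurs at generation [k + k] of the grid with root side [2 ^+ (N + k)], which is
   within the range [2 * (N + k)]. *)
rewrite -(cav_tgridD al N k k); apply: le_trans (runmax_dmax al (N + k) f x).
by apply: cav_le_runmax; rewrite addnn -mul2n leq_mul2l leq_addl orbT.
Qed.

Lemma dmax_le al f x (B : \bar R) :
  (forall N k, cav mu (tgrid al N) u k f x <= B) -> dmax al u f x <= B.
Proof.
move=> H; apply: ge_ereal_sup => _ [m _ <-].
by elim: (2 * m)%N => [|j IH] /=; rewrite ?ge_max ?IH ?H.
Qed.

Lemma runmax_tgrid_homo al f x : {homo (fun m => runmax mu (tgrid al m) u f (2 * m)%N x) :
  m k / (m <= k)%N >-> m <= k}.
Proof.
apply: homo_leq => [//|? ? ?|m]; first exact: le_trans.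
have H j : (j <= 2 * m)%N ->
    runmax mu (tgrid al m) u f j x <= runmax mu (tgrid al m.+1) u f (2 * m.+1)%N x.
  have C i : (i <= 2 * m)%N -> cav mu (tgrid al m) u i f x <=
      runmax mu (tgrid al m.+1) u f (2 * m.+1)%N x.
    move=> im; rewrite -(cav_tgridD al m i 1) !addn1; apply: cav_le_runmax.
    by rewrite mulnS addSn ltnS (leq_trans im)// leq_addl.
  elim: j => [|j IH] jm /=; first exact: C.
  by rewrite ge_max C// IH// ltnW.
exact: H.
Qed.

(** Doob's constant depends neither on [u] nor on the root, so monotone convergence in the root side
    keeps it. *)
Lemma dmax_bound al f p : (1 < p)%R -> nnm f ->
  \int[mu]_x (dmax al u f x `^ p * (u x)%:E) <=
  ((p / (p - 1)) `^ p)%:E * \int[mu]_x (f x `^ p * (u x)%:E).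
Proof.
move=> p1 nf; have [mu_ u0 _] := lu; have nu := nnm_locfin lu.
have p0 : (0 < p)%R by lra.
pose h m x := runmax mu (tgrid al m) u f (2 * m)%N x `^ p * (u x)%:E.
have nS m := nnm_runmax_tgrid al m (2 * m)%N nf.
have nh m : nnm (h m) := nnm_mul (nnm_pow p (nS m)) nu.
have hh x : {homo h ^~ x : m k / (m <= k)%N >-> m <= k}.
  move=> m k mk; apply: lee_wpmul2r; first exact: (nnm_ge0 nu).
  by apply: lee_poweR; [exact: ltW|exact: (nnm_ge0 (nS m))|exact: runmax_tgrid_homo].
apply: (@le_trans _ _ (\int[mu]_x ereal_sup (range (h ^~ x)))).
  apply: le_intT.
  - exact: (nnm_mul (nnm_pow p (nnm_dmax al nf)) nu).
  - exact: (nnm_sup nh).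
  - move=> x; rewrite muleC -lee_pdivlMl//; apply: poweR_sup_le => // m.
    + exact: (nnm_ge0 (nS m)).
    + rewrite lee_pdivlMl// muleC; apply: ereal_sup_ubound; by exists m.
apply: int_sup_le => // m.
apply: doob_maximal => //.
- exact: measurable_tgrid.
- exact: tgrid_nested.
- exact: locfin_fib.
Qed.

End weight.
End maximal_function.

Lemma poweR_step {R : realType} (X Y w : \bar R) (r k q : R) :
  (0 <= q)%R -> (0 <= k)%R -> 0 <= Y -> 0 <= w -> X `^ r <= k%:E * Y ->
  X `^ (r * q) * w <= (k `^ q)%:E * (Y `^ q * w).
Proof.
move=> q0 k0 Y0 w0 H; rewrite poweRrM muleA lee_wpmul2r//.
by rewrite -poweR_EFin -poweRM ?lee_fin// lee_poweR// poweR_ge0.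
Qed.

Section lerner.
Context {R : realType} {n : nat}.
Local Notation V := ('rV[R]_n.+1).
Local Notation T := (Rn R n).
Local Notation mu := (@lebesgue_Rn R n).
Local Notation dirs := {ffun 'I_n.+1 -> bool}.
Local Notation one := (fun _ : T => 1%R : R).

Definition hav (b : V) (s : R) (u : T -> R) : \bar R :=
  ((s ^+ n.+1)^-1)%:E * \int[mu]_(x in hcube b s) (u x)%:E.

(** A symmetric form of the Muckenhoupt condition. When [W^A S^B = 1], the function [S] is the dual
    weight [W^(1-P')] for [P = (A + B) / A], and the bound says that the A_P constant of [W] to the
    power [A] is at most [K]. Exchanging the two sides is duality. *)
Definition A_pair (A B K : R) (W S : T -> R) := forall b s, (0 < s)%R ->
  hav b s W `^ A * hav b s S `^ B <= K%:E.

Lemma cav1E al N k f x : cav mu (tgrid al N) one k f x =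
  ((side (2 ^+ N) k ^+ n.+1)^-1)%:E * \int[mu]_(y in fib (tgrid al N) k x) f y.
Proof.
rewrite /cav integral_cst; last exact: measurable_tgrid.
rewrite mul1e [X in X^-1]mu_fib; last exact: exp2_gt0.
rewrite inver gt_eqF; last by rewrite exprn_gt0// side_gt0// exp2_gt0.
by congr (_ * _); apply: eq_integral => y _; rewrite mule1.
Qed.

Section pair.
Context (A B K : R) (W S : T -> R).
Hypotheses (A0 : (0 < A)%R) (B0 : (0 < B)%R) (lW : locfin W) (lS : locfin S).
Hypothesis WS : forall x, (W x `^ A * S x `^ B = 1)%R.
Hypothesis AK : A_pair A B K W S.

Let W0 x : (0 < W x)%R. Proof. by have [] := lW. Qed.
Let S0 x : (0 < S x)%R. Proof. by have [] := lS. Qed.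

Lemma measurable_powRE (u : T -> R) r : measurable_fun [set: T] u ->
  measurable_fun [set: T] (fun x => u x `^ r)%R.
Proof. by move=> mu_; exact: (measurableT_comp (measurable_powR r)). Qed.

Lemma A_pair_swap x : (W x `^ (- (A / B)) = S x)%R.
Proof.
have : ((W x `^ A * S x `^ B) `^ B^-1 = 1)%R by rewrite WS powR1.
rewrite powRM ?powR_ge0// -!powRrM divff ?gt_eqF// powRr1 ?(ltW (S0 x))// => H.
by rewrite powRN -[LHS]mulr1 -H mulKf// gt_eqF// powR_gt0.
Qed.

Lemma A_pair_swap' x : (S x `^ (- (B / A)) = W x)%R.
Proof.
rewrite -A_pair_swap -powRrM mulrNN (_ : A / B * (B / A) = 1)%R.
  by rewrite powRr1// ltW.
by field; rewrite !gt_eqF.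
Qed.

Let h al f (y : T) : \bar R :=
  dmax al S (fun z => f z * ((S z)^-1)%:E) y `^ (B / A) * ((W y)^-1)%:E.

Let nfS f : nnm f -> nnm (fun z => f z * ((S z)^-1)%:E).
Proof.
move=> nf; apply: (nnm_mul nf); apply: nnm_EFin.
  have -> : (fun z => (S z)^-1)%R = (fun z => S z `^ (-1))%R.
    by apply/funext => z; rewrite powR_inv1// ltW.
  by apply: measurable_powRE; have [] := lS.
by move=> z; rewrite invr_ge0 ltW.
Qed.

Let nW1 : nnm (fun z => ((W z)^-1)%:E).
Proof.
apply: nnm_EFin.
  have -> : (fun z => (W z)^-1)%R = (fun z => W z `^ (-1))%R.
    by apply/funext => z; rewrite powR_inv1// ltW.
  by apply: measurable_powRE; have [] := lW.
by move=> z; rewrite invr_ge0 ltW.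
Qed.

Let nh al f : nnm f -> nnm (h al f).
Proof.
move=> nf.
exact: (nnm_mul (nnm_pow (B / A) (nnm_dmax lS al (nfS nf))) nW1).
Qed.

(** On a cube J the mean of [f] is [S(J)/|J|] times the [S]-average of [f / S]. This average is at
    most the [S]-maximal function everywhere on J, so its power [B / A = P - 1] times [|J|/W(J)] is
    at most the [W]-average of [h]; the pair condition compares [(S(J)/|J|)^(B/A)] with
    [|J|/W(J)]. *)
Lemma lerner_pointwise al N k f x : nnm f ->
  cav mu (tgrid al N) one k f x `^ (B / A) <=
  (K `^ A^-1)%:E * cav mu (tgrid al N) W k (h al f) x.
Proof.
move=> nf; have BA0 : (0 < B / A)%R by rewrite divr_gt0.
have [mS _ _] := lS; have nS := nnm_locfin lS; have nW := nnm_locfin lW.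
have [s s0 sE] := ufibE (locfin_fib al N lS) k x.
have [w w0 wE] := ufibE (locfin_fib al N lW) k x.
set j := (side (2 ^+ N : R) k ^+ n.+1)%R.
have j0 : (0 < j)%R by rewrite exprn_gt0// side_gt0// exp2_gt0.
have mJ : measurable (fib (tgrid al N) k x) := measurable_tgrid _ _ _ _.
set cS := cav mu (tgrid al N) S k (fun z => f z * ((S z)^-1)%:E) x.
have cS0 : 0 <= cS by apply: cav_ge0 => //; exact: nfS.
have c1 : cav mu (tgrid al N) one k f x = (s / j)%:E * cS.
  rewrite cav1E -/j /cS /cav sE inver gt_eqF// muleA -EFinM.
  rewrite mulrAC divff ?mul1r ?gt_eqF//; congr (_ * _).
  apply: eq_integral => y _; rewrite -muleA -EFinM mulVf ?mule1//.
  by rewrite gt_eqF.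
have cW : (j / w)%:E * cS `^ (B / A) <= cav mu (tgrid al N) W k (h al f) x.
  rewrite /cav wE inver gt_eqF// mulrC EFinM -muleA lee_pmul2l//; last first.
    by rewrite lte_fin invr_gt0.
  rewrite [leLHS](_ : _ = \int[mu]_(y in fib (tgrid al N) k x) (cS `^ (B / A))).
    apply: le_int => //.
    - by apply: nnm_cst; exact: poweR_ge0.
    - exact: (nnm_mul (nh al nf) nW).
    move=> y xy; rewrite /h -muleA -EFinM mulVf ?gt_eqF// mule1.
    apply: lee_poweR => //; first exact: ltW.
    by rewrite /cS (cav_fiberwise mu S _ (esym xy)); exact: cav_le_dmax.
  rewrite integral_cst// muleC; congr (_ * _).
  by rewrite [RHS]mu_fib//; exact: exp2_gt0.
rewrite c1 poweRM//; last by rewrite lee_fin divr_ge0// ltW.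
apply: (@le_trans _ _ ((K `^ A^-1)%:E * ((j / w)%:E * cS `^ (B / A)))); last first.
  by apply: lee_wpmul2l => //; rewrite lee_fin powR_ge0.
rewrite muleA; apply: lee_wpmul2r; first exact: poweR_ge0.
rewrite poweR_EFin -EFinM lee_fin.
have := AK (corner 0%R (2 ^+ N)%R (third_shift al N) k x)
  (side_gt0 (exp2_gt0 N) k).
rewrite /hav -fib_grid; last exact: exp2_gt0.
rewrite -/(tgrid al N) wE sE -/j -!EFinM lee_fin => H.
have A1 : (0 <= A^-1)%R by rewrite invr_ge0 ltW.
have L0 : (0 <= (j^-1 * w) `^ A * (j^-1 * s) `^ B)%R by rewrite mulr_ge0 ?powR_ge0.
have K0 : (0 <= K)%R := le_trans L0 H.
have {H}/(ge0_ler_powR A1) H := H.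
move: H; rewrite !nnegrE L0 K0 => /(_ isT isT).
rewrite (@powRM _ (_ `^ A)%R) ?powR_ge0// -!powRrM divff ?gt_eqF//.
rewrite powRr1; last by rewrite mulr_ge0// ?invr_ge0 ltW.
rewrite [(s / j)%R]mulrC => H.
rewrite -ler_pdivrMr ?divr_gt0// invf_div; apply: le_trans H.
by rewrite le_eqVlt; apply/orP; left; apply/eqP; ring.
Qed.

(** The pair constant to the power [P'], followed by the Doob constants of the [W]-maximal function
    on [L^P'(W)] and of the [S]-maximal function on [L^P(S)]. *)
Definition lerner_const : R :=
  let P := ((A + B) / A)%R in let P' := ((A + B) / B)%R in
  (K `^ A^-1 `^ P' * ((P' / (P' - 1)) `^ P' * (P / (P - 1)) `^ P))%R.

(** Since [P = (P - 1) P'], the pointwise bound to the power [P'] gives the [P]-th power of the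
    maximal function. Doob for [W] leads to the integral of [h^P' W], which is that of the
    [S]-maximal function of [f / S] to the power [P]; Doob for [S] ends at the integral of
    [(f / S)^P S = f^P W]. *)
Lemma lerner_bound al f : nnm f ->
  \int[mu]_x (dmax al one f x `^ ((A + B) / A) * (W x)%:E) <=
  lerner_const%:E * \int[mu]_x (f x `^ ((A + B) / A) * (W x)%:E).
Proof.
move=> nf; rewrite /lerner_const.
have [P PD] : exists P, P = ((A + B) / A)%R by eexists.
have [P' P'D] : exists P', P' = ((A + B) / B)%R by eexists.
rewrite -PD -P'D.
have BA0 : (0 < B / A)%R by rewrite divr_gt0.
have P1 : (1 < P)%R by rewrite PD mulrDl divff ?gt_eqF// ltrDl.
have P'1 : (1 < P')%R by rewrite P'D mulrDl divff ?gt_eqF// ltrDr divr_gt0.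
have PE : (P = B / A * P')%R by rewrite PD P'D; field; rewrite !gt_eqF.
have [mS _ _] := lS; have nS := nnm_locfin lS; have nW := nnm_locfin lW.
have n1 := nnm_dmax locfin1 al nf.
have nhf := nh al nf.
have nMW := nnm_dmax lW al nhf.
have nMS := nnm_dmax lS al (nfS nf).
have H1 x : dmax al one f x `^ (B / A) <= (K `^ A^-1)%:E * dmax al W (h al f) x.
  apply: poweR_sup_le => // m; first by apply: (nnm_ge0 (nnm_runmax_tgrid locfin1 _ _ _ nf)).
  have nc k : nnm (cav mu (tgrid al m) one k f).
    by apply: nnm_cav => //; exact: measurable_tgrid.
  have H k : cav mu (tgrid al m) one k f x `^ (B / A) <=
      (K `^ A^-1)%:E * dmax al W (h al f) x.
    apply: le_trans (lerner_pointwise al m k x nf) _.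
    by apply: lee_wpmul2l; [rewrite lee_fin powR_ge0|exact: cav_le_dmax].
  elim: (2 * m)%N => [|j IH] /=; first exact: H.
  by case: (leP (runmax mu (tgrid al m) one f j x)) => _.
have H2 x : dmax al one f x `^ P * (W x)%:E <= (K `^ A^-1 `^ P')%:E *
    (dmax al W (h al f) x `^ P' * (W x)%:E).
  rewrite PE; apply: poweR_step; rewrite ?powR_ge0 ?(nnm_ge0 nMW) ?(nnm_ge0 nW)//; lra.
apply: (@le_trans _ _ (\int[mu]_x ((K `^ A^-1 `^ P')%:E *
    (dmax al W (h al f) x `^ P' * (W x)%:E)))).
  apply: le_intT => //; first exact: (nnm_mul (nnm_pow P n1) nW).
  apply: nnm_mul; first by apply: nnm_cst; rewrite lee_fin powR_ge0.
  exact: (nnm_mul (nnm_pow P' nMW) nW).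
rewrite intZ ?lee_fin ?powR_ge0//; last exact: (nnm_mul (nnm_pow P' nMW) nW).
rewrite EFinM -muleA; apply: lee_wpmul2l; first by rewrite lee_fin powR_ge0.
apply: le_trans (dmax_bound lW al P'1 nhf) _.
rewrite EFinM -muleA; apply: lee_wpmul2l; first by rewrite lee_fin powR_ge0.
rewrite [leLHS](_ : _ =
  \int[mu]_x (dmax al S (fun z => f z * ((S z)^-1)%:E) x `^ P * (S x)%:E)).
  apply: le_trans (dmax_bound lS al P1 (nfS nf)) _.
  apply: lee_wpmul2l; first by rewrite lee_fin powR_ge0.
  rewrite le_eqVlt; apply/orP; left; apply/eqP; apply: eq_integral => x _.
  rewrite poweRM ?(nnm_ge0 nf) ?lee_fin ?invr_ge0 ?(ltW (S0 x))// -muleA; congr (_ * _).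
  rewrite poweR_EFin -EFinM -{2}(powRr1 (ltW (S0 x))) -powR_inv1 ?(ltW (S0 x))//.
  rewrite -powRrM -powRD; last by rewrite (gt_eqF (S0 x)) implybT.
  rewrite -[in RHS]A_pair_swap'; congr ((_ `^ _)%R)%:E.
  by rewrite PD; field; rewrite gt_eqF.
apply: eq_integral => x _; rewrite /h.
rewrite poweRM ?poweR_ge0 ?lee_fin ?invr_ge0 ?(ltW (W0 x))//.
rewrite -poweRrM -PE -muleA; congr (_ * _).
rewrite poweR_EFin -EFinM -{2}(powRr1 (ltW (W0 x))) -powR_inv1 ?(ltW (W0 x))//.
rewrite -powRrM -powRD; last by rewrite (gt_eqF (W0 x)) implybT.
rewrite -[in RHS]A_pair_swap; congr ((_ `^ _)%R)%:E.
by rewrite P'D; field; rewrite gt_eqF.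
Qed.

End pair.
End lerner.

(** * Powers and integrals of series *)

Lemma nneseries_le {R : realType} (a : nat -> \bar R) (B : \bar R) :
  (forall k, 0 <= a k) -> (forall m, \sum_(0 <= k < m) a k <= B) ->
  \sum_(0 <= k <oo) a k <= B.
Proof.
move=> a0 H; apply: lime_le; last by apply: nearW => m; exact: H.
by apply: is_cvg_nneseries => k _ _.
Qed.

Lemma nneseries_term_le {R : realType} (a : nat -> \bar R) j :
  (forall k, 0 <= a k) -> a j <= \sum_(0 <= k <oo) a k.
Proof.
move=> a0; rewrite (@nneseriesD1 _ _ j xpredT)//.
by rewrite leeDl// nneseries_ge0.
Qed.

Lemma poweRD_le {R : realType} (x y : \bar R) (p : R) : (0 < p)%R -> 0 <= x -> 0 <= y ->
  (x + y) `^ p <= (2 `^ p)%:E * (x `^ p + y `^ p).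
Proof.
move=> p0 x0 y0; have E z : 0 <= z -> (2 `^ p)%:E * z `^ p = (z + z) `^ p.
  move=> z0; rewrite -poweR_EFin -poweRM ?lee_fin//; congr (_ `^ _).
  by rewrite -[RHS]mule2n muleC muleC -mule_natl.
have p2 : 0 <= (2 `^ p)%:E by rewrite lee_fin powR_ge0.
have p0' := ltW p0.
have [xy|/ltW yx] := leP x y.
  apply: (@le_trans _ _ ((2 `^ p)%:E * y `^ p)).
    by rewrite E// lee_poweR// ?adde_ge0// leeD2r.
  by rewrite lee_wpmul2l// leeDr// poweR_ge0.
apply: (@le_trans _ _ ((2 `^ p)%:E * x `^ p)).
  by rewrite E// lee_poweR// ?adde_ge0// leeD2l.
by rewrite lee_wpmul2l// leeDl// poweR_ge0.
Qed.

Lemma poweR_sum_nat_le {R : realType} (a : nat -> \bar R) (p : R) m :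
  (0 < p)%R -> (forall k, 0 <= a k) ->
  (\sum_(0 <= k < m) a k) `^ p <=
    \sum_(0 <= k < m) (2 `^ p ^+ k.+1)%:E * a k `^ p.
Proof.
move=> p0; elim: m a => [|m IH] a a0.
  by rewrite !big_geq// poweR0r// gt_eqF.
rewrite !big_nat_recl//; apply: le_trans (poweRD_le p0 _ _) _ => //.
  by apply: sume_ge0.
rewrite ge0_muleDr ?poweR_ge0// expr1 leeD2l//.
apply: (@le_trans _ _ ((2 `^ p)%:E *
    \sum_(0 <= k < m) (2 `^ p ^+ k.+1)%:E * a k.+1 `^ p)).
  by rewrite lee_wpmul2l ?lee_fin ?powR_ge0//; exact: (IH (fun k => a k.+1)).
rewrite ge0_sume_distrr; last first.
  by move=> k _; rewrite mule_ge0 ?poweR_ge0// lee_fin exprn_ge0// powR_ge0.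
rewrite le_eqVlt; apply/orP; left; apply/eqP; apply: eq_bigr => k _.
by rewrite muleA -EFinM -exprS.
Qed.

(** Splitting off one term at a time costs a factor [2^p] each time. The resulting geometric loss is
    harmless in the Rubio de Francia series, whose ratio is chosen to beat it, and replaces
    Minkowski's inequality. *)
Lemma poweR_series_le {R : realType} (a : nat -> \bar R) (p : R) :
  (0 < p)%R -> (forall k, 0 <= a k) ->
  (\sum_(0 <= k <oo) a k) `^ p <=
    \sum_(0 <= k <oo) (2 `^ p ^+ k.+1)%:E * a k `^ p.
Proof.
move=> p0 a0; set Y := (X in _ <= X).
have pn0 : p != 0%R by rewrite gt_eqF.
have b0 k : 0 <= (2 `^ p ^+ k.+1)%:E * a k `^ p.
  by rewrite mule_ge0 ?poweR_ge0// lee_fin exprn_ge0// powR_ge0.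
have Y0 : 0 <= Y by apply: nneseries_ge0.
have H : \sum_(0 <= k <oo) a k <= Y `^ p^-1.
  apply: nneseries_le => // m.
  rewrite -[leLHS]poweRe1 ?sume_ge0// -(mulfV pn0) poweRrM.
  apply: lee_poweR; [by rewrite invr_ge0 ltW|exact: poweR_ge0|].
  by apply: le_trans (poweR_sum_nat_le m p0 a0) _; exact: nneseries_lim_ge.
apply: le_trans (lee_poweR (ltW p0) (nneseries_ge0 _) H) _ => //.
by rewrite -poweRrM mulVf// poweRe1.
Qed.

Lemma powRX {R : realType} (x p : R) k : (0 <= x -> (x ^+ k) `^ p = x `^ p ^+ k)%R.
Proof.
move=> x0.
by rewrite -(powR_mulrn k x0) -(powR_mulrn k (powR_ge0 x p)) powRAC.
Qed.

Lemma int_series d (T : measurableType d) (R : realType)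
    (mu : {measure set T -> \bar R}) (F : nat -> T -> \bar R) D :
  measurable D -> (forall k, nnm (F k)) ->
  \int[mu]_(x in D) (\sum_(0 <= k <oo) F k x) =
  \sum_(0 <= k <oo) \int[mu]_(x in D) F k x.
Proof.
move=> mD nF; apply: integral_nneseries => // [k|k x _]; last exact: nnm_ge0.
by apply: measurable_funTS; exact: nnm_m.
Qed.

Section finite_sums.
Context d (T : measurableType d) (R : realType) (mu : {measure set T -> \bar R}).
Context (I : Type) (s : seq I) (F : I -> T -> \bar R).
Hypothesis nF : forall i, nnm (F i).

Lemma nnm_sum : nnm (fun x => \sum_(i <- s) F i x).
Proof.
apply/nnmP; split; first by apply: emeasurable_sum => i; exact: nnm_m.
by move=> x; apply: sume_ge0 => i _; exact: nnm_ge0.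
Qed.

Lemma int_sum : \int[mu]_x (\sum_(i <- s) F i x) = \sum_(i <- s) \int[mu]_x F i x.
Proof.
by apply: ge0_integral_sum => // [i|i x _]; [exact: nnm_m|exact: nnm_ge0].
Qed.

End finite_sums.

(** * The maximal function of all shifted grids and the Rubio de Francia algorithm *)

Section hlmax.
Context {R : realType} {n : nat}.
Local Notation V := ('rV[R]_n.+1).
Local Notation T := (Rn R n).
Local Notation mu := (@lebesgue_Rn R n).
Local Notation dirs := {ffun 'I_n.+1 -> bool}.
Local Notation one := (fun _ : T => 1%R : R).

(** A sum over the shifts, rather than a maximum, keeps sublinearity and the integral bounds
    termwise; it still dominates the averages over all cubes up to a constant. *)
Definition hlmax (f : T -> \bar R) (x : T) : \bar R :=
  \sum_(al : dirs) dmax al one f x.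

Lemma dmax_ge0 al f x : nnm f -> 0 <= dmax al one f x.
Proof. by move=> nf; apply: nnm_ge0; exact: (nnm_dmax locfin1). Qed.

Lemma nnm_hlmax f : nnm f -> nnm (hlmax f).
Proof.
move=> nf; apply/nnmP; split; last by move=> x; apply: sume_ge0 => al _; exact: dmax_ge0.
apply: emeasurable_sum => al; apply: nnm_m; exact: (nnm_dmax locfin1).
Qed.

Definition cavg (b : V) (s : R) (f : T -> \bar R) : \bar R :=
  ((s ^+ n.+1)^-1)%:E * \int[mu]_(x in hcube b s) f x.

(** The cube lies in a cube of one of the grids with side at most [6 * s], whence the ratio of
    volumes [6 ^+ n.+1]. *)
Lemma cavg_le_hlmax b s f x : (0 < s)%R -> nnm f -> box b (b + const_mx s)%R x ->
  cavg b s f <= (6 ^+ n.+1)%:E * hlmax f x.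
Proof.
move=> s0 nf bx; have [al [N [k [k6 bsub]]]] := cube_sub_tgrid b s0.
apply: (@le_trans _ _ ((6 ^+ n.+1)%:E * dmax al one f x)); last first.
  rewrite lee_wpmul2l ?lee_fin ?exprn_ge0// /hlmax (bigD1 al)//= leeDl// sume_ge0//.
  by move=> ? _; exact: dmax_ge0.
apply: (@le_trans _ _ ((6 ^+ n.+1)%:E * cav mu (tgrid al N) one k f x)); last first.
  by rewrite lee_wpmul2l ?lee_fin ?exprn_ge0//; exact: cav_le_dmax.
rewrite cav1E /cavg int_hcube// muleA -EFinM.
have sd0 : (0 < side (2 ^+ N : R) k)%R by rewrite side_gt0// exp2_gt0.
apply: lee_pmul; rewrite ?lee_fin ?invr_ge0 ?exprn_ge0 ?(ltW s0)//.
- exact: nnm_int_ge0.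
- rewrite -!exprVn -exprMn lerXn2r ?nnegrE ?invr_ge0 ?mulr_ge0 ?(ltW s0)//.
    by rewrite invr_ge0 ltW.
  by rewrite ler_pdivlMr// mulrC ler_pdivrMr.
- apply: le_int_set => //; last exact: bsub.
  + exact: measurable_box.
  + exact: measurable_tgrid.
Qed.

Lemma hlmax_series (F : nat -> T -> \bar R) x : (forall k, nnm (F k)) ->
  hlmax (fun y => \sum_(0 <= k <oo) F k y) x <= \sum_(0 <= k <oo) hlmax (F k) x.
Proof.
move=> nF; rewrite /hlmax nneseries_sum; last by move=> *; exact: dmax_ge0.
apply: lee_sum => al _; apply: dmax_le => N k.
rewrite cav1E (int_series _ _ nF); last exact: measurable_tgrid.
rewrite -nneseriesZl; last by move=> j _; exact: nnm_int_ge0.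
apply: lee_nneseries => j _.
  rewrite mule_ge0 ?nnm_int_ge0// lee_fin invr_ge0 exprn_ge0// ltW// side_gt0//.
by rewrite -cav1E; exact: cav_le_dmax.
Qed.

Lemma hlmax_scale (c : R) f x : (0 <= c)%R -> nnm f ->
  hlmax (fun y => c%:E * f y) x <= c%:E * hlmax f x.
Proof.
move=> c0 nf; rewrite /hlmax ge0_sume_distrr; last by move=> *; exact: dmax_ge0.
apply: lee_sum => al _; apply: dmax_le => N k.
rewrite cav1E intZ ?lee_fin//; last exact: measurable_tgrid.
by rewrite muleCA -cav1E lee_wpmul2l ?lee_fin//; exact: cav_le_dmax.
Qed.

Definition hlmax_const (A B K : R) : R :=
  ((#|{: dirs}|)%:R `^ ((A + B) / A) * ((#|{: dirs}|)%:R * lerner_const A B K))%R.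

Lemma hlmax_bound (A B K : R) (W S : T -> R) f : (0 < A)%R -> (0 < B)%R ->
  locfin W -> locfin S -> (forall x, (W x `^ A * S x `^ B = 1)%R) ->
  A_pair A B K W S -> nnm f ->
  \int[mu]_x (hlmax f x `^ ((A + B) / A) * (W x)%:E) <=
  (hlmax_const A B K)%:E * \int[mu]_x (f x `^ ((A + B) / A) * (W x)%:E).
Proof.
move=> A0 B0 lW lS WS AK nf; rewrite /hlmax_const.
have H al := lerner_bound A0 B0 lW lS WS AK al nf.
have [P PD] : exists P, P = ((A + B) / A)%R by eexists.
move: H; rewrite -PD; have P0 : (0 < P)%R by rewrite PD divr_gt0// addr_gt0.
have nW := nnm_locfin lW.
have nd al := nnm_mul (nnm_pow P (nnm_dmax locfin1 al nf)) nW.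
have c0 : (0 <= (#|{: dirs}|)%:R `^ P :> R)%R by rewrite powR_ge0.
move=> H; apply: (@le_trans _ _ (\int[mu]_x (((#|{: dirs}|)%:R `^ P)%:E *
    \sum_(al : dirs) (dmax al one f x `^ P * (W x)%:E)))).
  apply: le_intT.
  - exact: (nnm_mul (nnm_pow P (nnm_hlmax nf)) nW).
  - apply: nnm_mul; first by apply: nnm_cst; rewrite lee_fin.
    exact: nnm_sum.
  move=> x; rewrite -ge0_sume_distrl; last by move=> *; exact: poweR_ge0.
  rewrite muleA lee_wpmul2r ?(nnm_ge0 nW)//.
  by apply: poweR_sum_le => // al; exact: dmax_ge0.
rewrite intZ ?lee_fin//; last first.
  exact: nnm_sum.
rewrite EFinM -muleA lee_wpmul2l ?lee_fin// (int_sum _ _ nd).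
apply: (@le_trans _ _ (\sum_(al : dirs) ((lerner_const A B K)%:E *
    \int[mu]_x (f x `^ P * (W x)%:E)))).
  by apply: lee_sum => al _; exact: H.
by rewrite sumr_const -[leLHS]mule_natl muleA -EFinM.
Qed.

Section rubio_de_francia.
Context (A B K : R) (W S : T -> R).
Hypotheses (A0 : (0 < A)%R) (B0 : (0 < B)%R) (lW : locfin W) (lS : locfin S).
Hypothesis WS : forall x, (W x `^ A * S x `^ B = 1)%R.
Hypothesis AK : A_pair A B K W S.

Let P : R := ((A + B) / A)%R.
Let D : R := (1 + `|hlmax_const A B K|)%R.

(* [del] is small enough for [(2 del) ^ P * D = 1/2] *)
Definition rdf_ratio : R :=
  ((2 `^ ((A + B) / A) * (2 * (1 + `|hlmax_const A B K|))) `^ (- (A / (A + B))))%R.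

Let P0 : (0 < P)%R. Proof. by rewrite divr_gt0// addr_gt0. Qed.

Let D0 : (0 < D)%R. Proof. by rewrite ltr_pwDl. Qed.

Lemma rdf_ratio_gt0 : (0 < rdf_ratio)%R.
Proof. by rewrite powR_gt0// mulr_gt0 ?powR_gt0// mulr_gt0. Qed.

Let ratioE : (2 `^ P * rdf_ratio `^ P * D = 2^-1)%R.
Proof.
rewrite /rdf_ratio -/P -/D -powRrM.
rewrite (_ : - (A / (A + B)) * P = -1)%R; last first.
  by rewrite /P; field; rewrite !gt_eqF// addr_gt0.
rewrite powR_inv1; last by rewrite !mulr_ge0 ?powR_ge0// ltW.
by field; rewrite !gt_eqF// powR_gt0.
Qed.

Definition rdf (G : T -> \bar R) (x : T) : \bar R :=
  \sum_(0 <= k <oo) (rdf_ratio ^+ k)%:E * iter k hlmax G x.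

Context (G : T -> \bar R) (nG : nnm G).

Let nI k : nnm (iter k hlmax G).
Proof. by elim: k => [//|k IH]; exact: nnm_hlmax. Qed.

Let nT k : nnm (fun x => (rdf_ratio ^+ k)%:E * iter k hlmax G x).
Proof.
apply: nnm_mul => //; apply: nnm_cst.
by rewrite lee_fin exprn_ge0// ltW// rdf_ratio_gt0.
Qed.

Lemma nnm_rdf : nnm (rdf G).
Proof. exact: (nnm_series nT). Qed.

Lemma rdf_ge x : G x <= rdf G x.
Proof.
by have := nneseries_term_le 0 (fun k => nnm_ge0 (nT k) x); rewrite /= mul1e.
Qed.

Lemma rdf_ge1 x : rdf_ratio%:E * hlmax G x <= rdf G x.
Proof. exact: (nneseries_term_le 1 (fun k => nnm_ge0 (nT k) x)). Qed.

(** Applying the maximal function shifts the series by one index, and the shift is paid by one power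
    of the ratio. This is the A_1 property of the majorant. *)
Lemma hlmax_rdf x : hlmax (rdf G) x <= (rdf_ratio^-1)%:E * rdf G x.
Proof.
have d0 := rdf_ratio_gt0; apply: le_trans (hlmax_series x nT) _.
rewrite lee_pdivlMl// -nneseriesZl; last first.
  by move=> k _; apply: nnm_ge0; exact: nnm_hlmax.
apply: (@le_trans _ _ (\sum_(0 <= k <oo)
    (rdf_ratio ^+ k.+1)%:E * iter k.+1 hlmax G x)).
  apply: lee_nneseries => k _.
    by rewrite mule_ge0 ?lee_fin ?(ltW d0)// nnm_ge0//; exact: nnm_hlmax.
  rewrite exprS EFinM -muleA lee_wpmul2l ?lee_fin ?(ltW d0)//=.
  by apply: hlmax_scale => //; rewrite exprn_ge0// ltW.
apply: nneseries_le => [k|m]; first exact: (nnm_ge0 (nT k.+1)).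
apply: (@le_trans _ _ (\sum_(0 <= k < m.+1) (rdf_ratio ^+ k)%:E * iter k hlmax G x)).
  by rewrite [leRHS]big_nat_recl// leeDr//; exact: (nnm_ge0 (nT 0%N) x).
by apply: nneseries_lim_ge => k *; exact: (nnm_ge0 (nT k) x).
Qed.

(** The k-th term contributes [2^(P(k+1)) del^(Pk) D^k = 2^P 2^(-k)] by the choice of the ratio, and
    the geometric series sums to 2. *)
Lemma int_rdf : \int[mu]_x (rdf G x `^ ((A + B) / A) * (W x)%:E) <=
  (2 * 2 `^ ((A + B) / A))%:E * \int[mu]_x (G x `^ ((A + B) / A) * (W x)%:E).
Proof.
rewrite -/P; have nW := nnm_locfin lW; have d0 := rdf_ratio_gt0.
set F := \int[mu]_x (G x `^ P * (W x)%:E).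
have F0 : 0 <= F by apply: nnm_int_ge0; exact: (nnm_mul (nnm_pow P nG) nW).
have nIW k := nnm_mul (nnm_pow P (nI k)) nW.
have bI k : \int[mu]_x (iter k hlmax G x `^ P * (W x)%:E) <= (D ^+ k)%:E * F.
  elim: k => [|k IH]; first by rewrite mul1e.
  apply: le_trans (hlmax_bound A0 B0 lW lS WS AK (nI k)) _.
  apply: (@le_trans _ _ (D%:E * \int[mu]_x (iter k hlmax G x `^ P * (W x)%:E))).
    rewrite lee_wpmul2r ?(nnm_int_ge0 _ _ (nIW k))// lee_fin.
    by rewrite (le_trans (ler_norm _))// lerDr.
  by rewrite exprS EFinM -muleA lee_wpmul2l// lee_fin ltW.
pose a k := (2 `^ P ^+ k.+1 * rdf_ratio `^ P ^+ k)%R.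
have a0 k : (0 <= a k)%R by rewrite mulr_ge0 ?exprn_ge0 ?powR_ge0.
have nh k : nnm (fun x => (a k)%:E * (iter k hlmax G x `^ P * (W x)%:E)).
  by apply: nnm_mul => //; apply: nnm_cst; rewrite lee_fin.
apply: (@le_trans _ _ (\int[mu]_x \sum_(0 <= k <oo)
    ((a k)%:E * (iter k hlmax G x `^ P * (W x)%:E)))).
  apply: le_intT.
  - exact: (nnm_mul (nnm_pow P nnm_rdf) nW).
  - exact: nnm_series.
  move=> x; have W0 : (0 < W x)%R by have [] := lW.
  rewrite muleC -lee_pdivlMl//.
  apply: le_trans (poweR_series_le P0 (fun k => nnm_ge0 (nT k) x)) _.
  rewrite -nneseriesZl; last by move=> k _; exact: (nnm_ge0 (nh k)).
  apply: lee_nneseries => k _.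
    by rewrite mule_ge0 ?poweR_ge0// lee_fin exprn_ge0// powR_ge0.
  rewrite poweRM ?(nnm_ge0 (nI k))//; last by rewrite lee_fin exprn_ge0// ltW.
  rewrite poweR_EFin muleA -EFinM.
  rewrite (_ : (rdf_ratio ^+ k) `^ P = rdf_ratio `^ P ^+ k)%R; last first.
    exact: powRX (ltW d0).
  rewrite [leRHS]muleC -!muleA -EFinM mulfV ?mule1//.
  by rewrite gt_eqF.
rewrite (int_series _ measurableT nh).
apply: nneseries_le => [k|m]; first exact: (nnm_int_ge0 _ _ (nh k)).
apply: (@le_trans _ _ (\sum_(0 <= k < m) ((2 `^ P) * 2^-1 ^+ k)%:E * F)).
  apply: lee_sum => k _; rewrite intZ ?lee_fin//.
  apply: (@le_trans _ _ ((a k)%:E * ((D ^+ k)%:E * F))).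
    by rewrite lee_wpmul2l ?lee_fin.
  rewrite muleA -EFinM /a exprS -!mulrA -!exprMn -ratioE.
  by rewrite lee_wpmul2r// lee_fin !mulrA.
rewrite -ge0_sume_distrl; last by move=> k _; rewrite lee_fin mulr_ge0 ?powR_ge0// exprn_ge0.
rewrite lee_wpmul2r// sumEFin lee_fin -mulr_sumr mulrC ler_wpM2r ?powR_ge0//.
have -> : (\sum_(0 <= k < m) 2^-1 ^+ k = 2 - 2 * 2^-1 ^+ m :> R)%R.
  elim: (m) => [|j IH]; first by rewrite big_geq// expr0 mulr1 subrr.
  by rewrite big_nat_recr//= IH exprS; field.
by rewrite gerBl mulr_ge0// exprn_ge0.
Qed.

End rubio_de_francia.
End hlmax.

(** * Real-valued positive majorants in A_1 *)

Section finite_version.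
Context d (T : measurableType d) (R : realType) (mu : {measure set T -> \bar R}).

Lemma int_lty_ae (f : T -> \bar R) : nnm f -> \int[mu]_x f x < +oo ->
  {ae mu, forall x, f x < +oo}.
Proof.
move=> nf foo; have /integrable_ae : mu.-integrable setT f.
  apply/integrableP; split; first exact: nnm_m.
  by under eq_integral do rewrite gee0_abs ?(nnm_ge0 nf)//.
move=> /(_ measurableT); apply: filterS => x /(_ I).
by rewrite ge0_fin_numE// nnm_ge0.
Qed.

Lemma pos_real_version (F : T -> \bar R) : measurable_fun [set: T] F ->
  {ae mu, forall x, 0 < F x < +oo} -> exists H : T -> R,
    [/\ measurable_fun [set: T] H, (forall x, (0 < H x)%R) &
        {ae mu, forall x, F x = (H x)%:E}].
Proof.
move=> mF F0; exists (fun x => if 0 < F x then if F x < +oo then fine (F x) else 1%R else 1%R).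
have mf : measurable_fun [set: T] (fun x => fine (F x)).
  by apply: (measurableT_comp (fine_measurable measurableT)).
split.
- apply: measurable_fun_ifT => //; first exact: measurable_fun_lte.
  by apply: measurable_fun_ifT => //; exact: measurable_fun_lte.
- by move=> x; case: ifPn => // F1; case: ifPn => // F2; apply: fine_gt0; rewrite F1 F2.
- apply: filterS F0 => x /andP[F1 F2]; rewrite F1 F2 fineK// ge0_fin_numE//.
  exact: ltW.
Qed.

End finite_version.

#[global] Instance ae_lebesgue_Rn_filter {R : realType} {n : nat} :
  Filter (almost_everywhere (@lebesgue_Rn R n)).
Proof. exact: (ae_filter_ringOfSetsType (@lebesgue_Rn R n)). Qed.

Section rdf_real.
Context {R : realType} {n : nat}.
Local Notation V := ('rV[R]_n.+1).
Local Notation T := (Rn R n).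
Local Notation mu := (@lebesgue_Rn R n).

Definition bigc (N : nat) : V := (const_mx (- N%:R))%R.

Lemma bigc_cover (x : V) : exists2 N, (0 < N)%N &
  box (bigc N) (bigc N + const_mx (2 * N%:R))%R x.
Proof.
exists (Num.truncn (\sum_i `|x 0 i|)%R).+1 => // i; rewrite !mxE.
rewrite (_ : - _ + 2 * _ = (Num.truncn (\sum_i `|x 0 i|)).+1%:R)%R; last by ring.
rewrite -ltr_norml; apply: le_lt_trans (truncnS_gt _).
by rewrite (bigD1 i)//= lerDl sumr_ge0.
Qed.

Lemma bigc_sub (N M : nat) : (N <= M)%N ->
  hcube (bigc N) (2 * N%:R)%R `<=` hcube (bigc M) (2 * M%:R)%R.
Proof.
move=> NM x xN i; have := xN i; rewrite !mxE => /andP[x1 x2].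
have : (N%:R <= M%:R :> R)%R by rewrite ler_nat.
by move=> H; apply/andP; split; lra.
Qed.

Lemma ae_exists (P : T -> Prop) (A : set T) : {ae mu, forall x, A x -> P x} ->
  measurable A -> 0 < mu A -> exists2 x, A x & P x.
Proof.
move=> [N [mN N0 AN]] mA A0; apply: contrapT => nex.
suff : mu A <= mu N by rewrite N0 leNgt A0.
apply: le_measure; rewrite ?inE// => x Ax; apply: AN => /= /(_ Ax) Px.
by apply: nex; exists x.
Qed.

Lemma exists_cube_pos (G : T -> \bar R) (P : R) (W : T -> R) : nnm G ->
  (P != 0)%R -> locfin W -> 0 < \int[mu]_x (G x `^ P * (W x)%:E) ->
  exists2 N, (0 < N)%N & 0 < \int[mu]_(x in hcube (bigc N) (2 * N%:R)%R) G x.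
Proof.
move=> nG P0 lW I0; apply: contrapT => nex.
suff E : \int[mu]_x (G x `^ P * (W x)%:E) = 0 by rewrite E ltxx in I0.
have nW := nnm_locfin lW.
apply: int_ae0 => //; first exact: (nnm_mul (nnm_pow P nG) nW).
have H N : {ae mu, forall x, hcube (bigc N.+1) (2 * N.+1%:R)%R x -> G x = 0}.
  apply: int_eq0 => //; first exact: measurable_hcube.
  apply/eqP; rewrite eq_le nnm_int_ge0// andbT leNgt; apply/negP => h.
  by apply: nex; exists N.+1.
have /ae_foralln : forall N, {ae mu, forall x, hcube (bigc N.+1) (2 * N.+1%:R)%R x -> G x = 0}.
  exact: H.
apply: filterS => x Hx _; have [[//|N] _ /box_sub_hcube/Hx ->] := bigc_cover x.
by rewrite poweR0r// mul0e.
Qed.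

(** [G] has positive mass on some large cube. A still larger cube also contains [x], so already the
    first iterate of the maximal function is positive at [x]. *)
Lemma rdf_pos (A B K : R) (G : T -> \bar R) (P : R) (W : T -> R) x : nnm G ->
  (P != 0)%R -> locfin W -> 0 < \int[mu]_x (G x `^ P * (W x)%:E) ->
  0 < rdf A B K G x.
Proof.
move=> nG P0 lW I0; have [N N0 IN] := exists_cube_pos nG P0 lW I0.
have [M M0 xM] := bigc_cover x.
pose L := (maxn N M); have L0 : (0 < 2 * L%:R :> R)%R.
  by rewrite mulr_gt0// ltr0n leq_max N0.
have xL : box (bigc L) (bigc L + const_mx (2 * L%:R))%R x.
  move=> i; have := xM i; rewrite !mxE => /andP[x1 x2].
  have : (M%:R <= L%:R :> R)%R by rewrite ler_nat leq_maxr.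
  by move=> H; apply/andP; split; lra.
apply: lt_le_trans (rdf_ge1 _ _ _ nG x).
rewrite mule_gt0 ?lte_fin ?rdf_ratio_gt0//.
have := cavg_le_hlmax L0 nG xL; rewrite -lee_pdivrMl ?exprn_gt0//.
apply: lt_le_trans; rewrite mule_gt0 ?lte_fin ?invr_gt0 ?exprn_gt0//.
rewrite /cavg mule_gt0 ?lte_fin ?invr_gt0 ?exprn_gt0//.
apply: (lt_le_trans IN); apply: le_int_set => //; try exact: measurable_hcube.
by apply: bigc_sub; rewrite leq_maxl.
Qed.

Lemma int_ae_eq (f g : T -> \bar R) D : measurable D -> nnm f -> nnm g ->
  {ae mu, forall x, f x = g x} -> \int[mu]_(x in D) f x = \int[mu]_(x in D) g x.
Proof.
move=> mD nf ng fg; apply: ae_eq_integral => //.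
- by apply: measurable_funTS; exact: nnm_m.
- by apply: measurable_funTS; exact: nnm_m.
- by apply: filterS fg => x ->.
Qed.

Lemma rdf_exists (A B K : R) : (0 < A)%R -> (0 < B)%R -> exists2 C : R, (0 < C)%R &
  forall W S, locfin W -> locfin S -> (forall x, (W x `^ A * S x `^ B = 1)%R) ->
  A_pair A B K W S -> forall G, nnm G ->
  0 < \int[mu]_x (G x `^ ((A + B) / A) * (W x)%:E) < +oo ->
  exists H : T -> R, [/\ locfin H, {ae mu, forall x, G x <= (H x)%:E},
    \int[mu]_x ((H x)%:E `^ ((A + B) / A) * (W x)%:E) <=
      C%:E * \int[mu]_x (G x `^ ((A + B) / A) * (W x)%:E) &
    forall b s, (0 < s)%R -> {ae mu, forall x, box b (b + const_mx s)%R x ->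
      hav b s H <= (C * H x)%:E}].
Proof.
move=> A0 B0; set P := ((A + B) / A)%R.
have P0 : (0 < P)%R by rewrite divr_gt0// addr_gt0.
have Pn0 : (P != 0)%R by rewrite gt_eqF.
have d0 := @rdf_ratio_gt0 R n A B K.
pose c1 := (2 * 2 `^ P)%R; pose c2 := (6 ^+ n.+1 * (@rdf_ratio R n A B K)^-1)%R.
have c10 : (0 < c1)%R by rewrite mulr_gt0// powR_gt0.
have c20 : (0 < c2)%R by rewrite mulr_gt0 ?exprn_gt0// invr_gt0.
exists (c1 + c2)%R; first by rewrite addr_gt0.
move=> W S lW lS WS AK G nG /andP[I0 Ioo].
set F := rdf A B K G; have nF : nnm F by exact: nnm_rdf.
have F0 x : 0 < F x by exact: (rdf_pos _ _ _ _ nG Pn0 lW I0).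
have nW := nnm_locfin lW.
have FW := int_rdf A0 B0 lW lS WS AK nG; rewrite -/P -/F in FW.
have nFW := nnm_mul (nnm_pow P nF) nW.
(* Finiteness almost everywhere follows from the finite weighted integral, the weight being
   positive. *)
have Ffin : {ae mu, forall x, 0 < F x < +oo}.
  have : {ae mu, forall x, F x `^ P * (W x)%:E < +oo}.
    apply: int_lty_ae => //; apply: le_lt_trans FW _.
    by rewrite lte_mul_pinfty// lee_fin mulr_ge0// powR_ge0.
  apply: filterS => x; rewrite F0/= !ltey; apply: contraNneq => ->.
  by rewrite poweRyr// gt0_mulye// lte_fin; have [] := lW.
have [H [mH H0 FH]] := pos_real_version (nnm_m nF) Ffin.
have nH : nnm (fun x => (H x)%:E) by apply: nnm_EFin => // x; exact: ltW.
have cH b s : (0 < s)%R -> {ae mu, forall x, box b (b + const_mx s)%R x ->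
    hav b s H <= (c2 * H x)%:E}.
  move=> s0; apply: filterS (FH) => x Fx bx.
  rewrite /hav -(int_ae_eq (measurable_hcube b s) nF nH FH) EFinM -Fx.
  apply: le_trans (cavg_le_hlmax s0 nF bx) _; rewrite EFinM -muleA.
  by rewrite lee_wpmul2l ?lee_fin ?exprn_ge0//; exact: hlmax_rdf.
exists H; split.
- split=> // b s s0.
  (* The A_1 bound at a single point of the cube, where [H] is a real number, makes the integral
     over the cube finite. *)
  have [|x bx] := ae_exists (cH b s s0) (measurable_box _ _).
    by rewrite lebesgue_Rn_cube// lte_fin exprn_gt0.
  rewrite /hav lee_pdivrMl ?exprn_gt0// => /le_lt_trans; apply.
  by rewrite -EFinM ltry.
- by apply: filterS FH => x <-; exact: rdf_ge.
- rewrite -(int_ae_eq measurableT (nnm_mul (nnm_pow P nF) nW) (nnm_mul (nnm_pow P nH) nW)).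
    apply: le_trans FW _; rewrite lee_wpmul2r ?(ltW I0)// lee_fin lerDl ltW//.
    by apply: filterS FH => x ->.
- move=> b s s0; have := cH b s s0.
  apply: filterS => x Hx bx; apply: le_trans (Hx bx) _.
  by rewrite lee_fin ler_wpM2r ?(ltW (H0 x))// lerDr ltW.
Qed.

End rdf_real.

(** * Stopping cubes *)

Section stopping.
Context d (T : measurableType d) (R : realType) (mu : {measure set T -> \bar R}).
Context (g : nat -> T -> nat).
Hypothesis mg : forall k j, measurable [set x | g k x = j].
Hypothesis ng : forall k x y, g k.+1 x = g k.+1 y -> g k x = g k y.

(** Unions of pieces of generation [k]; membership is decided by the label. *)
Definition rank_set k (Z : set T) := forall x y, g k x = g k y -> Z x -> Z y.

Lemma rank_set_eq k Z x y : rank_set k Z -> g k x = g k y -> Z x = Z y.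
Proof. by move=> rZ gxy; apply/propext; split; apply: rZ. Qed.

Lemma measurable_rank_set k Z : rank_set k Z -> measurable Z.
Proof.
move=> rZ; rewrite -[Z]setTI.
rewrite (_ : Z = (fun x => `[<Z x>]) @^-1` [set true]).
  apply: (@measurable_fiberwise _ _ g mg k) => // x y gxy.
  by rewrite (rank_set_eq rZ gxy).
by apply/seteqP; split=> x /=; [move=> Zx; exact/asboolP|move/asboolP].
Qed.

Lemma rank_setI k Z Z' : rank_set k Z -> rank_set k Z' -> rank_set k (Z `&` Z').
Proof. by move=> r r' x y gxy [Zx Zx']; split; [exact: r Zx|exact: r' Zx']. Qed.

Lemma rank_set_fib k m x : (k <= m)%N -> rank_set m (fib g k x).
Proof. by move=> km y z gyz; rewrite /fib /= => <-; apply/esym/(nested_le ng km). Qed.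

Lemma le_int_rank k Z (h1 h2 : T -> \bar R) : rank_set k Z -> nnm h1 -> nnm h2 ->
  (forall x, Z x -> \int[mu]_(y in fib g k x) h1 y <= \int[mu]_(y in fib g k x) h2 y) ->
  \int[mu]_(x in Z) h1 x <= \int[mu]_(x in Z) h2 x.
Proof.
move=> rZ n1 n2 H; have mZ := measurable_rank_set rZ.
have E h : nnm h -> \int[mu]_(x in Z) h x =
    \sum_(0 <= j <oo) \int[mu]_(x in [set x | g k x = j]) (h \_ Z) x.
  move=> nh; rewrite integral_mkcond (int_fibers _ mg k)//; exact: nnm_restrict.
rewrite (E _ n1) (E _ n2); apply: lee_nneseries => [j _ _|j _].
  by apply: nnm_int_ge0; exact: nnm_restrict.
rewrite -!integral_mkcondr.
have [[x [gx Zx]]|nex] := pselect (exists x, g k x = j /\ Z x).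
  suff -> : [set x | g k x = j] `&` Z = fib g k x by exact: H.
  rewrite /fib; apply/seteqP; split=> y /=; first by rewrite gx => -[].
  by move=> gy; split; [rewrite gy|exact: (rZ x)].
suff -> : [set x | g k x = j] `&` Z = set0 by rewrite !integral_set0.
by apply/seteqP; split=> // y [/= gy Zy]; apply: nex; exists y.
Qed.

Lemma le_int_bigcup (Z : nat -> set T) (h1 h2 : T -> \bar R) :
  (forall k, measurable (Z k)) -> trivIset setT Z -> nnm h1 -> nnm h2 ->
  (forall k, \int[mu]_(x in Z k) h1 x <= \int[mu]_(x in Z k) h2 x) ->
  \int[mu]_(x in \bigcup_k Z k) h1 x <= \int[mu]_(x in \bigcup_k Z k) h2 x.
Proof.
move=> mZ tZ n1 n2 H; rewrite !ge0_integral_bigcup//.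
- by apply: lee_nneseries => [k _ _|k _]; [exact: nnm_int_ge0|exact: H].
- by apply: measurable_funTS; exact: nnm_m.
- by move=> x _; exact: nnm_ge0.
- by apply: measurable_funTS; exact: nnm_m.
- by move=> x _; exact: nnm_ge0.
Qed.

Context (u1 u2 : T -> R).
Hypothesis m1 : measurable_fun [set: T] u1.
Hypothesis m2 : measurable_fun [set: T] u2.
Hypothesis u10 : forall x, (0 < u1 x)%R.
Hypothesis u20 : forall x, (0 < u2 x)%R.
Hypothesis fin1 : forall k x, 0 < \int[mu]_(y in fib g k x) (u1 y)%:E < +oo.
Hypothesis fin2 : forall k x, 0 < \int[mu]_(y in fib g k x) (u2 y)%:E < +oo.

Let n1 : nnm (fun x => (u1 x)%:E).
Proof. by apply: nnm_EFin => // x; exact: ltW. Qed.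
Let n2 : nnm (fun x => (u2 x)%:E).
Proof. by apply: nnm_EFin => // x; exact: ltW. Qed.

Definition mass (u : T -> R) k x : R := fine (\int[mu]_(y in fib g k x) (u y)%:E).

Lemma mass1E k x : \int[mu]_(y in fib g k x) (u1 y)%:E = (mass u1 k x)%:E.
Proof. by rewrite /mass; have [a _ ->] := ufibE fin1 k x. Qed.

Lemma mass2E k x : \int[mu]_(y in fib g k x) (u2 y)%:E = (mass u2 k x)%:E.
Proof. by rewrite /mass; have [a _ ->] := ufibE fin2 k x. Qed.

Lemma mass1_gt0 k x : (0 < mass u1 k x)%R.
Proof. by rewrite /mass; have [a a0 ->] := ufibE fin1 k x. Qed.

Lemma mass2_gt0 k x : (0 < mass u2 k x)%R.
Proof. by rewrite /mass; have [a a0 ->] := ufibE fin2 k x. Qed.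

Lemma mass_fib u k x y : g k x = g k y -> mass u k x = mass u k y.
Proof. by rewrite /mass /fib => ->. Qed.

Lemma mass2_le k x : (mass u2 k.+1 x <= mass u2 k x)%R.
Proof.
rewrite -lee_fin -!mass2E; apply: le_int_set => //; try exact: measurable_fib.
by move=> y; rewrite /fib /= => /ng.
Qed.

(** The pieces on which the mean density of [u2] with respect to [u1] exceeds [L]. The sets
    [hit L k] collect those selected for the first time at generation [k], so that [overs L] is a
    disjoint union of stopping pieces. *)
Definition over L k := [set x | (L * mass u1 k x < mass u2 k x)%R].
Definition hit L k := over L k `\` \bigcup_(i in [set i | (i < k)%N]) over L i.
Definition overs L := \bigcup_k over L k.

Lemma rank_over L k m : (k <= m)%N -> rank_set m (over L k).
Proof.
by move=> km x y /(nested_le ng km) gxy; rewrite /over/= !(mass_fib _ gxy).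
Qed.

Lemma rank_hit L k : rank_set k (hit L k).
Proof.
move=> x y gxy [ox nx]; split; first exact: (rank_over (leqnn k) gxy).
move=> [i /= ik oy]; apply: nx; exists i => //.
exact: (rank_over (ltnW ik) (esym gxy)).
Qed.

Lemma measurable_hit L k : measurable (hit L k).
Proof. exact: measurable_rank_set (@rank_hit L k). Qed.

Lemma trivIset_hit L : trivIset setT (hit L).
Proof.
apply: ltn_trivIset => k i ki.
apply/seteqP; split=> // x [[ox1 nx1] [ox2 nx2]]; apply: nx2; by exists i.
Qed.

Lemma overs_hit L : overs L = \bigcup_k hit L k.
Proof.
apply/seteqP; split=> x [k _ xk]; last by exists k => //; case: xk.
have ex : exists k, `[<over L k x>] by exists k; apply/asboolP.
case: (ex_minnP ex) => i /asboolP xi imin; exists i => //; split=> // -[j /= ji xj].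
by have := imin j (introT (asboolP _) xj); rewrite leqNgt ji.
Qed.

Lemma measurable_overs L : measurable (overs L).
Proof. by apply: bigcupT_measurable => k; exact: measurable_rank_set (rank_over (leqnn k)). Qed.

Lemma overs_mono L L' : (L <= L')%R -> overs L' `<=` overs L.
Proof.
move=> LL x [k _ xk]; exists k => //; apply: le_lt_trans xk.
by rewrite ler_pM2r// mass1_gt0.
Qed.

Context (D : R) (x0 : T).
Hypothesis doubling : forall k x, g 0%N x = g 0%N x0 -> (mass u1 k x <= D * mass u1 k.+1 x)%R.

Let Q := fib g 0 x0.

Definition avg0 : R := (mass u2 0 x0 / mass u1 0 x0)%R.

Lemma avg0_gt0 : (0 < avg0)%R.
Proof. by rewrite divr_gt0 ?mass1_gt0 ?mass2_gt0. Qed.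

(* a cube selected at level [L >= avg0] is not the root, so its parent is not selected *)
Lemma hit_le L k x : (avg0 <= L)%R -> Q x -> hit L k x ->
  (mass u2 k x <= L * D * mass u1 k x)%R.
Proof.
move=> aL Qx [ox nx]; case: k => [|k] in ox nx *.
  move: ox; rewrite /over/= !(mass_fib _ Qx) ltNge => /negP[].
  by rewrite -ler_pdivrMr// mass1_gt0.
have : ~ over L k x by move=> o; apply: nx; exists k => /=.
move=> /negP; rewrite -leNgt => H; apply: le_trans (mass2_le k x) _.
apply: le_trans H _; rewrite -mulrA ler_wpM2l ?doubling//.
exact: le_trans (ltW avg0_gt0) aL.
Qed.

Lemma overs_upper L : (avg0 <= L)%R -> (0 < D)%R ->
  \int[mu]_(y in overs L `&` Q) (u2 y)%:E <=
    (L * D)%:E * \int[mu]_(y in overs L `&` Q) (u1 y)%:E.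
Proof.
move=> aL D0; have L0 : (0 < L)%R := lt_le_trans avg0_gt0 aL.
have LD : (0 <= L * D)%R by rewrite mulr_ge0 ?ltW.
have mQ : measurable Q by exact: measurable_fib.
have nb : nnm (fun y => (L * D)%:E * (u1 y)%:E).
  by apply: nnm_mul => //; apply: nnm_cst; rewrite lee_fin.
rewrite -intZ ?lee_fin//; last exact: measurableI (measurable_overs L) mQ.
rewrite overs_hit setI_bigcupl; apply: le_int_bigcup => //.
- by move=> k; apply: measurableI => //; exact: measurable_hit.
- by move=> i j _ _ [y [[yi _] [yj _]]]; apply: (@trivIset_hit L) => //; exists y.
move=> k; have rk : rank_set k (hit L k `&` Q).
  by apply: rank_setI; [exact: rank_hit|exact: rank_set_fib].
apply: (le_int_rank rk) => // x [hx Qx].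
rewrite intZ ?lee_fin//; last exact: measurable_fib.
by rewrite mass1E mass2E -EFinM lee_fin; exact: hit_le.
Qed.

(** The weak-type bound, localized: if no larger piece around [x] was selected, the stopping pieces
    meeting [fib k x] lie inside it, and on each of them the [u1]-mass is at most the [u2]-mass
    divided by [L]. *)
Lemma overs_weak L k x : (0 < L)%R -> (forall i, (i < k)%N -> ~ over L i x) ->
  (\int[mu]_(y in overs L `&` fib g k x) (u1 y)%:E <= (L^-1 * mass u2 k x)%:E).
Proof.
move=> L0 nx; rewrite overs_hit setI_bigcupl.
have rI i : (k <= i)%N -> rank_set i (hit L i `&` fib g k x).
  by move=> ki; apply: rank_setI; [exact: rank_hit|exact: rank_set_fib].
have mI i : measurable (hit L i `&` fib g k x).
  by apply: measurableI; [exact: measurable_hit|exact: measurable_fib].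
have tI : trivIset setT (fun i => hit L i `&` fib g k x).
  move=> i j _ _ [y [[yi _] [yj _]]]; apply: (@trivIset_hit L) => //; by exists y.
have nL : nnm (fun y => (L^-1)%:E * (u2 y)%:E).
  by apply: nnm_mul => //; apply: nnm_cst; rewrite lee_fin invr_ge0 ltW.
apply: (@le_trans _ _ (\int[mu]_(y in \bigcup_i (hit L i `&` fib g k x))
    ((L^-1)%:E * (u2 y)%:E))).
  apply: le_int_bigcup => // i; have [ki|ik] := leqP k i; last first.
    rewrite (_ : hit L i `&` _ = set0) ?integral_set0//.
    apply/seteqP; split=> // y [[oy _] fy]; apply: (nx i ik).
    by apply: (rank_over (ltnW ik) _ oy); rewrite fy.
  apply: (le_int_rank (rI i ki)) => // y [[oy _] _].
  rewrite intZ ?lee_fin ?invr_ge0 ?(ltW L0)//; last exact: measurable_fib.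
  by rewrite mass1E mass2E -EFinM lee_fin ler_pdivlMl// ltW.
rewrite intZ ?lee_fin ?invr_ge0 ?(ltW L0)//; last exact: bigcupT_measurable.
rewrite EFinM -mass2E lee_wpmul2l ?lee_fin ?invr_ge0 ?(ltW L0)//.
apply: le_int_set => //; [exact: bigcupT_measurable|exact: measurable_fib|].
by move=> y [i _ []].
Qed.

(* Calderon-Zygmund decay: inside a cube selected at level [L] the set selected at
   level [D / alpha * L] has small [u1]-mass, hence controlled [u2]-mass *)
Lemma overs_decay (alpha beta L : R) : (0 < alpha)%R -> (0 < beta)%R -> (avg0 <= L)%R ->
  (alpha <= D)%R ->
  (forall k x E, Q x -> measurable E -> E `<=` fib g k x ->
    \int[mu]_(y in E) (u1 y)%:E <= (alpha * mass u1 k x)%:E ->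
    \int[mu]_(y in E) (u2 y)%:E <= (beta * mass u2 k x)%:E) ->
  \int[mu]_(y in overs (D / alpha * L) `&` Q) (u2 y)%:E <=
    beta%:E * \int[mu]_(y in overs L `&` Q) (u2 y)%:E.
Proof.
move=> a0 b0 aL aD small; set L' := (D / alpha * L)%R.
have L0 : (0 < L)%R := lt_le_trans avg0_gt0 aL.
have D0 : (0 < D)%R := lt_le_trans a0 aD.
have LL' : (L <= L')%R by rewrite ler_peMl ?(ltW L0)// ler_pdivlMr// mul1r.
have L'0 : (0 < L')%R := lt_le_trans L0 LL'.
have mO := measurable_overs L'.
have nO := nnm_restrict mO n2.
have -> : \int[mu]_(y in overs L' `&` Q) (u2 y)%:E =
    \int[mu]_(y in overs L `&` Q) ((fun y => (u2 y)%:E) \_ (overs L')) y.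
  rewrite -integral_mkcondr; congr integral; apply/seteqP.
  by split=> y; [move=> [/[dup] /(overs_mono LL')]|move=> [[]]].
have nb : nnm (fun y => beta%:E * (u2 y)%:E).
  by apply: nnm_mul => //; apply: nnm_cst; rewrite lee_fin ltW.
have mQ : measurable Q by exact: measurable_fib.
rewrite -intZ ?lee_fin ?(ltW b0)//; last exact: measurableI (measurable_overs L) mQ.
rewrite (overs_hit L) setI_bigcupl; apply: le_int_bigcup => //.
- by move=> k; apply: measurableI => //; exact: measurable_hit.
- by move=> i j _ _ [y [[yi _] [yj _]]]; apply: (@trivIset_hit L) => //; exists y.
move=> k; have rk : rank_set k (hit L k `&` Q).
  by apply: rank_setI; [exact: rank_hit|exact: rank_set_fib].
apply: (le_int_rank rk) => // x [hx Qx].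
rewrite intZ ?lee_fin ?(ltW b0)//; last exact: measurable_fib.
rewrite -integral_mkcondr setIC mass2E -EFinM; apply: small => //.
- by apply: measurableI => //; exact: measurable_fib.
have nx i : (i < k)%N -> ~ over L' i x.
  move=> ik ox; case: hx => _; apply; exists i => //=.
  by apply: le_lt_trans ox; rewrite ler_pM2r// mass1_gt0.
apply: le_trans (overs_weak L'0 nx) _; rewrite lee_fin ler_pdivrMl//.
apply: le_trans (hit_le aL Qx hx) _; rewrite mulrA ler_pM2r ?mass1_gt0//.
rewrite (_ : L' * alpha = L * D)%R// /L'; field.
by rewrite gt_eqF.
Qed.

Definition gehring_exp (beta A : R) : R := (ln (Num.sqrt beta)^-1 / ln A)%R.

Definition gehring_const (beta : R) : R :=
  (1 + (Num.sqrt beta)^-1 * (1 - Num.sqrt beta)^-1)%R.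

(** A layer decomposition of the density [u2 / u1] along the levels [A ^+ j * avg0]: by [diff] a
    point of density above a level lies almost surely in the corresponding stopping set, and
    [overs_decay] makes the [u2]-masses of these sets decay like [beta ^+ j]. *)
Lemma gehring (alpha beta : R) : (0 < alpha < D)%R -> (0 < beta < 1)%R ->
  (forall k x E, Q x -> measurable E -> E `<=` fib g k x ->
    \int[mu]_(y in E) (u1 y)%:E <= (alpha * mass u1 k x)%:E ->
    \int[mu]_(y in E) (u2 y)%:E <= (beta * mass u2 k x)%:E) ->
  {ae mu, forall x, Q x -> forall L, (L * u1 x < u2 x)%R -> overs L x} ->
  forall del, del = gehring_exp beta (D / alpha) ->
  \int[mu]_(x in Q) ((u2 x / u1 x) `^ del * u2 x)%:E <=
    (gehring_const beta * avg0 `^ del * mass u2 0 x0)%:E.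
Proof.
move=> /andP[a0 aD] /andP[b0 b1] small diff del delE.
have D0 : (0 < D)%R := lt_trans a0 aD.
set A := (D / alpha)%R in delE *.
have A1 : (1 < A)%R by rewrite ltr_pdivlMr// mul1r.
have A0 : (0 < A)%R by lra.
set tau := Num.sqrt beta.
have t0 : (0 < tau)%R by rewrite sqrtr_gt0.
have tt : (tau * tau = beta)%R by rewrite -expr2 sqr_sqrtr// ltW.
have t1 : (tau < 1)%R by rewrite -(@ltr_pXn2r _ 2)// ?nnegrE ?(ltW t0)// expr1n expr2 tt.
have del0 : (0 < del)%R by rewrite delE divr_gt0// ln_gt0// invf_gt1.
have Adel : (A `^ del = tau^-1)%R.
  rewrite /powR gt_eqF// delE /gehring_exp -/tau -mulrA mulVf; last first.
    by rewrite gt_eqF// ln_gt0.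
  by rewrite mulr1 lnK// posrE invr_gt0.
have av0 := avg0_gt0.
pose L j := (A ^+ j * avg0)%R.
have L0 j : (0 < L j)%R by rewrite mulr_gt0// exprn_gt0.
have mQ : measurable Q by exact: measurable_fib.
have decay j : \int[mu]_(y in overs (L j) `&` Q) (u2 y)%:E <=
    (beta ^+ j * mass u2 0 x0)%:E.
  elim: j => [|j IH].
    rewrite mul1r -mass2E; apply: le_int_set => //.
    exact: measurableI (measurable_overs _) mQ.
  rewrite /L exprS -mulrA; apply: le_trans (overs_decay a0 b0 _ (ltW aD) small) _.
    by rewrite ler_peMl ?(ltW av0)// exprn_ege1// ltW.
  by rewrite exprS -mulrA EFinM lee_wpmul2l// lee_fin ltW.
pose c j := (A `^ del ^+ j.+1 * avg0 `^ del)%R.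
have c0 j : (0 <= c j)%R by rewrite mulr_ge0 ?exprn_ge0 ?powR_ge0.
have nh j : nnm (fun x => (c j)%:E * ((fun y => (u2 y)%:E) \_ (overs (L j))) x).
  apply: nnm_mul; first by apply: nnm_cst; rewrite lee_fin.
  by apply: nnm_restrict => //; exact: measurable_overs.
have na : nnm (fun x => (avg0 `^ del)%:E * (u2 x)%:E).
  by apply: nnm_mul => //; apply: nnm_cst; rewrite lee_fin powR_ge0.
have nl : nnm (fun x => ((u2 x / u1 x) `^ del * u2 x)%:E).
  apply: nnm_EFin; last by move=> x; rewrite mulr_ge0 ?powR_ge0// ltW.
  apply: measurable_funM => //; apply: (measurableT_comp (measurable_powR _)).
  apply: measurable_funM => //.
  have -> : (fun z => (u1 z)^-1)%R = (fun z => u1 z `^ (-1))%R.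
    by apply/funext => z; rewrite powR_inv1// ltW.
  exact: (measurableT_comp (measurable_powR _)).
apply: (@le_trans _ _ (\int[mu]_(x in Q) ((avg0 `^ del)%:E * (u2 x)%:E +
    \sum_(0 <= j <oo) ((c j)%:E * ((fun y => (u2 y)%:E) \_ (overs (L j))) x)))).
  apply: ae_ge0_le_integral => //.
  - by move=> x _; exact: (nnm_ge0 nl).
  - by apply: measurable_funTS; exact: nnm_m nl.
  - by move=> x _; exact: (nnm_ge0 (nnm_add na (nnm_series nh))).
  - by apply: measurable_funTS; exact: (nnm_m (nnm_add na (nnm_series nh))).
  apply: filterS diff => x dx Qx.
  have rho0 : (0 < u2 x / u1 x)%R by rewrite divr_gt0.
  have [ra|ra] := lerP (u2 x / u1 x) avg0.
    apply: (@le_trans _ _ ((avg0 `^ del)%:E * (u2 x)%:E)).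
      rewrite -EFinM lee_fin ler_wpM2r ?(ltW (u20 x))//.
      by rewrite ge0_ler_powR ?nnegrE ?(ltW rho0) ?(ltW av0) ?(ltW del0).
    by rewrite leeDl//; exact: (nnm_ge0 (nnm_series nh)).
  (* The layer exists because [A ^+ k >= k * (A - 1)]. *)
  have ex : exists j, (u2 x / u1 x <= L j.+1)%R.
    exists (Num.truncn (u2 x / u1 x / avg0 / (A - 1))).+1.
    rewrite /L -ler_pdivrMr//; set k := (Num.truncn _).+1.
    apply: (@le_trans _ _ (A ^+ k)%R); last by rewrite ler_weXn2l// ltW.
    apply: (@le_trans _ _ (k%:R * (A - 1))%R).
      by rewrite -ler_pdivrMr ?subr_gt0//; apply: ltW; exact: truncnS_gt.
    elim: (k) => [|i IH]; first by rewrite mul0r.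
    rewrite exprS -natr1 mulrDl mul1r (le_trans (lerD IH (lexx _)))//.
    have : (1 <= A ^+ i)%R by rewrite exprn_ege1// ltW.
    by move: (A ^+ i)%R => z z1; nra.
  case: (ex_minnP ex) => j rj jmin.
  have Lj : (L j < u2 x / u1 x)%R.
    case: j rj jmin => [|j] rj jmin; first by rewrite /L mul1r.
    by rewrite ltNge; apply/negP => /jmin; rewrite ltnn.
  have oj : overs (L j) x by apply: dx => //; rewrite -ltr_pdivlMr.
  apply: (@le_trans _ _ ((c j)%:E * ((fun y => (u2 y)%:E) \_ (overs (L j))) x)).
    rewrite patchE mem_set// -EFinM lee_fin ler_wpM2r ?(ltW (u20 x))//.
    apply: (@le_trans _ _ (L j.+1 `^ del)%R).
      by rewrite ge0_ler_powR ?nnegrE ?(ltW rho0) ?(ltW (L0 _)) ?(ltW del0).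
    rewrite /L powRM ?exprn_ge0 ?(ltW A0) ?(ltW av0)// /c.
    by rewrite (powRX _ _ (ltW A0)).
  apply: (le_trans (nneseries_term_le j (fun k => nnm_ge0 (nh k) x))).
  by rewrite leeDr//; exact: (nnm_ge0 na).
rewrite intD//; last exact: nnm_series.
rewrite intZ ?lee_fin ?powR_ge0// mass2E (int_series _ mQ nh).
apply: (@le_trans _ _ ((avg0 `^ del)%:E * (mass u2 0 x0)%:E +
  ((tau^-1 * (1 - tau)^-1) * avg0 `^ del * mass u2 0 x0)%:E)); last first.
  by rewrite -EFinM -EFinD lee_fin /gehring_const -/tau; lra.
rewrite leeD2l//; apply: nneseries_le => [j|m]; first exact: (nnm_int_ge0 _ _ (nh j)).
apply: (@le_trans _ _ (\sum_(0 <= j < m)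
   (tau ^+ j * (tau^-1 * avg0 `^ del * mass u2 0 x0))%:E)).
  apply: lee_sum => j _; rewrite intZ ?lee_fin//; last first.
    by apply: nnm_restrict => //; exact: measurable_overs.
  rewrite -integral_mkcondr setIC.
  apply: (@le_trans _ _ ((c j)%:E * (beta ^+ j * mass u2 0 x0)%:E)).
    by rewrite lee_wpmul2l ?lee_fin.
  rewrite -EFinM lee_fin /c Adel -tt exprMn exprS.
  rewrite le_eqVlt; apply/orP; left; apply/eqP.
  have tj : (tau^-1 ^+ j * tau ^+ j = 1)%R.
    by rewrite -exprMn mulVf ?gt_eqF// expr1n.
  transitivity (tau^-1 ^+ j * tau ^+ j * (tau ^+ j *
      (tau^-1 * avg0 `^ del * mass u2 0 x0)))%R; first by ring.
  by rewrite tj mul1r.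
rewrite sumEFin lee_fin -mulr_suml.
have gs : (\sum_(0 <= j < m) tau ^+ j <= (1 - tau)^-1)%R.
  have -> : (\sum_(0 <= j < m) tau ^+ j = (1 - tau ^+ m) / (1 - tau))%R.
    elim: (m) => [|j IH]; first by rewrite big_geq// expr0 subrr mul0r.
    rewrite big_nat_recr//= IH exprS; field; by rewrite subr_eq0 gt_eqF.
  by rewrite ler_piMl ?invr_ge0 ?subr_ge0 ?(ltW t1)// gerBl exprn_ge0// ltW.
rewrite [leRHS](_ : _ = (1 - tau)^-1 * (tau^-1 * avg0 `^ del * mass u2 0 x0))%R.
  by rewrite ler_wpM2r// !mulr_ge0 ?invr_ge0 ?powR_ge0 ?(ltW t0)// ltW// mass2_gt0.
by ring.
Qed.

End stopping.

(** * Differentiation *)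

Section density_comparison.
Context d (T : measurableType d) (R : realType) (mu : {measure set T -> \bar R}).
Context (u1 u2 : T -> R).
Hypothesis m1 : measurable_fun [set: T] u1.
Hypothesis m2 : measurable_fun [set: T] u2.
Hypothesis u10 : forall x, (0 < u1 x)%R.
Hypothesis u20 : forall x, (0 < u2 x)%R.

Let n1 : nnm (fun x => (u1 x)%:E).
Proof. by apply: nnm_EFin => // x; exact: ltW. Qed.
Let n2 : nnm (fun x => (u2 x)%:E).
Proof. by apply: nnm_EFin => // x; exact: ltW. Qed.

(** The maximal pieces contained in [U] that are not over [q] are disjoint and cover [E]; on each
    the [u2]-mass is at most [q] times the [u1]-mass. *)
Lemma le_int_cover (g : nat -> T -> nat) (U E : set T) (q : R) :
  (forall k j, measurable [set x | g k x = j]) ->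
  (forall k x y, g k.+1 x = g k.+1 y -> g k x = g k y) ->
  (forall k x, 0 < \int[mu]_(y in fib g k x) (u1 y)%:E < +oo) ->
  (forall k x, 0 < \int[mu]_(y in fib g k x) (u2 y)%:E < +oo) ->
  (0 <= q)%R -> measurable U -> measurable E ->
  (forall x, E x -> exists k, fib g k x `<=` U) ->
  (forall x, E x -> forall k, ~ over mu g u1 u2 q k x) ->
  \int[mu]_(x in E) (u2 x)%:E <= q%:E * \int[mu]_(x in U) (u1 x)%:E.
Proof.
move=> mg ng fin1 fin2 q0 mU mE EU Eo.
pose Z k := [set x | [/\ fib g k x `<=` U, forall i, (i < k)%N -> ~ (fib g i x `<=` U)
  & ~ over mu g u1 u2 q k x]].
have rZ k : rank_set g k (Z k).
  move=> x y gxy [x1 x2 x3]; split; first by rewrite -(fib_eq gxy).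
  - by move=> i ik; rewrite -(fib_eq (nested_le ng (ltnW ik) gxy)); exact: x2.
  - by move=> /(rank_over ng (leqnn k) (esym gxy)).
have mZ k : measurable (Z k) := measurable_rank_set mg (rZ k).
have tZ : trivIset setT Z.
  apply: ltn_trivIset => k i ik; apply/seteqP; split=> // x [[x1 _ _] [_ x2 _]].
  exact: (x2 i ik).
have EZ : E `<=` \bigcup_k Z k.
  move=> x Ex; have [k0 k0U] := EU x Ex.
  have ex : exists k, `[<fib g k x `<=` U>] by exists k0; apply/asboolP.
  case: (ex_minnP ex) => k /asboolP xk kmin; exists k => //; split => //.
    by move=> i ik /asboolP/kmin; rewrite leqNgt ik.
  exact: Eo.
have ZU : \bigcup_k Z k `<=` U by move=> x [k _ [xU _ _]]; apply: xU; exact: fib_refl.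
have mbZ : measurable (\bigcup_k Z k) by exact: bigcupT_measurable.
apply: (le_trans (le_int_set mu mE mbZ n2 EZ)).
have nq : nnm (fun x => q%:E * (u1 x)%:E).
  by apply: nnm_mul => //; apply: nnm_cst; rewrite lee_fin.
rewrite -intZ ?lee_fin//; apply: le_trans (le_int_set mu mbZ mU nq ZU).
apply: le_int_bigcup => // k; apply: (le_int_rank mg (rZ k)) => // x [_ _ /negP].
rewrite /over/= -leNgt => H; rewrite intZ ?lee_fin//; last exact: measurable_fib.
by rewrite (mass1E fin1) (mass2E fin2) -EFinM lee_fin.
Qed.

(** Continuity from above, obtained from monotone convergence on the complements in [Q]: the
    [u1]-mass of [Q] minus the m-th approximation is at most [u1(Q) - u2(E) / q]. *)
Lemma le_int_outer_limit (Q E : set T) (U : nat -> set T) (q : R) :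
  measurable Q -> measurable E -> E `<=` Q -> (forall m, measurable (U m)) ->
  (forall m, E `<=` U m) -> mu (\bigcap_m U m `\` E) = 0 ->
  \int[mu]_(x in Q) (u1 x)%:E < +oo -> (0 < q)%R ->
  (forall m, \int[mu]_(x in E) (u2 x)%:E <=
     q%:E * \int[mu]_(x in (\bigcap_(i in [set i | (i <= m)%N]) U i) `&` Q) (u1 x)%:E) ->
  \int[mu]_(x in E) (u2 x)%:E <= q%:E * \int[mu]_(x in E) (u1 x)%:E.
Proof.
move=> mQ mE EQ mU EU U0 fQ q0 H.
pose B m := \bigcap_(i in [set i | (i <= m)%N]) U i.
have mB m : measurable (B m).
  rewrite /B bigcap_mkcond; apply: bigcapT_measurable => i.
  by case: ifPn.
have mBoo : measurable (\bigcap_m U m) by exact: bigcapT_measurable.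
have int_split A A' : measurable A -> measurable A' ->
    \int[mu]_(x in A) (u1 x)%:E = \int[mu]_(x in A `&` A') (u1 x)%:E +
      \int[mu]_(x in A `\` A') (u1 x)%:E.
  move=> mA mA'; rewrite -{1}(setUIDK A A') ge0_integral_setU//.
  - exact: measurableI.
  - exact: measurableD.
  - by apply: measurable_funTS; exact: nnm_m n1.
  - by move=> x _; exact: (nnm_ge0 n1).
  - by apply/disj_setPS => x [[_ ?] []].
have fS A : measurable A -> A `<=` Q -> \int[mu]_(x in A) (u1 x)%:E < +oo.
  by move=> mA AQ; apply: le_lt_trans fQ; exact: le_int_set.
have i0 A : 0 <= \int[mu]_(x in A) (u1 x)%:E by exact: nnm_int_ge0.
have fE A : measurable A -> A `<=` Q -> exists a : R,
    \int[mu]_(x in A) (u1 x)%:E = a%:E.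
  move=> mA AQ; have := fS A mA AQ; have := i0 A.
  by case: (\int[mu]_(x in A) _) => // a _ _; exists a.
have e2f : exists e2 : R, \int[mu]_(x in E) (u2 x)%:E = e2%:E.
  have := H 0%N; have [||a ->] := fE (B 0%N `&` Q).
  - exact: measurableI.
  - by move=> x [].
  rewrite -EFinM; have : 0 <= \int[mu]_(x in E) (u2 x)%:E by exact: nnm_int_ge0.
  by case: (\int[mu]_(x in E) _) => // e _ _; exists e.
have [e2 e2E] := e2f; have [M ME] := fE Q mQ (@subset_refl _ Q).
have nC m : nnm ((fun x => (u1 x)%:E) \_ (Q `\` B m)).
  by apply: nnm_restrict => //; exact: measurableD.
have Ble m k : (m <= k)%N -> B k `<=` B m.
  by move=> mk x Bx i im; apply: Bx; exact: leq_trans mk.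
have sup_le : \int[mu]_x ereal_sup (range (fun m => ((fun x => (u1 x)%:E) \_ (Q `\` B m)) x))
    <= (M - e2 / q)%:E.
  apply: int_sup_le => // [x m k mk|m].
    rewrite !patchE; case: ifPn => [|_]; last by case: ifP => // _; exact: (nnm_ge0 n1).
    rewrite inE => -[Qx nB]; rewrite mem_set//; split=> // Bx; apply: nB.
    exact: Ble Bx.
  rewrite -integral_mkcond; have := H m; rewrite e2E.
  have := int_split Q (B m) mQ (mB m); rewrite ME setIC.
  have [||a aE] := fE (B m `&` Q).
  - exact: measurableI.
  - by move=> x [].
  have [||c cE] := fE (Q `\` B m).
  - exact: measurableD.
  - by move=> x [].
  rewrite -/(B m) aE cE -!EFinM -EFinD => -[->]; rewrite !lee_fin => h.
  by rewrite lerBrDr -lerBrDl addrK ler_pdivrMr// mulrC.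
have {sup_le} lim_le : \int[mu]_(x in Q `\` \bigcap_m U m) (u1 x)%:E <= (M - e2 / q)%:E.
  apply: le_trans sup_le; rewrite integral_mkcond; apply: le_intT.
  - by apply: nnm_restrict => //; exact: measurableD.
  - exact: nnm_sup.
  move=> x; rewrite patchE; case: ifPn; last first.
    move=> _; apply: (@le_trans _ _ (((fun x => (u1 x)%:E) \_ (Q `\` B 0%N)) x)).
      exact: (nnm_ge0 (nC 0%N)).
    by apply: ereal_sup_ubound; exists 0%N.
  rewrite inE => -[Qx] /existsNP[m /not_implyP[_ nU]].
  apply: ereal_sup_ubound; exists m => //; rewrite patchE mem_set//.
  by split=> // Bx; apply: nU; apply: Bx => /=.
have EE : \int[mu]_(x in Q `&` \bigcap_m U m) (u1 x)%:E = \int[mu]_(x in E) (u1 x)%:E.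
  rewrite (int_split _ E (measurableI _ _ mQ mBoo) mE).
  rewrite [X in _ + X](_ : _ = 0) ?adde0.
    congr integral; apply/seteqP; split=> x; first by case.
    by move=> Ex; split=> //; split; [exact: EQ|move=> m _; exact: EU].
  apply: int_ae0 => //; first by apply: measurableD => //; exact: measurableI.
  exists (\bigcap_m U m `\` E); split=> //; first exact: measurableD.
  by move=> x /= /not_implyP[[[_ Ux] nE] _].
have := int_split Q _ mQ mBoo; rewrite ME EE.
have [e1 e1E] := fE E mE EQ; rewrite e1E e2E.
have [||c cE] := fE (Q `\` \bigcap_m U m).
- exact: measurableD.
- by move=> x [].
move: lim_le; rewrite cE -EFinD lee_fin => h [Mec].
rewrite -EFinM lee_fin -ler_pdivrMl// mulrC; move: h; rewrite Mec; lra.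
Qed.

Lemma measurable_density_lt q :
  measurable ((fun x => (q * u1 x < u2 x)%R) @^-1` [set true]).
Proof.
rewrite -[X in measurable X]setTI; apply: measurable_fun_ltr => //.
exact: measurable_funM.
Qed.

Lemma density_lt_null (E : set T) (q : R) : measurable E -> (0 <= q)%R ->
  (forall x, E x -> (q * u1 x < u2 x)%R) -> \int[mu]_(x in E) (u1 x)%:E < +oo ->
  \int[mu]_(x in E) (u2 x)%:E <= q%:E * \int[mu]_(x in E) (u1 x)%:E -> mu E = 0.
Proof.
move=> mE q0 Eq f1 H; apply/eqP; rewrite eq_le measure_ge0 andbT leNgt; apply/negP => E0.
pose h x := (Num.max 0 (u2 x - q * u1 x))%:E.
have nh : nnm h.
  apply: nnm_EFin; last by move=> x; rewrite le_max lexx.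
  apply: measurable_maxr => //; apply: measurable_funB => //.
  exact: measurable_funM.
have hE x : E x -> h x = (u2 x - q * u1 x)%:E.
  by move=> Ex; rewrite /h max_r// subr_ge0 ltW// Eq.
have : 0 < \int[mu]_(x in E) h x.
  by apply: int_gt0 => // x Ex; rewrite hE// lte_fin subr_gt0 Eq.
have : \int[mu]_(x in E) (u2 x)%:E = \int[mu]_(x in E) h x +
    q%:E * \int[mu]_(x in E) (u1 x)%:E.
  have nq : nnm (fun x => q%:E * (u1 x)%:E).
    by apply: nnm_mul => //; apply: nnm_cst; rewrite lee_fin.
  rewrite -intZ ?lee_fin// -intD//; apply: eq_integral => x; rewrite inE => Ex.
  by rewrite hE// -EFinM -EFinD subrK.
have e0 : 0 <= \int[mu]_(x in E) (u1 x)%:E by exact: nnm_int_ge0.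
move: H f1 e0; case: (\int[mu]_(x in E) (u1 x)%:E) => // e H _ _ E2.
move: H; rewrite E2 -EFinM => + h0; rewrite leNgt => /negP; apply.
by rewrite lteDr.
Qed.

End density_comparison.

Lemma fib_anti d (T : measurableType d) (g : nat -> T -> nat) :
  (forall k x y, g k.+1 x = g k.+1 y -> g k x = g k y) ->
  forall k m x, (k <= m)%N -> fib g m x `<=` fib g k x.
Proof. by move=> ng k m x km y; rewrite /fib/=; exact: nested_le. Qed.

(** * Differentiation along the dyadic grid of a cube *)

Section local_grid.
Context {R : realType} {n : nat}.
Local Notation V := ('rV[R]_n.+1).
Local Notation T := (Rn R n).
Local Notation mu := (@lebesgue_Rn R n).

Lemma open_box (a b : V) : open (box a b).
Proof.
rewrite openE => x abx; rewrite /interior.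
have : \forall y \near (x : V), forall i : 'I_n.+1, (a 0%R i < (y : V) 0%R i < b 0%R i)%R.
  apply: (@filter_forall V 'I_n.+1
    (fun i y => is_true (a 0 i < y 0 i < b 0 i)%R) (nbhs x)) => i.
  have H : nbhs (x 0%R i) [set z : R | (a 0%R i < z < b 0%R i)%R].
    apply: open_nbhs_nbhs; split; last exact: abx.
    have -> : [set z : R | (a 0%R i < z < b 0%R i)%R] = `]a 0%R i, b 0%R i[%classic.
      by apply/seteqP; split=> z /=; rewrite in_itv.
    exact: interval_open.
  exact: (@coord_continuous R 1 n.+1 0%R i x _ H).
by apply.
Qed.

Definition lgrid (b : V) (s : R) : nat -> T -> nat := grid b s (fun _ _ => 0%R).

Lemma no_shift k (i : 'I_n.+1) : exists z : int,
  ((fun (_ : nat) (_ : 'I_n.+1) => 0%R) k.+1 i =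
   2 * (fun (_ : nat) (_ : 'I_n.+1) => 0%R) k i - z%:~R :> R)%R.
Proof. by exists 0%R; rewrite mulr0 subr0. Qed.

Section fixed.
Context (b : V) (s : R).
Hypothesis s0 : (0 < s)%R.

Lemma measurable_lgrid k j : measurable [set x | lgrid b s k x = j].
Proof. by rewrite /lgrid; exact: measurable_grid. Qed.

Lemma lgrid_nested k x y : lgrid b s k.+1 x = lgrid b s k.+1 y -> lgrid b s k x = lgrid b s k y.
Proof. exact: (grid_nested no_shift). Qed.

Lemma lgrid_fib0 x : hcube b s x -> fib (lgrid b s) 0 x = hcube b s.
Proof.
move=> bx; rewrite /lgrid fib_grid//; congr hcube; last by rewrite /side expr0 divr1.
apply/rowP => i; rewrite mxE subr0 expr0 divr1.
have -> : Num.floor (gcoord b s (fun _ _ => 0%R) 0 x i) = 0%R.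
  apply/floor_def; rewrite /gcoord expr0 mulr1 addr0 add0r.
  have /andP[b1 b2] := bx i.
  by rewrite divr_ge0 ?subr_ge0 ?(ltW s0)//= ltr_pdivrMr// mul1r ltrBlDl.
by rewrite mulr0 addr0.
Qed.

Lemma hcube_corner : hcube b s b.
Proof. by move=> i; rewrite lexx ltrDl. Qed.

Lemma lgrid_root : fib (lgrid b s) 0 b = hcube b s.
Proof. by rewrite lgrid_fib0//; exact: hcube_corner. Qed.

Lemma locfin_lfib u : locfin u -> forall k x,
  0 < \int[mu]_(y in fib (lgrid b s) k x) (u y)%:E < +oo.
Proof.
move=> lu k x; rewrite /lgrid fib_grid//.
by apply: locfin_hcube => //; exact: side_gt0.
Qed.

Lemma outer_regular (E : set T) e : mu E < +oo -> (0 < e)%R ->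
  exists U : set V, [/\ open U, E `<=` U & mu (U : set T) <= mu E + e%:E].
Proof.
move=> Eoo e0.
have Efin : lebesgue_outer E \is a fin_num.
  by rewrite ge0_fin_numE ?lebesgue_outer_ge0.
have [_ [F EF <-] /ltW Fe] := lb_ereal_inf_adherent e0 Efin.
exists (\bigcup_k box (F k).1 (F k).2); split => //.
  by apply: bigcup_open => k _; exact: open_box.
apply: le_trans Fe; apply: ereal_inf_lbound.
by exists F.
Qed.

(** For a fixed level [q], let [bad q] be the set where the density exceeds [q] although no piece
    around the point has mean density above [q]. Open sets shrinking to it, cut into maximal pieces,
    give [u2(bad q) <= q * u1(bad q)], which forces measure zero. Only this one-sided form of
    Lebesgue's theorem enters the stopping time argument. *)
Lemma differentiation u1 u2 : locfin u1 -> locfin u2 ->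
  {ae mu, forall x, fib (lgrid b s) 0 b x -> forall L, (L * u1 x < u2 x)%R ->
    overs mu (lgrid b s) u1 u2 L x}.
Proof.
move=> l1 l2; have [m1 u10 _] := l1; have [m2 u20 _] := l2.
have n1 := nnm_locfin l1.
have mQ : measurable (hcube b s : set T) := measurable_hcube b s.
have fin1 := locfin_lfib l1; have fin2 := locfin_lfib l2.
have mov q := measurable_overs mu measurable_lgrid lgrid_nested u1 u2 q.
have f1 (A : set T) : measurable A -> A `<=` hcube b s -> \int[mu]_(x in A) (u1 x)%:E < +oo.
  move=> mA AQ; apply: (@le_lt_trans _ _ (\int[mu]_(x in hcube b s) (u1 x)%:E)).
    exact: le_int_set.
  by have /andP[] := locfin_hcube b l1 s0.
pose bad q := [set x : T | [/\ hcube b s x, (q * u1 x < u2 x)%R &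
   ~ overs mu (lgrid b s) u1 u2 q x]].
have mbad q : measurable (bad q).
  rewrite (_ : bad q = (hcube b s `&` (fun x => (q * u1 x < u2 x)%R) @^-1` [set true])
      `\` overs mu (lgrid b s) u1 u2 q); last first.
    by apply/seteqP; split=> x [] => [*|[]].
  apply: measurableD; last exact: mov.
  by apply: measurableI; [exact: mQ|exact: measurable_density_lt].
have null q : (0 < q)%R -> mu (bad q) = 0.
  move=> q0; apply: (@density_lt_null _ _ _ mu u1 u2 m1 m2 u10 (bad q) q) => //.
  - exact: ltW.
  - by move=> x [].
  - by apply: f1 => // x [].
  have Eoo : mu (bad q) < +oo.
    apply: (@le_lt_trans _ _ (mu (hcube b s))).
      by apply: le_measure; rewrite ?inE// => x [].
    by rewrite lebesgue_Rn_hcube// ltry.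
  have [U HU] : {U : nat -> set V & forall m, [/\ open (U m), bad q `<=` U m &
      mu (U m : set T) <= mu (bad q) + (m.+1%:R^-1)%:E]}.
    apply: (@choice _ _ (fun m W => [/\ open W, bad q `<=` W &
      mu (W : set T) <= mu (bad q) + (m.+1%:R^-1)%:E])) => m.
    by have [|W] := @outer_regular (bad q) (m.+1%:R^-1)%R Eoo; [|exists W].
  have mU m : measurable (U m : set T).
    by have [oU _ _] := HU m; exact: (open_measurable b (fun=> fun=> 0%R) s0 oU).
  apply: (@le_int_outer_limit _ _ _ mu u1 u2 m1 m2 u10 u20 (hcube b s) (bad q) U q) => //.
  - by move=> x [].
  - by move=> m; have [] := HU m.
  - apply/eqP; rewrite eq_le measure_ge0 andbT; apply/lee_addgt0Pr => e e0; rewrite add0e.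
    have [m me] : exists m, (m.+1%:R^-1 <= e)%R.
      exists (Num.truncn e^-1); rewrite -[leRHS]invrK lef_pV2 ?posrE ?invr_gt0//.
      exact/ltW/truncnS_gt.
    have [_ EU Um] := HU m.
    apply: (@le_trans _ _ (mu ((U m : set T) `\` bad q))).
      apply: le_measure; rewrite ?inE; [|exact: measurableD|].
        by apply: measurableD => //; exact: bigcapT_measurable.
      by move=> x [Ux nE]; split=> //; exact: Ux.
    rewrite measureD//; last by apply: le_lt_trans Um _; rewrite lte_add_pinfty// ltry.
    rewrite setIidr// leeBlDr//; last by rewrite ge0_fin_numE// measure_ge0.
    by apply: le_trans Um _; rewrite addeC leeD2r// lee_fin.
  - by apply: f1 => //; exact: mQ.
  move=> m; set B := \bigcap_(i in _) _.
  have mB : measurable (B : set T).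
    by rewrite /B bigcap_mkcond; apply: bigcapT_measurable => i; case: ifPn.
  apply: (@le_int_cover _ _ _ mu u1 u2 m1 m2 u10 u20 (lgrid b s)) => //.
  - exact: measurable_lgrid.
  - exact: lgrid_nested.
  - exact: ltW.
  - exact: measurableI.
  - move=> x Ex; have [Qx _ nx] := Ex.
    have kI : exists k, forall i, (i <= m)%N -> fib (lgrid b s) k x `<=` U i.
      have Uk i : exists k, fib (lgrid b s) k x `<=` U i.
        have [oU EU _] := HU i; apply: (fib_sub_open b (fun=> fun=> 0%R) s0 oU).
        exact: EU.
      elim: (m) => [|j [k Hk]]; first by have [k Hk] := Uk 0%N; exists k; case.
      have [k' Hk'] := Uk j.+1; exists (maxn k k') => i.
      rewrite leq_eqVlt => /predU1P[->|ij] y xy.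
        exact/Hk'/(fib_anti lgrid_nested (leq_maxr k k') xy).
      exact: (Hk i ij _ (fib_anti lgrid_nested (leq_maxl k k') xy)).
    have [k Hk] := kI; exists k => y xy; split; first by move=> i /= /Hk; exact.
    rewrite -(lgrid_fib0 Qx); exact: (fib_anti lgrid_nested (leq0n k) xy).
  - by move=> x [_ _ nx] k ox; apply: nx; exists k.
(* Countably many exceptional sets suffice: a real level below the density is replaced by a larger
   rational one still below it. *)
have /ae_foralln : forall i : nat, {ae mu, forall x, hcube b s x ->
    if @unpickle rat i is Some q then
      (0 < ratr q :> R)%R -> (ratr q * u1 x < u2 x)%R ->
      overs mu (lgrid b s) u1 u2 (ratr q) x
    else True}.
  move=> i; case: unpickle => [q|]; last by apply: nearW => x _.
  have [q0|q0] := boolP (0 < ratr q :> R)%R; last by apply: nearW => x _ q1.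
  exists (bad (ratr q)); split; [exact: mbad|exact: null|].
  by move=> x /= /not_implyP[Qx /not_implyP[_ /not_implyP[]]].
rewrite lgrid_root; apply: filterS => x Hx Qx L Lx.
have [L0|L0] := lerP L 0%R.
  exists 0%N => //; rewrite /over/=; apply: (@le_lt_trans _ _ 0%R).
    by rewrite mulr_le0_ge0// ltW// (mass1_gt0 fin1).
  exact: (mass2_gt0 fin2).
have := Lx; rewrite -ltr_pdivlMr// => /rat_in_itvoo[q]; rewrite in_itv/= => /andP[Lq].
rewrite ltr_pdivlMr// => qx.
apply: (overs_mono fin1 (ltW Lq)).
have := Hx (pickle q) Qx; rewrite pickleK; apply => //; exact: lt_trans Lq.
Qed.

End fixed.
End local_grid.

Section int_misc.
Context d (T : measurableType d) (R : realType) (mu : {measure set T -> \bar R}).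

(* stated without measurability because [maximal f] is not known to be measurable: the
   integral of any nonnegative function is a supremum over simple functions below it *)
Lemma le_int_any (f1 f2 : T -> \bar R) D : (forall x, D x -> 0 <= f1 x) ->
  (forall x, D x -> 0 <= f2 x) ->
  (forall x, D x -> f1 x <= f2 x) ->
  \int[mu]_(x in D) f1 x <= \int[mu]_(x in D) f2 x.
Proof.
move=> f10 f20 f12; rewrite !ge0_integralE//; apply: le_ereal_sup => _ [h hf1 <-].
exists h => // x; apply: le_trans (hf1 x) _; rewrite !patchE; case: ifPn => //.
by rewrite inE; exact: f12.
Qed.

Lemma int_setID (f : T -> \bar R) A A' : measurable A -> measurable A' -> nnm f ->
  \int[mu]_(x in A) f x = \int[mu]_(x in A `&` A') f x + \int[mu]_(x in A `\` A') f x.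
Proof.
move=> mA mA' nf; rewrite -{1}(setUIDK A A') ge0_integral_setU//.
- exact: measurableI.
- exact: measurableD.
- by apply: measurable_funTS; exact: nnm_m nf.
- by move=> x _; exact: (nnm_ge0 nf).
- by apply/disj_setPS => x [[_ ?] []].
Qed.

End int_misc.

(** * Reverse Hoelder and A_infinity *)

Section a_infinity.
Context {R : realType} {n : nat}.
Local Notation V := ('rV[R]_n.+1).
Local Notation T := (Rn R n).
Local Notation mu := (@lebesgue_Rn R n).
Local Notation one := (fun _ : T => 1%R : R).

Lemma avg_box (b : V) s (f : T -> \bar R) : (0 < s)%R -> nnm f ->
  avg (box b (b + const_mx s)%R) f = cavg b s f.
Proof.
move=> s0 nf; rewrite /avg /cavg [X in X^-1]lebesgue_Rn_cube//.
by rewrite inver gt_eqF ?exprn_gt0// int_hcube.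
Qed.

Lemma maximal_le_hlmax (f : T -> \bar R) (x : T) : nnm f -> maximal f x <= (6 ^+ n.+1)%:E * hlmax
  f x.
Proof.
move=> nf; apply: ge_ereal_sup => _ [_ [[b [s [s0 ->]]] bx] <-].
have -> : (fun y => `|f y|) = f by apply/funext => y; rewrite gee0_abs// nnm_ge0.
by rewrite avg_box//; exact: cavg_le_hlmax.
Qed.

Lemma maximal_ge0 (f : T -> \bar R) (x : T) : nnm f -> 0 <= maximal f x.
Proof.
move=> nf; have [N N0 xN] := bigc_cover x.
apply: (@le_trans _ _ (avg (box (bigc N) (bigc N + const_mx (2 * N%:R))%R) (fun y => `|f y|))).
  have -> : (fun y => `|f y|) = f by apply/funext => y; rewrite gee0_abs// nnm_ge0.
  rewrite /avg mule_ge0 ?nnm_int_ge0// inve_ge0 measure_ge0//.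
apply: ereal_sup_ubound; exists (box (bigc N) (bigc N + const_mx (2 * N%:R))%R) => //.
by split=> //; exists (bigc N), (2 * N%:R)%R; rewrite mulr_gt0// ltr0n.
Qed.

(** [maximal] sees open cubes only, and [x] may lie on the boundary; the concentric cube of twice
    the side contains it in its interior and costs [2 ^+ n.+1]. *)
Lemma cavg_le_maximal (c : V) t (f : T -> \bar R) (x : V) : (0 < t)%R -> nnm f -> hcube c t x ->
  cavg c t f <= (2 ^+ n.+1)%:E * maximal f x.
Proof.
move=> t0 nf cx; pose c' := (c - const_mx (t / 2))%R.
have t20 : (0 < 2 * t)%R by rewrite mulr_gt0.
have sub : hcube c t `<=` box c' (c' + const_mx (2 * t))%R.
  move=> y cy i; have /andP[y1 y2] := cy i; rewrite !mxE; apply/andP; split; lra.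
apply: (@le_trans _ _ ((2 ^+ n.+1)%:E * cavg c' (2 * t)%R f)).
  rewrite /cavg muleA -EFinM exprMn invfM mulrA divff ?mul1r; last by rewrite expf_neq0.
  rewrite lee_wpmul2l ?lee_fin ?invr_ge0 ?exprn_ge0 ?(ltW t0)//.
  rewrite [leRHS]int_hcube//.
  exact: (@le_int_set _ _ _ mu f _ _ (measurable_hcube c t) (measurable_box c' (c' + const_mx (2
    * t))%R) nf sub).
rewrite lee_wpmul2l ?lee_fin ?exprn_ge0// -avg_box//.
apply: ereal_sup_ubound; exists (box c' (c' + const_mx (2 * t))%R).
  by split; [exists c', (2 * t)%R|exact: sub].
by congr avg; apply/funext => y; rewrite gee0_abs// nnm_ge0.
Qed.

Lemma gehring_exp_gt0 (beta A : R) : (0 < beta < 1)%R -> (1 < A)%R -> (0 < gehring_exp beta A)%R.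
Proof.
move=> /andP[b0 b1] A1; rewrite /gehring_exp divr_gt0// ln_gt0//.
rewrite invf_gt1 ?sqrtr_gt0//.
by rewrite -(@ltr_pXn2r _ 2)// ?nnegrE ?sqrtr_ge0// expr1n sqr_sqrtr// ltW.
Qed.

Section local.
Context (b : V) (s : R) (W : T -> R).
Hypotheses (s0 : (0 < s)%R) (lW : locfin W).

Lemma lfib_cube k x : fib (lgrid b s) k x = hcube (corner b s (fun _ _ => 0%R) k x) (side s k).
Proof. by rewrite /lgrid fib_grid. Qed.

End local.

Lemma locfin_fine u b s : locfin u -> (0 < s)%R -> exists2 a : R, (0 < a)%R &
  \int[mu]_(x in hcube b s) (u x)%:E = a%:E.
Proof.
move=> lu s0; have := locfin_hcube b lu s0.
by case: (\int[mu]_(x in hcube b s) _) => [a| |]//; rewrite ?ltxx ?andbF// => /andP[]; exists a.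
Qed.

Lemma int1_cube c t : (0 < t)%R -> \int[mu]_(y in hcube c t) (one y)%:E = (t ^+ n.+1)%:E.
Proof.
move=> t0; rewrite integral_cst ?mul1e; last exact: (measurable_hcube c t).
by rewrite [LHS]lebesgue_Rn_hcube.
Qed.

Definition doubling_cube (u : T -> R) (D : R) := forall c c' t, (0 < t)%R ->
  hcube c' (t / 2)%R `<=` hcube c t ->
  \int[mu]_(y in hcube c t) (u y)%:E <= D%:E * \int[mu]_(y in hcube c' (t / 2)%R) (u y)%:E.

Lemma doubling_cube_one : doubling_cube one (2 ^+ n.+1)%R.
Proof.
move=> c c' t t0 _; rewrite !int1_cube ?divr_gt0// -EFinM -exprMn.
by rewrite (_ : 2 * (t / 2) = t)%R//; field.
Qed.

Lemma lgrid_doubling u D b s : locfin u -> (0 < s)%R -> doubling_cube u D -> forall k x,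
  (mass mu (lgrid b s) u k x <= D * mass mu (lgrid b s) u k.+1 x)%R.
Proof.
move=> lu s0 doub k x; have fu := locfin_lfib b s0 lu.
rewrite -lee_fin EFinM -!(mass1E fu).
have sk : (side s k.+1 = side s k / 2)%R by rewrite /side exprS invfM; ring.
have := @fib_anti _ _ (lgrid b s) (@lgrid_nested R n b s) k k.+1 x (leqnSn k).
rewrite !lfib_cube// sk; exact: doub (side_gt0 s0 k).
Qed.

(** It serves twice: with Lebesgue measure as [u1] and a weight as [u2] it is the reverse Hoelder
    inequality; with the roles exchanged it bounds a negative power of the weight. *)
Lemma gehring_cube u1 u2 D alpha beta : locfin u1 -> locfin u2 ->
  ((0 < alpha)%R && (alpha < D)%R) -> (0 < beta < 1)%R ->
  doubling_cube u1 D ->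
  (forall c t (E : set T), (0 < t)%R -> measurable E -> E `<=` hcube c t ->
    \int[mu]_(y in E) (u1 y)%:E <= alpha%:E * \int[mu]_(y in hcube c t) (u1 y)%:E ->
    \int[mu]_(y in E) (u2 y)%:E <= beta%:E * \int[mu]_(y in hcube c t) (u2 y)%:E) ->
  forall del, del = gehring_exp beta (D / alpha) ->
  forall b s v1 v2, (0 < s)%R -> \int[mu]_(y in hcube b s) (u1 y)%:E = v1%:E ->
  \int[mu]_(y in hcube b s) (u2 y)%:E = v2%:E ->
  \int[mu]_(x in hcube b s) ((u2 x / u1 x) `^ del * u2 x)%:E <=
    (gehring_const beta * (v2 / v1) `^ del * v2)%:E.
Proof.
move=> l1 l2 aD be doub small del delE b s v1 v2 s0 v1E v2E.
have diff := differentiation b s0 l1 l2.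
have f1 := locfin_lfib b s0 l1; have f2 := locfin_lfib b s0 l2.
have [m1 p1 _] := l1; have [m2 p2 _] := l2.
have small' k x (E : set T) : fib (lgrid b s) 0 b x -> measurable E -> E `<=` fib (lgrid b s) k x ->
    \int[mu]_(y in E) (u1 y)%:E <= (alpha * mass mu (lgrid b s) u1 k x)%:E ->
    \int[mu]_(y in E) (u2 y)%:E <= (beta * mass mu (lgrid b s) u2 k x)%:E.
  move=> _ mE; rewrite !EFinM -(mass1E f1) -(mass1E f2) !lfib_cube// => Es Em.
  by apply: small => //; exact: side_gt0.
have := @gehring _ _ _ mu (lgrid b s) (measurable_lgrid b s0) (@lgrid_nested _ _ b s) u1 u2
  m1 m2 p1 p2 f1 f2 D b (fun k x _ => lgrid_doubling b l1 s0 doub k x) alpha beta aD be small'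
    diff del delE.
by rewrite /avg0 /mass (lgrid_root b s0) v1E v2E.
Qed.

Section pair.
Context (A B K : R) (W S : T -> R).
Hypotheses (A0 : (0 < A)%R) (B0 : (0 < B)%R) (lW : locfin W) (lS : locfin S).
Hypothesis WS : forall x, (W x `^ A * S x `^ B = 1)%R.
Hypothesis AK : A_pair A B K W S.

Let kappa := (1 + (2 `^ (A + B) * K) `^ A^-1)%R.

(** Hoelder's inequality bounds [|J minus E|], which is at least half of [|J|], by powers of
    [W(J minus E)] and [S(J)]. With the pair condition, [W(J) <= kappa * W(J minus E)]. The 1 in
    [kappa] keeps [1 - kappa^-1] strictly between 0 and 1 for positive [K]. *)
Lemma pair_small c t (E : set T) : (0 < t)%R -> measurable E -> E `<=` hcube c t ->
  mu E <= (2^-1 * t ^+ n.+1)%:E ->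
  \int[mu]_(x in E) (W x)%:E <= (1 - kappa^-1)%:E * \int[mu]_(x in hcube c t) (W x)%:E.
Proof.
move=> t0 mE Esub Ehalf; have nW := nnm_locfin lW; have nS := nnm_locfin lS.
have [W_m W0 _] := lW; have [S_m S0 _] := lS.
have mJ : measurable (hcube c t : set T) := measurable_hcube c t.
have mE' : measurable ((hcube c t : set T) `\` E) by exact: measurableD.
have AB0 : (0 < A + B)%R by rewrite addr_gt0.
have th01 : (0 < A / (A + B) < 1)%R.
  by rewrite divr_gt0//= ltr_pdivrMr// mul1r ltrDl.
have th' : (1 - A / (A + B) = B / (A + B))%R by field; rewrite gt_eqF.
have [w w0 wE] := locfin_fine c lW t0; have [v v0 vE] := locfin_fine c lS t0.
have j0 : (0 < t ^+ n.+1)%R by rewrite exprn_gt0.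
set j := (t ^+ n.+1)%R in j0 Ehalf *.
have K1 : ((w / j) `^ A * (v / j) `^ B <= K)%R.
  have := AK c t0; rewrite /hav wE vE -/j -!EFinM lee_fin.
  by rewrite ![(j^-1 * _)%R]mulrC.
have K0 : (0 <= K)%R by apply: le_trans K1; rewrite mulr_ge0 ?powR_ge0.
have k0 : (0 < kappa)%R by rewrite ltr_pwDl// powR_ge0.
have := int_setID mu mJ mE nW; rewrite wE setIidr//.
have i0 (D : set T) (u : T -> R) : nnm (fun x => (u x)%:E) ->
  0 <= \int[mu]_(x in D) (u x)%:E by exact: nnm_int_ge0.
have w'le : \int[mu]_(x in (hcube c t : set T) `\` E) (W x)%:E <= w%:E.
  by rewrite -wE; apply: le_int_set => // x [].
have := int_hoelder mu mE' nW nS th01.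
have -> : \int[mu]_(x in (hcube c t : set T) `\` E) ((W x)%:E `^ (A / (A + B)) *
    (S x)%:E `^ (1 - A / (A + B))) = mu ((hcube c t : set T) `\` E).
  rewrite -[RHS]mul1e -integral_cst//; apply: eq_integral => x _.
  rewrite th' !poweR_EFin -EFinM !powRrM -powRM ?powR_ge0//.
  by rewrite WS powR1.
have v'le : \int[mu]_(x in (hcube c t : set T) `\` E) (S x)%:E <= v%:E.
  by rewrite -vE; apply: le_int_set => // x [].
have e'ge : (2^-1 * j)%:E <= mu ((hcube c t : set T) `\` E).
  rewrite measureD//; last by rewrite [X in X < _]lebesgue_Rn_hcube// ltry.
  rewrite setIidr// [X in X - _]lebesgue_Rn_hcube// -/j.
  have [e eE] : exists e : R, mu E = e%:E.
    have : 0 <= mu E by exact: measure_ge0.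
    by move: Ehalf; case: (mu E) => // e _ _; exists e.
  by move: Ehalf; rewrite [X in _ - X]eE [X in X <= _ -> _]eE -EFinB !lee_fin; lra.
move: (i0 ((hcube c t : set T) `\` E) W nW) (i0 ((hcube c t : set T) `\` E) S nS) v'le w'le.
case: (\int[mu]_(x in _ `\` _) (W x)%:E) => [w'| |]//.
case: (\int[mu]_(x in _ `\` _) (S x)%:E) => [v'| |]//.
rewrite !lee_fin => w'0 v'0 v'v w'w H.
have {H e'ge} := le_trans e'ge H; rewrite th' !poweR_EFin -EFinM lee_fin => H.
move: (i0 E W nW); case: (\int[mu]_(x in E) _) => [wE'| |]//; rewrite lee_fin => wE'0.
rewrite -EFinD => -[ww]; rewrite -EFinM lee_fin.
suff : (w <= kappa * w')%R.
  by rewrite -ler_pdivrMl// => kw; rewrite mulrBl mul1r; lra.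
apply: (@le_trans _ _ ((2 `^ (A + B) * K) `^ A^-1 * w')%R); last first.
  by rewrite ler_wpM2r// /kappa lerDr.
have A1 : (0 <= A^-1)%R by rewrite invr_ge0 ltW.
have rA z : (0 <= z -> (z `^ A) `^ A^-1 = z)%R.
  by move=> z0; rewrite -powRrM divff ?gt_eqF// powRr1.
rewrite -(rA w (ltW w0)) -{1}(rA w' w'0) -powRM; last 2 first.
- by rewrite mulr_ge0 ?powR_ge0.
- exact: powR_ge0.
apply: ge0_ler_powR; rewrite ?nnegrE ?mulr_ge0 ?powR_ge0//.
have {}H : ((2^-1 * j) `^ (A + B) <= w' `^ A * v `^ B)%R.
  have := ge0_ler_powR (ltW AB0) _ _ H.
  rewrite !nnegrE !mulr_ge0 ?powR_ge0 ?(ltW j0)// => /(_ isT isT)/le_trans; apply.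
  rewrite powRM ?powR_ge0// -!powRrM !divfK ?gt_eqF//.
  by rewrite ler_wpM2l ?powR_ge0// ge0_ler_powR ?nnegrE ?(ltW B0) ?(ltW v0).
move: H; rewrite powRM ?(ltW j0)// [(_ `^ A * v `^ B)%R]mulrC.
rewrite -[(2^-1)%R]powR_inv1// -powRrM mulN1r powRN => H.
have := K1; rewrite !powRM ?invr_ge0 ?(ltW w0) ?(ltW v0) ?(ltW j0)//.
rewrite mulrACA -powRD; last by rewrite (gt_eqF AB0).
rewrite -powR_inv1 ?(ltW j0)// -powRrM mulN1r powRN ler_pdivrMr ?powR_gt0// => H2.
have vB : (0 < v `^ B)%R by rewrite powR_gt0.
rewrite -(ler_pM2r vB); apply: (le_trans H2).
have p2 : (0 < 2 `^ (A + B) :> R)%R by rewrite powR_gt0.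
rewrite ler_pdivrMl// in H.
rewrite (_ : 2 `^ (A + B) * K * w' `^ A * v `^ B = K * (2 `^ (A + B) * (v `^ B * w' `^ A)))%R.
  by rewrite ler_wpM2l.
by ring.
Qed.

Lemma pair_reverse_hoelder : exists2 del : R, (0 < del)%R & exists C : R,
  forall b s, (0 < s)%R -> hav b s (fun x => W x `^ (1 + del))%R <=
    C%:E * hav b s W `^ (1 + del).
Proof.
have k1 : (1 < kappa)%R.
  rewrite ltrDl powR_gt0// mulr_gt0 ?powR_gt0//.
  have := AK (0%R : V) ltr01; rewrite /hav.
  have [w w0 ->] := locfin_fine (0%R : V) lW ltr01.
  have [v v0 ->] := locfin_fine (0%R : V) lS ltr01.
  rewrite -!EFinM lee_fin expr1n invr1 !mul1r; apply: lt_le_trans.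
  by rewrite mulr_gt0 ?powR_gt0.
pose beta := (1 - kappa^-1)%R.
have be01 : (0 < beta < 1)%R.
  by rewrite /beta subr_gt0 invf_lt1 ?k1 ?(lt_trans _ k1)//= gtrBl invr_gt0 (lt_trans _ k1).
have D2 : ((0 < 2^-1 :> R) && (2^-1 < 2 ^+ n.+1 :> R))%R.
  rewrite invr_gt0 ltr0n/= (@lt_le_trans _ _ 1%R)//; first by rewrite invf_lt1 ?ltr1n.
  by rewrite exprn_ege1// ler1n.
have [del delE] : exists del, del = gehring_exp beta (2 ^+ n.+1 / 2^-1) by eexists.
exists del; first by rewrite delE gehring_exp_gt0// ltr_pdivlMr ?mul1r; case/andP: D2.
exists (gehring_const beta) => b s s0.
have [w w0 wE] := locfin_fine b lW s0.
have l1 := @locfin1 R n.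
have small c t (E : set T) : (0 < t)%R -> measurable E -> E `<=` hcube c t ->
    \int[mu]_(y in E) (one y)%:E <= (2^-1)%:E * \int[mu]_(y in hcube c t) (one y)%:E ->
    \int[mu]_(y in E) (W y)%:E <= beta%:E * \int[mu]_(y in hcube c t) (W y)%:E.
  move=> t0 mE Es; rewrite int1_cube// integral_cst// mul1e -EFinM.
  exact: pair_small.
have [mo o0 _] := l1; have [W_m W0 _] := lW.
have := gehring_cube l1 lW D2 be01 doubling_cube_one small delE s0 _ wE.
rewrite int1_cube// => /(_ _ erefl) H; rewrite /hav wE -EFinM.
rewrite (eq_integral (fun x => ((W x / one x) `^ del * W x)%:E)); last first.
  move=> x _; rewrite divr1; congr (_%:E).
  by rewrite addrC powRD ?powRr1 ?(ltW (W0 x))// (gt_eqF (W0 x)) implybT.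
have j0 : (0 < (s ^+ n.+1)^-1)%R by rewrite invr_gt0 exprn_gt0.
apply: (le_trans (lee_wpmul2l _ H)); first by rewrite lee_fin ltW.
rewrite -!EFinM lee_fin addrC powRD; last by apply/implyP => _; rewrite mulf_neq0// gt_eqF.
rewrite powRr1 ?mulr_ge0 ?(ltW w0) ?(ltW j0)// [(w / _)%R]mulrC.
by rewrite le_eqVlt; apply/orP; left; apply/eqP; ring.
Qed.

End pair.
End a_infinity.

(** * The Fujii-Wilson constant *)

Section fujii.
Context {R : realType} {n : nat}.
Local Notation V := ('rV[R]_n.+1).
Local Notation T := (Rn R n).
Local Notation mu := (@lebesgue_Rn R n).
Local Notation one := (fun _ : T => 1%R : R).

(** The maximal function is bounded on the dual space, with weight [S] and exponent
    [P = (A + B) / B]. Applied to [W] restricted to the cube, where [W^P S = W], and combined with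
    Hoelder's inequality against [W], this bounds the integral of the maximal function by a multiple
    of the mass of [W]. *)
Lemma pair_fujii A B K : (0 < A)%R -> (0 < B)%R -> exists C : R, forall W S : T -> R,
  locfin W -> locfin S -> (forall x, (W x `^ A * S x `^ B = 1)%R) -> A_pair A B K W S ->
  Ainfty_const (fun x => (W x)%:E) <= C%:E.
Proof.
move=> A0 B0; have AB0 : (0 < A + B)%R by rewrite addr_gt0.
pose th := (B / (A + B))%R; pose P := ((B + A) / B)%R.
have th01 : (0 < th < 1)%R by rewrite divr_gt0//= ltr_pdivrMr// mul1r ltrDr.
exists (6 ^+ n.+1 * `|@hlmax_const R n B A K| `^ th)%R => W S lW lS WS AK.
have SW x : (S x `^ B * W x `^ A = 1)%R by rewrite mulrC.
have BK : A_pair B A K S W by move=> b s s0; rewrite muleC; exact: AK.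
have [W_m W0 _] := lW; have nW := nnm_locfin lW; have nS := nnm_locfin lS.
apply: ge_ereal_sup => _ [_ [b [s [s0 ->]]] <-].
have mQ : measurable (box b (b + const_mx s)%R : set T) by exact: measurable_box.
set Q : set T := box b (b + const_mx s)%R in mQ *.
have [w w0 wE] := locfin_fine b lW s0; rewrite int_hcube// -/Q in wE.
rewrite wE inver gt_eqF//.
set f : T -> \bar R := (fun x : T => (W x)%:E) \_ Q.
have nf : nnm f by exact: nnm_restrict.
have nM : nnm (hlmax f) by exact: nnm_hlmax.
have P0 : (0 <= P)%R by rewrite divr_ge0 ?addr_ge0 ?ltW.
have nF : nnm (fun x => hlmax f x `^ P * (S x)%:E) := nnm_mul (nnm_pow P nM) nS.
have mle : \int[mu]_(x in Q) maximal f x <= (6 ^+ n.+1)%:E * \int[mu]_(x in Q) hlmax f x.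
  rewrite -intZ ?lee_fin//; apply: le_int_any => x _; [exact: maximal_ge0| |exact:
    maximal_le_hlmax].
  by rewrite mule_ge0 ?lee_fin ?(nnm_ge0 nM).
have bound := hlmax_bound B0 A0 lS lW SW BK nf.
have fW : \int[mu]_x (f x `^ P * (S x)%:E) = w%:E.
  rewrite -wE [RHS]integral_mkcond; apply: eq_integral => x _.
  rewrite /f !patchE; case: ifPn => _; last by rewrite poweR0r ?mul0e// gt_eqF//
    divr_gt0// addr_gt0.
  rewrite -(A_pair_swap B0 lW lS WS) poweR_EFin -EFinM -powRD; last first.
    by apply/implyP => _; rewrite gt_eqF.
  rewrite (_ : P + - (A / B) = 1)%R ?powRr1 ?(ltW (W0 x))// /P.
  by field; rewrite gt_eqF.
have hold : \int[mu]_(x in Q) hlmax f x <=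
    (\int[mu]_(x in Q) (hlmax f x `^ P * (S x)%:E)) `^ th * w%:E `^ (1 - th).
  rewrite -wE; apply: le_trans (int_hoelder mu mQ nF nW th01).
  apply: le_int => //; first exact: nnm_mul (nnm_pow th nF) (nnm_pow (1 - th)%R nW).
  move=> x _; rewrite poweRM ?poweR_ge0 ?(nnm_ge0 nS)// -(poweRrM (hlmax f x)).
  rewrite (_ : P * th = 1)%R; last by rewrite /P /th; field; rewrite !gt_eqF//.
  rewrite poweRe1 ?(nnm_ge0 nM)// -muleA !poweR_EFin -EFinM.
  rewrite -(A_pair_swap B0 lW lS WS) -powRrM -powRD; last first.
    by apply/implyP => _; rewrite gt_eqF.
  rewrite (_ : - (A / B) * th + (1 - th) = 0)%R ?powRr0 ?mule1//.
  by rewrite /th; field; rewrite !gt_eqF.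
have le2 : \int[mu]_(x in Q) (hlmax f x `^ P * (S x)%:E) <= (`|@hlmax_const R n B A K| * w)%:E.
  apply: (@le_trans _ _ (\int[mu]_x (hlmax f x `^ P * (S x)%:E))).
    by apply: le_int_set => //; exact: measurableT.
  apply: le_trans bound _; rewrite fW -EFinM lee_fin ler_wpM2r ?(ltW w0)//.
  exact: ler_norm.
apply: (@le_trans _ _ ((w^-1)%:E * ((6 ^+ n.+1)%:E * ((`|@hlmax_const R n B A K| * w)%:E `^ th *
  w%:E `^ (1 - th))))).
  rewrite lee_wpmul2l ?lee_fin ?invr_ge0 ?(ltW w0)//; apply: le_trans mle _.
  rewrite lee_wpmul2l ?lee_fin//; apply: le_trans hold _.
  rewrite lee_wpmul2r ?poweR_ge0//; apply: lee_poweR => //; last exact: (nnm_int_ge0 _ _ nF).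
  by case/andP: th01 => /ltW.
rewrite !poweR_EFin -!EFinM lee_fin powRM ?(ltW w0)// -mulrA.
have -> : (w `^ th * w `^ (1 - th) = w)%R.
  by rewrite -powRD ?subrKC ?powRr1 ?(ltW w0)//; apply/implyP => _; rewrite gt_eqF.
rewrite le_eqVlt; apply/orP; left; apply/eqP; field; exact: lt0r_neq0.
Qed.

Lemma overs_le_maximal b s (W : T -> R) L (x : T) : (0 < s)%R -> locfin W ->
  box b (b + const_mx s)%R x ->
  overs mu (lgrid b s) one W L x ->
  L%:E <= (2 ^+ n.+1)%:E * maximal ((fun x : T => (W x)%:E) \_ (box b (b + const_mx s)%R : set
    T)) x.
Proof.
move=> s0 lW bx [k _ ok].
have nW := nnm_locfin lW.
have mQ : measurable (box b (b + const_mx s)%R : set T) by exact: measurable_box.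
set Q : set T := box b (b + const_mx s)%R in mQ bx *.
set f : T -> \bar R := (fun x : T => (W x)%:E) \_ Q.
have nf : nnm f by exact: nnm_restrict.
have fW := locfin_lfib b s0 lW; have f1 := locfin_lfib b s0 (@locfin1 R n).
have sk0 := side_gt0 s0 k.
have := @fib_anti _ _ (lgrid b s) (@lgrid_nested R n b s) 0%N k x (leq0n k).
have bx' : hcube b s x by exact: box_sub_hcube.
rewrite lgrid_fib0// lfib_cube// => sub.
set c := corner _ _ _ _ _ in sub *.
have cx : hcube c (side s k) x by rewrite -lfib_cube.
apply: (@le_trans _ _ (cavg c (side s k) f)); last exact: cavg_le_maximal.
have -> : cavg c (side s k) f = ((side s k ^+ n.+1)^-1 * mass mu (lgrid b s) W k x)%:E.
  rewrite /cavg EFinM; congr (_ * _); rewrite -(mass1E fW) lfib_cube//.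
  apply/esym; rewrite (@int_setID _ _ _ mu _ _ Q (measurable_hcube c (side s k)) mQ nW).
  rewrite [X in _ + X](_ : _ = 0) ?adde0.
    rewrite /f -integral_mkcondr; congr integral; exact/seteqP.
  apply/eqP; rewrite eq_le (nnm_int_ge0 _ _ nW) andbT.
  apply: (@le_trans _ _ (\int[mu]_(x in (hcube b s : set T) `\` Q) (W x)%:E)).
    apply: le_int_set => //.
    - by apply: measurableD => //; exact: measurable_hcube.
    - by apply: measurableD => //; exact: measurable_hcube.
    - by move=> y [/sub].
  rewrite null_set_integral//.
  - by apply: measurableD => //; exact: measurable_hcube.
  - by apply: measurable_funTS; exact: nnm_m nW.
  - exact: hcube_diff_null.
rewrite lee_fin ler_pdivlMl ?exprn_gt0// mulrC ltW//.
move: ok; rewrite /over /=; congr (_ * _ < _)%R; apply/EFin_inj.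
by rewrite -(mass1E f1) lfib_cube// int1_cube.
Qed.

(** On the stopping sets [O j] at levels [2 ^+ j] times the mean, the sum of the levels is at most a
    multiple of the maximal function. Each term, integrated, controls the [W]-mass of [O j], hence
    that of the smallest set [O N]; so [N] times this last mass is bounded by a multiple of [K w].
    Outside [O N] the weight is at most [L N], and a set of small measure carries little mass
    there. *)
Lemma fujii_small K : (0 < K)%R -> exists2 alpha : R, (0 < alpha < 1)%R &
  forall W, locfin W -> Ainfty_const (fun x => (W x)%:E) <= K%:E ->
  forall b s (E : set T), (0 < s)%R -> measurable E -> E `<=` hcube b s ->
  mu E <= (alpha * s ^+ n.+1)%:E ->
  \int[mu]_(x in E) (W x)%:E <= (2^-1)%:E * \int[mu]_(x in hcube b s) (W x)%:E.
Proof.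
move=> K0; set D := (2 ^+ n.+1 : R)%R.
have D1 : (1 <= D)%R by rewrite exprn_ege1// ler1n.
have D0 : (0 < D)%R by apply: lt_le_trans D1.
(* Enough levels for the mass of [O N] to be at most a quarter of [w]. *)
have [N NK] : exists N : nat, (4 * (D * (2 * D) * K) <= N%:R :> R)%R.
  by exists (Num.truncn (4 * (D * (2 * D) * K))).+1; apply: ltW; exact: truncnS_gt.
have N0 : (0 < N%:R :> R)%R by apply: lt_le_trans NK; rewrite !mulr_gt0.
have p0 : (0 < 2 ^+ N :> R)%R by rewrite exprn_gt0.
have p1 : (1 <= 2 ^+ N :> R)%R by rewrite exprn_ege1// ler1n.
(* With this [alpha], the part of [E] outside [O N] has mass at most [L N * mu E <= w / 4]. *)
exists ((2 ^+ N * 4)^-1)%R.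
  rewrite invr_gt0 mulr_gt0//= invf_lt1 ?mulr_gt0//; lra.
move=> W lW WK b s E s0 mE Es Em.
have [W_m W0 _] := lW; have nW := nnm_locfin lW.
have [w w0 wE] := locfin_fine b lW s0.
have l1 := @locfin1 R n; have [mo o0 _] := l1.
have fW := locfin_lfib b s0 lW; have f1 := locfin_lfib b s0 l1.
have mH : measurable (hcube b s : set T) := measurable_hcube b s.
have mQ : measurable (box b (b + const_mx s)%R : set T) by exact: measurable_box.
set Q : set T := box b (b + const_mx s)%R in mQ *.
set f : T -> \bar R := (fun x : T => (W x)%:E) \_ Q.
have nf : nnm f by exact: nnm_restrict.
have IM : \int[mu]_(x in Q) maximal f x <= (K * w)%:E.
  have : (\int[mu]_(x in Q) (W x)%:E)^-1 * \int[mu]_(x in Q) maximal f x <= K%:E.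
    by apply: le_trans WK; apply: ereal_sup_ubound; exists Q => //; exists b, s.
  rewrite -int_hcube// wE inver gt_eqF// lee_pdivrMl//.
  by rewrite muleC -EFinM mulrC.
set a := avg0 mu (lgrid b s) one W b.
have aE : a = (w / s ^+ n.+1)%R.
  by rewrite /a /avg0 /mass (lgrid_root b s0) wE int1_cube.
have a0 : (0 < a)%R by rewrite aE divr_gt0// exprn_gt0.
pose L j := (2 ^+ j * a)%R.
have L0 j : (0 < L j)%R by rewrite mulr_gt0// exprn_gt0.
have aL j : (a <= L j)%R by rewrite ler_peMl ?(ltW a0)// exprn_ege1// ler1n.
pose O j := overs mu (lgrid b s) one W (L j).
have mO j : measurable (O j).
  exact: (@measurable_overs _ _ _ mu (lgrid b s) (measurable_lgrid b s0) (@lgrid_nested _ _ b s)).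
have mOQ j : measurable (O j `&` hcube b s) by exact: measurableI.
have up j : \int[mu]_(x in O j `&` hcube b s) (W x)%:E <= (L j * D)%:E * mu (O j `&` hcube b s).
  have := @overs_upper _ _ _ mu (lgrid b s) (measurable_lgrid b s0) (@lgrid_nested _ _ b s) one W
    mo W_m o0 W0 f1 fW D b (fun k x _ => lgrid_doubling b l1 s0 doubling_cube_one k x) (L j) (aL
      j) D0.
  by rewrite (lgrid_root b s0) integral_cst ?mul1e//; exact: mOQ j.
have Omono i j : (i <= j)%N -> O j `<=` O i.
  move=> ij; apply: (@overs_mono _ _ _ mu (lgrid b s) one W f1).
  by rewrite /L ler_pM2r// ler_weXn2l// ler1n.
pose h j x : \bar R := (L j)%:E * (\1_(O j) x)%:E.
have nI j : nnm (fun x : T => (\1_(O j) x : R)%:E).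
  by apply: nnm_EFin => //; exact: measurable_indic.
have nh j : nnm (h j).
  have nL : nnm (fun _ : T => (L j)%:E) by apply: nnm_cst; rewrite lee_fin ltW.
  exact: (nnm_mul nL (nI j)).
have hM m x : Q x -> \sum_(0 <= j < m) h j x <= (2 * D)%:E * maximal f x.
  (* The sets [O j] decrease, so at a point of [O m] the sum is geometric and at most twice its last
     level, which the maximal function dominates up to [D]. *)
  move=> Qx; have M0 : 0 <= (2 * D)%:E * maximal f x.
    by rewrite mule_ge0 ?maximal_ge0// lee_fin mulr_ge0 ?(ltW D0).
  elim: m => [|m IH]; first by rewrite big_geq.
  have [Ox|nOx] := pselect (O m x); last first.
    rewrite big_nat_recr//= {2}/h indicE memNset// mule0 adde0.
    exact: IH.
  apply: (@le_trans _ _ (2 * L m)%:E); last first.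
    rewrite !EFinM -muleA lee_wpmul2l ?lee_fin//.
    exact: overs_le_maximal Ox.
  have -> : \sum_(0 <= j < m.+1) h j x = (\sum_(0 <= j < m.+1) L j)%:E.
    rewrite -sumEFin; apply: eq_big_nat => j /andP[_ jm].
    by rewrite /h indicE mem_set ?mule1//; apply: Omono Ox.
  rewrite lee_fin /L -mulr_suml mulrA ler_pM2r//.
  elim: (m) => [|k IHk]; first by rewrite big_nat1 expr0 mulr1 ler1n.
  rewrite big_nat_recr//; have e : (2 ^+ k.+1 = 2 * 2 ^+ k :> R)%R by rewrite exprS.
  by move: IHk; rewrite -e => IHk; rewrite mulr_natl mulr2n lerD.
have hsum : \sum_(0 <= j < N) \int[mu]_(x in Q) h j x <= (2 * D * (K * w))%:E.
  have nS : nnm (fun x => \sum_(0 <= j < N) h j x) := nnm_sum (index_iota 0 N) nh.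
  have -> : \sum_(0 <= j < N) \int[mu]_(x in Q) h j x = \int[mu]_(x in Q) \sum_(0 <= j < N) h j x.
    rewrite ge0_integral_sum// => j; [exact: measurable_funTS (nnm_m (nh j))|].
    by move=> x _; exact: nnm_ge0 (nh j) x.
  have D20 : (0 < 2 * D)%R by rewrite mulr_gt0.
  rewrite EFinM -lee_pdivrMl// -intZ ?lee_fin ?invr_ge0 ?(ltW D20)//; last first.
  apply: le_trans IM; apply: le_int_any => x Qx.
  - by rewrite mule_ge0 ?(nnm_ge0 nS)// lee_fin invr_ge0 ltW.
  - exact: maximal_ge0.
  - by rewrite lee_pdivrMl//; exact: hM.
have small : \int[mu]_(x in O N `&` hcube b s) (W x)%:E <= (w / 4)%:E.
  have [v vE] : exists v, \int[mu]_(x in O N `&` hcube b s) (W x)%:E = v%:E.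
    have : \int[mu]_(x in O N `&` hcube b s) (W x)%:E <= w%:E.
      by rewrite -wE; apply: le_int_set => // x [].
    have := nnm_int_ge0 mu (O N `&` hcube b s) nW.
    by case: (\int[mu]_(x in _ `&` _) _) => // v _ _; exists v.
  have vj j : (j < N)%N -> v%:E <= D%:E * \int[mu]_(x in Q) h j x.
    move=> jN; rewrite -vE; apply: (@le_trans _ _ (\int[mu]_(x in O j `&` hcube b s) (W x)%:E)).
      by apply: le_int_set => // x [/(Omono _ _ (ltnW jN))].
    apply: le_trans (up j) _; rewrite mulrC EFinM -muleA lee_wpmul2l ?lee_fin ?(ltW D0)//.
    rewrite -int_hcube// intZ ?lee_fin ?(ltW (L0 j))//.
    by rewrite integral_indic// setIC.
  have : (N%:R * v)%:E <= D%:E * (2 * D * (K * w))%:E.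
    apply: le_trans (lee_wpmul2l _ hsum); last by rewrite lee_fin ltW.
    rewrite ge0_sume_distrr; last by move=> j _; exact: nnm_int_ge0 (nh j).
    apply: (@le_trans _ _ (\sum_(0 <= j < N) v%:E)).
      by rewrite sumEFin sumr_const_nat subn0 mulr_natl.
    rewrite big_nat [leRHS]big_nat; apply: lee_sum => j /andP[_ jN]; exact: vj.
  rewrite vE -EFinM !lee_fin => H; rewrite ler_pdivlMr//.
  have NK' := ler_wpM2r (ltW w0) NK.
  rewrite -(ler_pM2l N0); apply: le_trans NK'.
  rewrite [leRHS](_ : _ = D * (2 * D * (K * w)) * 4)%R; last by ring.
  by rewrite [leLHS]mulrA ler_pM2r.
have diff := differentiation b s0 l1 lW.
have LN : (L N * ((2 ^+ N * 4)^-1 * s ^+ n.+1) = w / 4)%R.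
  by rewrite /L aE; field; rewrite !lt0r_neq0// exprn_gt0.
rewrite wE (int_setID mu mE (mO N) nW).
apply: (@le_trans _ _ ((w / 4)%:E + (w / 4)%:E)); last first.
  by rewrite -EFinD -EFinM lee_fin le_eqVlt; apply/orP; left; apply/eqP; field.
apply: leeD.
  apply: le_trans small; apply: le_int_set => //; first exact: measurableI.
  by move=> x [Ex Ox]; split=> //; exact: Es.
have mD : measurable (E `\` O N) by exact: measurableD.
apply: (@le_trans _ _ (\int[mu]_(x in E `\` O N) (L N)%:E)).
  apply: ae_ge0_le_integral; first exact: mD.
  - by move=> x _; exact: (nnm_ge0 nW).
  - by apply: measurable_funTS; exact: nnm_m nW.
  - by move=> x _; rewrite lee_fin ltW.
  - exact: measurable_cst.
  apply: filterS diff => x dx [Ex nOx]; rewrite lee_fin leNgt; apply/negP => LW.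
  apply: nOx; apply: dx; rewrite ?mulr1//.
  by rewrite (lgrid_root b s0); exact: Es.
rewrite integral_cst// -LN [leRHS]EFinM lee_wpmul2l ?lee_fin ?(ltW (L0 N))//.
apply: le_trans Em; apply: le_measure; rewrite ?inE//.
Qed.

End fujii.

Lemma bernoulli_le {R : realType} (h : R) k : (0 <= h <= 1)%R -> (1 - k%:R * h <= (1 - h) ^+ k)%R.
Proof.
move=> /andP[h0 h1]; elim: k => [|k IH]; first by rewrite mul0r subr0.
have k0 : (0 <= k%:R :> R)%R by [].
have := ler_wpM2l (_ : 0 <= 1 - h)%R IH; rewrite subr_ge0 exprS => /(_ h1); apply: le_trans.
by rewrite -natr1; move: (k%:R)%R k0 => z z0; nra.
Qed.

(** * Doubling, and the passage from A_infinity to a Muckenhoupt class *)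

Section small.
Context {R : realType} {n : nat}.
Local Notation V := ('rV[R]_n.+1).
Local Notation T := (Rn R n).
Local Notation mu := (@lebesgue_Rn R n).
Local Notation one := (fun _ : T => 1%R : R).

Lemma hcube_sub_corner (c c' : V) t s : (0 < s)%R -> hcube c' s `<=` hcube c t ->
  forall i, (c 0%R i <= c' 0%R i)%R /\ (c' 0%R i + s <= c 0%R i + t)%R.
Proof.
move=> s0 sub i; have /andP[c1 c2] := sub _ (hcube_corner c' s0) i; split=> //.
rewrite leNgt; apply/negP => lt.
pose u := (c 0%R i + t - c' 0%R i)%R.
have /sub/(_ i) : hcube c' s (c' + const_mx u)%R.
  by move=> j; rewrite !mxE /u; apply/andP; split; lra.
by rewrite !mxE /u => /andP[_]; lra.
Qed.

Section fixed.
Context (alpha : R) (W : T -> R).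
Hypotheses (al01 : (0 < alpha < 1)%R) (lW : locfin W).
Hypothesis small : forall b s (E : set T), (0 < s)%R -> measurable E -> E `<=` hcube b s ->
  mu E <= (alpha * s ^+ n.+1)%:E ->
  \int[mu]_(x in E) (W x)%:E <= (2^-1)%:E * \int[mu]_(x in hcube b s) (W x)%:E.

(** The difference of the two cubes has proportion at most [alpha], so it carries at most half of
    the mass of the larger cube. *)
Lemma small_step (c c' : V) s s' : (0 < s)%R -> (0 < s')%R ->
  hcube c' s' `<=` hcube c s -> ((1 - alpha) * s ^+ n.+1 <= s' ^+ n.+1)%R ->
  \int[mu]_(x in hcube c s) (W x)%:E <= 2%:E * \int[mu]_(x in hcube c' s') (W x)%:E.
Proof.
move=> s0 s'0 sub le; have nW := nnm_locfin lW.
have mJ : measurable (hcube c s : set T) := measurable_hcube c s.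
have mJ' : measurable (hcube c' s' : set T) := measurable_hcube c' s'.
have mD : measurable ((hcube c s : set T) `\` hcube c' s') by exact: measurableD.
have [w w0 wE] := locfin_fine c lW s0; have [w' w'0 w'E] := locfin_fine c' lW s'0.
have muD : mu ((hcube c s : set T) `\` hcube c' s') <= (alpha * s ^+ n.+1)%:E.
  rewrite measureD//; last by rewrite [X in X < _]lebesgue_Rn_hcube// ltry.
  rewrite setIidr// [X in X - _]lebesgue_Rn_hcube// [X in _ - X]lebesgue_Rn_hcube//.
  by rewrite -EFinB lee_fin; lra.
have := small s0 mD (@subDsetl _ _ _) muD.
have := int_setID mu mJ mJ' nW; rewrite setIidr// wE w'E.
have := nnm_int_ge0 mu ((hcube c s : set T) `\` hcube c' s') nW.
case: (\int[mu]_(x in _ `\` _) _) => // v; rewrite !lee_fin => v0 [] ww.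
by rewrite ww => H; lra.
Qed.

(* the two cubes are joined by a chain of interpolated cubes of slowly varying sides *)
Lemma small_doubling m : (n.+1%:R / alpha <= m%:R)%R -> doubling_cube W (2 ^+ m)%R.
Proof.
move=> ma c c' t t0 sub; have /andP[al0 al1] := al01.
have m0 : (0 < m%:R :> R)%R by apply: lt_le_trans ma; rewrite divr_gt0.
have t20 : (0 < t / 2)%R by rewrite divr_gt0.
have cs := hcube_sub_corner t20 sub.
pose l i : R := (i%:R / m%:R)%R.
have l01 i : (i <= m)%N -> (0 <= l i <= 1)%R.
  by move=> im; rewrite divr_ge0//= ler_pdivrMr// mul1r ler_nat.
have lS i : (l i.+1 = l i + m%:R^-1)%R by rewrite /l -natr1 mulrDl mul1r.
pose p i : V := (c + l i *: (c' - c))%R.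
pose q i : R := (t * (1 - l i / 2))%R.
have q0 i : (i <= m)%N -> (t / 2 <= q i)%R.
  by move=> /l01/andP[_ l1]; rewrite /q; nra.
have mi0 : (0 < m%:R^-1 :> R)%R by rewrite invr_gt0.
have chain i : (i <= m)%N -> \int[mu]_(x in hcube (p 0%N) (q 0%N)) (W x)%:E <=
    (2 ^+ i)%:E * \int[mu]_(x in hcube (p i) (q i)) (W x)%:E.
  elim: i => [|i IH] im; first by rewrite mul1e.
  have {}IH := IH (ltnW im); apply: le_trans IH _.
  rewrite exprSr EFinM -muleA lee_wpmul2l ?lee_fin ?exprn_ge0//.
  have qi := q0 _ (ltnW im); have qi1 := q0 _ im.
  apply: small_step; [exact: lt_le_trans qi|exact: lt_le_trans qi1| |].
    move=> x xp j; have /andP[x1 x2] := xp j; have [c1 c2] := cs j.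
    move: x1 x2; rewrite !mxE lS /q !lS; move: (l i) (m%:R^-1)%R mi0 => z y y0.
    by move=> x1 x2; apply/andP; split; nra.
  have qq : (q i.+1 = q i * (1 - t / 2 / m%:R / q i))%R.
    rewrite mulrBr mulr1 [X in (_ - X)%R]mulrC divfK; last by rewrite gt_eqF// (lt_le_trans _ qi).
    by rewrite /q lS; ring.
  have qip : (0 < q i)%R by exact: lt_le_trans qi.
  have h1 : (t / 2 / m%:R / q i <= m%:R^-1)%R.
    rewrite ler_pdivrMr// [(t / 2 / _)%R]mulrC ler_wpM2l// ltW//.
  have h0 : (0 <= t / 2 / m%:R / q i)%R by rewrite !divr_ge0 ?ltW.
  have m1 : (m%:R^-1 <= 1 :> R)%R.
    by rewrite invf_le1// ler1n -(ltr_nat R).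
  rewrite qq [leRHS]exprMn [leLHS]mulrC ler_wpM2l ?exprn_ge0 ?(ltW qip)//.
  (* The side shrinks by a relative amount of at most [1/m], so by Bernoulli's inequality the volume
     keeps a proportion of at least [1 - n.+1 / m >= 1 - alpha]. *)
  apply: le_trans (bernoulli_le n.+1 _); last by rewrite h0 (le_trans h1).
  rewrite lerD2l lerN2; apply: le_trans (ler_wpM2l _ h1) _ => //.
  by rewrite ler_pdivrMr// mulrC -ler_pdivrMr.
have := chain m (leqnn m).
rewrite (_ : p 0%N = c); last by rewrite /p /l mul0r scale0r addr0.
rewrite (_ : q 0%N = t); last by rewrite /q /l !mul0r subr0 mulr1.
rewrite (_ : p m = c'); last by rewrite /p /l divff ?gt_eqF// scale1r addrC subrK.
by rewrite (_ : q m = (t / 2)%R)// /q /l divff ?gt_eqF//; field.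
Qed.

(** If [E] had proportion above [1 - alpha], its complement would carry at most half of the mass and
    [E] at least half, more than a third. *)
Lemma small_converse c t (E : set T) : (0 < t)%R -> measurable E -> E `<=` hcube c t ->
  \int[mu]_(y in E) (W y)%:E <= (3^-1)%:E * \int[mu]_(y in hcube c t) (W y)%:E ->
  \int[mu]_(y in E) (one y)%:E <= (1 - alpha)%:E * \int[mu]_(y in hcube c t) (one y)%:E.
Proof.
move=> t0 mE Es; have nW := nnm_locfin lW.
have mJ : measurable (hcube c t : set T) := measurable_hcube c t.
have mD : measurable ((hcube c t : set T) `\` E) by exact: measurableD.
have [w w0 wE] := locfin_fine c lW t0; rewrite wE int1_cube// integral_cst// mul1e.
rewrite -EFinM => H; rewrite leNgt; apply/negP => lt.
have muD : mu ((hcube c t : set T) `\` E) <= (alpha * t ^+ n.+1)%:E.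
  rewrite measureD//; last by rewrite [X in X < _]lebesgue_Rn_hcube// ltry.
  rewrite setIidr// [X in X - _]lebesgue_Rn_hcube//.
  have : mu E <= (t ^+ n.+1)%:E.
    by rewrite -[leRHS](@lebesgue_Rn_hcube R n c)//; apply: le_measure; rewrite ?inE.
  move=> e1; have [e eE] : exists e : R, mu E = e%:E.
    by move: (measure_ge0 mu E : 0 <= mu E) e1; case: (mu E) => // e _ _; exists e.
  have : ((1 - alpha) * t ^+ n.+1 < e)%R by rewrite -lte_fin -eE EFinM.
  by rewrite [X in _ - X]eE -EFinB lee_fin; lra.
have := small t0 mD (@subDsetl _ _ _) muD.
have := int_setID mu mJ mE nW; rewrite setIidr// wE.
have := nnm_int_ge0 mu ((hcube c t : set T) `\` E) nW; move: H.
have := nnm_int_ge0 mu E nW.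
case: (\int[mu]_(x in E) _) => // u u0; rewrite lee_fin => H.
case: (\int[mu]_(x in _ `\` _) _) => // v; rewrite !lee_fin => v0 [] ww.
by lra.
Qed.

End fixed.

(** The stopping argument is run with [W] as the underlying measure, which is doubling, and Lebesgue
    measure of density [1 / W] on top of it. The gain of integrability is a bound on the mean of
    [W^(-del)], that is, the A_r condition for [r = 1 + 1/del], with [del] depending on [K] only. *)
Lemma fujii_pair K : (0 < K)%R -> exists del C : R, (0 < del)%R /\
  forall W : T -> R, locfin W -> Ainfty_const (fun x => (W x)%:E) <= K%:E ->
  [/\ locfin (fun x => W x `^ (- del))%R, (forall x, W x `^ 1 * (W x `^ (- del)) `^ del^-1 = 1)%R &
      A_pair 1 del^-1 C W (fun x => W x `^ (- del))%R].
Proof.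
move=> K0; have [alpha al01 small] := @fujii_small R n K K0.
have /andP[al0 al1] := al01.
have [m ma] : exists m : nat, (n.+1%:R / alpha <= m%:R)%R.
  by exists (Num.truncn (n.+1%:R / alpha)).+1; apply: ltW; exact: truncnS_gt.
have m1 : (1 <= 2 ^+ m :> R)%R by rewrite exprn_ege1// ler1n.
have be01 : (0 < 1 - alpha < 1)%R by apply/andP; split; lra.
have aD : ((0 < 3^-1 :> R) && (3^-1 < 2 ^+ m :> R))%R.
  by rewrite invr_gt0 ltr0n/= (lt_le_trans _ m1)// invf_lt1 ?ltr1n.
have [del delE] : exists del, del = gehring_exp (1 - alpha) (2 ^+ m / 3^-1) by eexists.
have del0 : (0 < del)%R.
  by rewrite delE gehring_exp_gt0// ltr_pdivlMr ?mul1r; case/andP: aD.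
set Cg := gehring_const (1 - alpha).
exists del, (`|Cg| `^ del^-1)%R; split; first exact: del0.
move=> W lW WK.
have [W_m W0 _] := lW.
have l1 := @locfin1 R n.
have H b s w : (0 < s)%R -> \int[mu]_(y in hcube b s) (W y)%:E = w%:E ->
    \int[mu]_(x in hcube b s) (W x `^ (- del))%:E <= (Cg * (s ^+ n.+1 / w) `^ del * s ^+ n.+1)%:E.
  move=> s0 wE.
  have := gehring_cube lW l1 aD be01 (small_doubling al01 lW (small W lW WK) ma)
    (small_converse lW (small W lW WK)) delE s0 wE (int1_cube b s0).
  rewrite (eq_integral (fun x => (W x `^ (- del))%:E))// => x _.
  by rewrite mulr1 div1r -powR_inv1 ?(ltW (W0 x))// -powRrM mulN1r.
have Sm : measurable_fun setT (fun x : T => W x `^ (- del))%R.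
  exact: (measurableT_comp (measurable_powR _)).
split.
- split=> // [x|b s s0]; first by rewrite powR_gt0.
  have [w w0 wE] := locfin_fine b lW s0.
  by apply: le_lt_trans (H b s w s0 wE) _; rewrite ltry.
- move=> x; rewrite -powRrM -powRD; last by apply/implyP => _; rewrite gt_eqF.
  by rewrite mulNr divff ?gt_eqF// subrr powRr0.
move=> b s s0; have [w w0 wE] := locfin_fine b lW s0.
have := H b s w s0 wE; rewrite /hav wE.
have nS : nnm (fun x : T => (W x `^ (- del))%:E).
  by apply: nnm_EFin => // x; rewrite powR_ge0.
have := nnm_int_ge0 mu (hcube b s) nS.
case: (\int[mu]_(x in _) (W x `^ (- del))%:E) => // v; rewrite !lee_fin => v0 vle.
rewrite powRr1; last by rewrite mulr_ge0 ?invr_ge0 ?exprn_ge0 ?ltW.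
have j0 : (0 < s ^+ n.+1)%R by rewrite exprn_gt0.
move: vle j0; set j := (s ^+ n.+1)%R => vle j0.
have jw : (0 < j^-1 * w)%R by rewrite mulr_gt0// invr_gt0.
have -> : (j^-1 * w = ((j^-1 * w) `^ del) `^ del^-1)%R.
  by rewrite -powRrM divff ?gt_eqF// powRr1// ltW.
rewrite -powRM ?powR_ge0//; last by rewrite mulr_ge0// invr_ge0 ltW.
apply: ge0_ler_powR; rewrite ?nnegrE ?invr_ge0 ?(ltW del0)//.
  by rewrite mulr_ge0 ?powR_ge0// mulr_ge0// invr_ge0 ltW.
have C1 : (v <= `|Cg| * (j / w) `^ del * j)%R.
  apply: le_trans vle _; rewrite ler_wpM2r ?(ltW j0)// ler_wpM2r ?powR_ge0//.
  exact: ler_norm.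
apply: (@le_trans _ _ ((j^-1 * w) `^ del * (j^-1 * (`|Cg| * (j / w) `^ del * j)))%R).
  by rewrite ler_wpM2l ?powR_ge0// ler_wpM2l// invr_ge0 ltW.
have e1 : ((j^-1 * w) `^ del * (j / w) `^ del = 1)%R.
  rewrite -powRM ?(ltW jw)// ?divr_ge0 ?(ltW j0) ?(ltW w0)//.
  rewrite (_ : j^-1 * w * (j / w) = 1)%R ?powR1//.
  by field; rewrite !gt_eqF.
rewrite [leLHS](_ : _ = (j^-1 * w) `^ del * (j / w) `^ del * (`|Cg| * (j^-1 * j)))%R; last by ring.
by rewrite e1 mulVf ?gt_eqF// mul1r mulr1.
Qed.

End small.

(** * Averages of order c *)

Section norms.
Context {R : realType} {n : nat}.
Local Notation V := ('rV[R]_n.+1).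
Local Notation T := (Rn R n).
Local Notation mu := (@lebesgue_Rn R n).
Implicit Types (u v : T -> R) (b : V) (c k e s t N : R).

Definition posm u := measurable_fun setT u /\ forall x, (0 < u x)%R.

Lemma posm_pow u r : posm u -> posm (fun x => u x `^ r)%R.
Proof.
move=> [um u0]; split=> [|x]; last exact: powR_gt0.
exact: (measurableT_comp (measurable_powR _)).
Qed.

Lemma posm_mul u v : posm u -> posm v -> posm (fun x => u x * v x)%R.
Proof. by move=> [um u0] [vm v0]; split=> [|x]; [exact: measurable_funM|exact: mulr_gt0]. Qed.

Lemma posm_inv u : posm u -> posm (fun x => (u x)^-1)%R.
Proof.
move=> pu; have := posm_pow (-1) pu; congr posm; apply/funext => x.
by rewrite powR_inv1// ltW//; case: pu.
Qed.

Lemma posm_nnm u : posm u -> nnm (fun x => (u x)%:E).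
Proof. by move=> [um u0]; apply: nnm_EFin => // x; exact: ltW. Qed.

Lemma posm_one : posm (fun=> 1%R).
Proof. by split=> // x; exact: ltr01. Qed.

Lemma hav_ge0 b s u : (0 < s)%R -> posm u -> 0 <= hav b s u.
Proof.
move=> s0 pu; rewrite /hav mule_ge0 ?lee_fin ?invr_ge0 ?exprn_ge0 ?(ltW s0)//.
exact: (nnm_int_ge0 _ _ (posm_nnm pu)).
Qed.

Lemma hav_gt0 b s u : (0 < s)%R -> posm u -> 0 < hav b s u.
Proof.
move=> s0 pu; rewrite /hav mule_gt0 ?lte_fin ?invr_gt0 ?exprn_gt0//.
apply: int_gt0 (measurable_hcube b s) (posm_nnm pu) _ _.
  by move=> x _; rewrite lte_fin; case: pu.
by rewrite [X in _ < X]lebesgue_Rn_hcube// lte_fin exprn_gt0.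
Qed.

Lemma hav_le_ae b s u v : (0 < s)%R -> posm u -> posm v ->
  {ae mu, forall x, box b (b + const_mx s)%R x -> (u x <= v x)%R} -> hav b s u <= hav b s v.
Proof.
move=> s0 pu pv uv; rewrite /hav lee_wpmul2l ?lee_fin ?invr_ge0 ?exprn_ge0 ?(ltW s0)//.
have nu := posm_nnm pu; have nv := posm_nnm pv.
rewrite !int_hcube//; apply: ae_ge0_le_integral.
- exact: measurable_box.
- by move=> x _; exact: nnm_ge0 nu x.
- by apply: measurable_funTS; exact: nnm_m nu.
- by move=> x _; exact: nnm_ge0 nv x.
- by apply: measurable_funTS; exact: nnm_m nv.
by apply: filterS uv => x H bx; rewrite lee_fin; exact: H.
Qed.

Lemma hav_scale b s u (k : R) : (0 <= k)%R -> posm u ->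
  hav b s (fun x => k * u x)%R = k%:E * hav b s u.
Proof.
move=> k0 pu; rewrite /hav muleCA; congr (_ * _).
rewrite -intZ ?lee_fin//; [exact: measurable_hcube|exact: posm_nnm].
Qed.

Lemma hav_one b s : (0 < s)%R -> hav b s (fun=> 1%R) = 1.
Proof. by move=> s0; rewrite /hav int1_cube// -EFinM mulVf// gt_eqF// exprn_gt0. Qed.

Lemma hav_hoelder b s u v t : (0 < s)%R -> (0 < t < 1)%R -> posm u -> posm v ->
  hav b s (fun x => u x `^ t * v x `^ (1 - t))%R <= hav b s u `^ t * hav b s v `^ (1 - t).
Proof.
move=> s0 /[dup] t01 /andP[t0 t1] pu pv.
have nu := posm_nnm pu; have nv := posm_nnm pv.
have j0 : (0 < s ^+ n.+1)%R by rewrite exprn_gt0.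
rewrite /hav; move: (s ^+ n.+1)%R j0 => j j0.
have ij0 : 0 <= (j^-1)%:E by rewrite lee_fin invr_ge0 ltW.
rewrite !poweRM ?(nnm_int_ge0 _ _ nu) ?(nnm_int_ge0 _ _ nv)// muleACA.
rewrite !poweR_EFin -EFinM -powRD; last by apply/implyP => _; rewrite gt_eqF// invr_gt0.
rewrite subrKC powRr1 ?invr_ge0 ?(ltW j0)// lee_wpmul2l//.
exact: (int_hoelder mu (measurable_hcube b s) nu nv t01).
Qed.

(* [nle c b s u N] says that the average [<u^(1/c)>^c] over the cube is at most [N],
   understood as an essential supremum for [c = 0] *)
Definition nle c b s u (N : R) : Prop :=
  if c == 0%R then {ae mu, forall x, box b (b + const_mx s)%R x -> (u x <= N)%R}
  else hav b s (fun x => u x `^ c^-1)%R <= (N `^ c^-1)%:E.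

Arguments nle c%_R b%_R s%_R u N%_R.

Lemma nle0 b s u N :
  nle 0 b s u N = {ae mu, forall x, box b (b + const_mx s)%R x -> (u x <= N)%R}.
Proof. by rewrite /nle eqxx. Qed.

Lemma nle_pos c b s u N : (0 < c)%R ->
  nle c b s u N = (hav b s (fun x => u x `^ c^-1)%R <= (N `^ c^-1)%:E).
Proof. by move=> c0; rewrite /nle gt_eqF. Qed.

Lemma nle_mul0 c b s u v (N1 N2 : R) : (0 < s)%R -> posm u -> posm v -> (0 <= c)%R ->
  (0 <= N1)%R -> (0 <= N2)%R ->
  nle 0 b s u N1 -> nle c b s v N2 -> nle c b s (fun x => u x * v x)%R (N1 * N2).
Proof.
move=> s0 pu pv; rewrite le_eqVlt => /predU1P[<-|c0] N10 N20; rewrite ?nle0 ?nle_pos// => H1 H2.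
  have [_ u0] := pu; have [_ v0] := pv.
  by apply: filterS2 H1 H2 => x h1 h2 bx; rewrite ler_pM ?h1 ?h2 ?(ltW (u0 x)) ?(ltW (v0 x)).
have pvc := posm_pow c^-1 pv; have [_ u0] := pu; have [_ v0] := pv.
have c1 : (0 <= c^-1)%R by rewrite invr_ge0 ltW.
have [N1E|N1p] := eqVneq N1 0%R.
  have [|x bx] := ae_exists H1 (measurable_box _ _).
    by rewrite lebesgue_Rn_cube// lte_fin exprn_gt0.
  by rewrite N1E leNgt u0.
have N1p0 : (0 < N1)%R by rewrite lt0r N1p.
rewrite powRM// EFinM; apply: le_trans (lee_wpmul2l _ H2); last by rewrite lee_fin powR_ge0.
rewrite -(hav_scale b s (powR_ge0 _ _) pvc).
apply: (hav_le_ae s0 (posm_pow _ (posm_mul pu pv))).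
  by apply: (posm_mul _ pvc); split=> [|x]; [exact: measurable_cst|exact: powR_gt0].
apply: filterS H1 => x h bx; rewrite powRM ?(ltW (u0 x)) ?(ltW (v0 x))//.
by rewrite ler_wpM2r ?powR_ge0// ge0_ler_powR ?nnegrE ?h ?(ltW (u0 x)).
Qed.

(** Hoelder's inequality in terms of orders: orders add and bounds multiply, with order zero
    standing for the essential supremum. *)
Lemma nle_mul (c1 c2 : R) b s u v (N1 N2 : R) : (0 < s)%R -> posm u -> posm v ->
  (0 <= c1)%R -> (0 <= c2)%R -> (0 <= N1)%R -> (0 <= N2)%R ->
  nle c1 b s u N1 -> nle c2 b s v N2 -> nle (c1 + c2) b s (fun x => u x * v x)%R (N1 * N2).
Proof.
move=> s0 pu pv; rewrite le_eqVlt => /predU1P[<-|c10]; first by rewrite add0r; exact: nle_mul0.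
rewrite le_eqVlt => /predU1P[<-|c20] N10 N20.
  rewrite addr0 mulrC => H1 H2.
  rewrite (_ : (fun x => _) = (fun x => v x * u x)%R); last by apply/funext => x; rewrite mulrC.
  by apply: nle_mul0 H2 H1 => //; exact: ltW.
have c0 : (0 < c1 + c2)%R by rewrite addr_gt0.
rewrite !nle_pos// => H1 H2; have [_ u0] := pu; have [_ v0] := pv.
pose t := (c1 / (c1 + c2))%R.
have t01 : (0 < t < 1)%R by rewrite divr_gt0//= ltr_pdivrMr// mul1r ltrDl.
have t1 : (1 - t = c2 / (c1 + c2))%R by rewrite /t; field; rewrite gt_eqF.
have p1 := posm_pow c1^-1 pu; have p2 := posm_pow c2^-1 pv.
have := hav_hoelder b s0 t01 p1 p2; rewrite t1 /t.
have -> : (fun x => (u x `^ c1^-1) `^ (c1 / (c1 + c2)) * (v x `^ c2^-1) `^ (c2 / (c1 + c2)))%R =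
    (fun x => (u x * v x) `^ (c1 + c2)^-1)%R.
  apply/funext => x; rewrite powRM ?(ltW (u0 x)) ?(ltW (v0 x))// -!powRrM.
  by congr (_ `^ _ * _ `^ _)%R; field; rewrite !gt_eqF.
move=> /le_trans; apply.
have -> : ((N1 * N2) `^ (c1 + c2)^-1 =
    (N1 `^ c1^-1) `^ (c1 / (c1 + c2)) * (N2 `^ c2^-1) `^ (c2 / (c1 + c2)))%R.
  rewrite powRM// -!powRrM.
  by congr (_ `^ _ * _ `^ _)%R; field; rewrite !gt_eqF.
have -> : ((N1 `^ c1^-1) `^ (c1 / (c1 + c2)) * (N2 `^ c2^-1) `^ (c2 / (c1 + c2)))%:E =
    (N1 `^ c1^-1)%:E `^ (c1 / (c1 + c2)) * (N2 `^ c2^-1)%:E `^ (c2 / (c1 + c2)).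
  by rewrite !poweR_EFin -EFinM.
apply: lee_pmul; [exact: poweR_ge0|exact: poweR_ge0| |].
  exact: (lee_poweR (divr_ge0 (ltW c10) (ltW c0)) (hav_ge0 b s0 p1) H1).
exact: (lee_poweR (divr_ge0 (ltW c20) (ltW c0)) (hav_ge0 b s0 p2) H2).
Qed.

Lemma nle_pow k c b s u N : posm u -> (0 <= k)%R -> (0 <= c)%R -> (0 <= N)%R ->
  nle c b s u N -> nle (k * c) b s (fun x => u x `^ k)%R (N `^ k).
Proof.
move=> pu; have [_ u0] := pu; rewrite le_eqVlt => /predU1P[<-|k0].
  by move=> _ _ _; rewrite mul0r nle0; apply: aeW => x _; rewrite !powRr0.
rewrite le_eqVlt => /predU1P[<-|c0] N0.
  rewrite mulr0 !nle0 => H; apply: filterS H => x h bx.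
  by rewrite ge0_ler_powR ?nnegrE ?h ?(ltW (u0 x)) ?(ltW k0).
rewrite !nle_pos ?mulr_gt0// => H.
have e : (k * (k * c)^-1 = c^-1)%R by field; rewrite !gt_eqF.
rewrite -powRrM e (_ : (fun x => _) = (fun x => u x `^ c^-1)%R)//.
by apply/funext => x; rewrite -powRrM e.
Qed.

Lemma nle_one c b s : (0 < s)%R -> (0 <= c)%R -> nle c b s (fun=> 1%R) 1%R.
Proof.
move=> s0; rewrite le_eqVlt => /predU1P[<-|c0]; first by rewrite nle0; exact: aeW.
by rewrite nle_pos// (_ : (fun x => _) = fun=> 1%R) ?powR1 ?hav_one.
Qed.

(** Raising the order weakens the norm: multiply by the constant 1, taken at order [d]. *)
Lemma nle_addr c (d : R) b s u N : (0 < s)%R -> posm u -> (0 <= c)%R -> (0 <= d)%R -> (0 <= N)%R ->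
  nle c b s u N -> nle (c + d) b s u N.
Proof.
move=> s0 pu c0 d0 N0 H.
have := nle_mul s0 pu posm_one c0 d0 N0 ler01 H (nle_one b s0 d0).
by rewrite mulr1 (_ : (fun x => _) = u)//; apply/funext => x; rewrite mulr1.
Qed.

Lemma nle_one_le c b s N : (0 < s)%R -> (0 <= c)%R -> (0 <= N)%R ->
  nle c b s (fun=> 1%R) N -> (1 <= N)%R.
Proof.
move=> s0; rewrite le_eqVlt => /predU1P[<-|c0] N0.
  rewrite nle0 => H; have [|x bx] := ae_exists H (measurable_box _ _) => //.
  by rewrite lebesgue_Rn_cube// lte_fin exprn_gt0.
rewrite nle_pos// (_ : (fun x => _) = fun=> 1%R) ?hav_one//; last first.
  by apply/funext => x; rewrite powR1.
rewrite lee_fin; apply: contraTT; rewrite -!ltNge => N1.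
have : (N `^ c^-1 < 1 `^ c^-1)%R by rewrite gt0_ltr_powR ?nnegrE ?invr_gt0.
by rewrite powR1.
Qed.

(** The product of the norm of [u] of order [c1] and that of [1/u] of order [c2] is at most [K] on
    every cube. The norms enter through upper bounds [N1] and [N2], so that essential suprema and
    averages are treated alike. *)
Definition bracket c1 c2 (K : R) u : Prop := forall b s, (0 < s)%R -> exists N1 N2,
  [/\ (0 < N1)%R, (0 < N2)%R, (N1 * N2 <= K)%R, nle c1 b s u N1 &
      nle c2 b s (fun x => (u x)^-1)%R N2].

Arguments bracket c1%_R c2%_R K%_R u.

Lemma bracket_swap c1 c2 K u : bracket c1 c2 K u -> bracket c2 c1 K (fun x => (u x)^-1)%R.
Proof.
move=> H b s s0; have [N1 [N2 [N10 N20 NK H1 H2]]] := H b s s0; exists N2, N1.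
split; [exact: N20|exact: N10|by rewrite mulrC|exact: H2|].
by rewrite (_ : (fun x => _) = u)//; apply/funext => x; rewrite invrK.
Qed.

Lemma bracket_addr (c1 c2 d1 d2 K : R) u : posm u -> (0 <= c1)%R -> (0 <= c2)%R ->
  (0 <= d1)%R -> (0 <= d2)%R ->
  bracket c1 c2 K u -> bracket (c1 + d1) (c2 + d2) K u.
Proof.
move=> pu c10 c20 d10 d20 H b s s0; have [N1 [N2 [N10 N20 NK H1 H2]]] := H b s s0.
exists N1, N2; split; [exact: N10|exact: N20|exact: NK| |].
  exact: (nle_addr s0 pu c10 d10 (ltW N10) H1).
exact: (nle_addr s0 (posm_inv pu) c20 d20 (ltW N20) H2).
Qed.

(** Let [h] be the mean of [H] on a cube. The A_1 condition bounds [1/H] by [C / h] at order 0,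
    while [H] itself has norm [h] at order 1. Hence [H^(-e)] adds nothing to the first order and [e]
    to the second, and [h] cancels in the product. *)
Lemma bracket_A1 al be K C k e w H : posm w -> posm H -> (0 <= al)%R -> (0 <= be)%R ->
  (0 <= k)%R -> (0 <= e)%R -> (0 <= C)%R -> bracket al be K w ->
  (forall b s, (0 < s)%R -> hav b s H < +oo) ->
  (forall b s, (0 < s)%R -> {ae mu, forall x, box b (b + const_mx s)%R x ->
     hav b s H <= (C * H x)%:E}) ->
  bracket (k * al) (k * be + e) (K `^ k * C `^ e) (fun x => w x `^ k * H x `^ (- e))%R.
Proof.
move=> pw pH al0 be0 k0 e0 C0 br Hfin HA b s s0.
have [N1 [N2 [N10 N20 NK H1 H2]]] := br b s s0.
have := hav_gt0 b s0 pH; have := Hfin b s s0; case hE : (hav b s H) => [h| |]// _ h0.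
rewrite lte_fin in h0; have [_ H0] := pH; have [_ w0] := pw.
have HA' := HA b s s0; rewrite hE in HA'.
have C1 : (0 < C)%R.
  have [|x bx] := ae_exists HA' (measurable_box _ _).
    by rewrite lebesgue_Rn_cube// lte_fin exprn_gt0.
  rewrite lee_fin => /(lt_le_trans h0); rewrite pmulr_lgt0//.
have nH : nle 1 b s H h.
  rewrite nle_pos// invr1 powRr1 ?(ltW h0)// (_ : (fun x => _) = H) ?hE//.
  by apply/funext => x; rewrite powRr1 ?(ltW (H0 x)).
have nHV : nle 0 b s (fun x => (H x)^-1)%R (C / h)%R.
  rewrite nle0; apply: filterS HA' => x hx bx; have := hx bx; rewrite lee_fin => hC.
  by rewrite -[leLHS]mul1r ler_pdivrMr// mulrAC ler_pdivlMr// mul1r.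
have pHV := posm_inv pH.
have Ch : (0 < C / h)%R by rewrite divr_gt0.
exists (N1 `^ k * (C / h) `^ e)%R, (N2 `^ k * h `^ e)%R; split.
- by rewrite mulr_gt0 ?powR_gt0.
- by rewrite mulr_gt0 ?powR_gt0.
- rewrite mulrACA -!powRM ?(ltW N10) ?(ltW N20) ?(ltW Ch) ?(ltW h0)// divfK ?gt_eqF//.
  by rewrite ler_wpM2r ?powR_ge0// ge0_ler_powR// nnegrE ?mulr_ge0 ?(ltW N10) ?(ltW
    N20)// (le_trans _ NK)// mulr_ge0 ?ltW.
- have := nle_mul s0 (posm_pow k pw) (posm_pow e pHV) _ _ _ _
    (nle_pow pw k0 al0 (ltW N10) H1) (nle_pow pHV e0 (lexx 0%R) (ltW Ch) nHV).
  rewrite mulr0 addr0 (_ : (fun x => _) = (fun x => w x `^ k * H x `^ (- e))%R).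
    by apply; rewrite ?powR_ge0 ?mulr_ge0.
  by apply/funext => x; rewrite -powR_inv1 ?(ltW (H0 x))// -powRrM mulN1r.
have := nle_mul s0 (posm_pow k (posm_inv pw)) (posm_pow e pH) _ _ _ _
  (nle_pow (posm_inv pw) k0 be0 (ltW N20) H2) (nle_pow pH e0 ler01 (ltW h0) nH).
rewrite mulr1 (_ : (fun x => _ * _)%R = (fun x => (w x `^ k * H x `^ (- e))^-1)%R).
  by apply; rewrite ?powR_ge0 ?mulr_ge0.
apply/funext => x; rewrite invfM powRN invrK; congr (_ * _)%R.
by rewrite -powR_inv1 ?(ltW (w0 x))// -powRrM mulN1r powRN.
Qed.

Lemma bracket_pair A B K w : (0 < A)%R -> (0 < B)%R -> posm w -> bracket A B K w ->
  [/\ locfin (fun x => w x `^ A^-1)%R, locfin (fun x => (w x)^-1 `^ B^-1)%R,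
      (forall x, (w x `^ A^-1) `^ A * ((w x)^-1 `^ B^-1) `^ B = 1)%R &
      A_pair A B K (fun x => w x `^ A^-1)%R (fun x => (w x)^-1 `^ B^-1)%R].
Proof.
move=> A0 B0 pw br.
have lf c u : (0 < c)%R -> posm u -> (forall b s, (0 < s)%R -> exists N, nle c b s u N) ->
    locfin (fun x => u x `^ c^-1)%R.
  move=> c0 pu H; have [um u0] := posm_pow c^-1 pu; split=> // b s s0.
  have [N] := H b s s0; rewrite nle_pos// /hav => /le_lt_trans/(_ (ltry _)).
  case: (\int[mu]_(x in _) _) => // [r _|]; first exact: ltry.
  by rewrite gt0_muley// lte_fin invr_gt0 exprn_gt0.
have pwV := posm_inv pw; have [_ w0] := pw.
have cancel (c : R) (z : R) : (0 < c)%R -> (0 < z)%R -> ((z `^ c^-1) `^ c = z)%R.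
  by move=> c0 z0; rewrite -powRrM mulVf ?gt_eqF// powRr1// ltW.
split.
- by apply: lf => // b s s0; have [N1 [N2 []]] := br b s s0; exists N1.
- by apply: lf => // b s s0; have [N1 [N2 []]] := br b s s0; exists N2.
- by move=> x; rewrite !cancel ?invr_gt0// mulfV// gt_eqF.
move=> b s s0; have [N1 [N2 [N10 N20 NK]]] := br b s s0; rewrite !nle_pos// => H1 H2.
apply: (@le_trans _ _ (N1 * N2)%:E); last by rewrite lee_fin.
have -> : (N1 * N2)%:E = (N1 `^ A^-1)%:E `^ A * (N2 `^ B^-1)%:E `^ B.
  by rewrite !poweR_EFin -EFinM !cancel.
apply: lee_pmul; [exact: poweR_ge0|exact: poweR_ge0| |].
  exact: (lee_poweR (ltW A0) (hav_ge0 b s0 (posm_pow _ pw)) H1).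
exact: (lee_poweR (ltW B0) (hav_ge0 b s0 (posm_pow _ pwV)) H2).
Qed.

Lemma pair_bracket A B K w W S : (0 < A)%R -> (0 < B)%R -> posm w -> locfin W -> locfin S ->
  (forall x, w x `^ A^-1 = W x)%R -> (forall x, (w x)^-1 `^ B^-1 = S x)%R ->
  A_pair A B K W S -> bracket A B K w.
Proof.
move=> A0 B0 pw lW lS WE SE AK b s s0.
have [x1 x10 x1E] := locfin_fine b lW s0; have [x2 x20 x2E] := locfin_fine b lS s0.
have [j jE] : exists j, j = ((s ^+ n.+1)^-1)%R by eexists.
have j0 : (0 < j)%R by rewrite jE invr_gt0 exprn_gt0.
have := AK b s s0; rewrite /hav x1E x2E -jE -!EFinM lee_fin => H.
exists ((j * x1) `^ A)%R, ((j * x2) `^ B)%R.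
split; rewrite ?powR_gt0 ?mulr_gt0//.
- rewrite nle_pos// (_ : (fun x => _) = W); last exact/funext.
  by rewrite -powRrM divff ?gt_eqF// powRr1 ?mulr_ge0 ?(ltW j0) ?(ltW
    x10)// /hav x1E -jE EFinM lexx.
- rewrite nle_pos// (_ : (fun x => _) = S); last exact/funext.
  by rewrite -powRrM divff ?gt_eqF// powRr1 ?mulr_ge0 ?(ltW j0) ?(ltW
    x20)// /hav x2E -jE EFinM lexx.
Qed.

End norms.

(** * Weight classes in terms of brackets *)

Section constants.
Context {R : realType} {n : nat}.
Local Notation V := ('rV[R]_n.+1).
Local Notation T := (Rn R n).
Local Notation mu := (@lebesgue_Rn R n).
Implicit Types (u v : T -> R) (b : V) (c k e s t N : R).

Lemma int_subset_any (A B : set T) (f : T -> \bar R) : (forall x, 0 <= f x) -> A `<=` B ->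
  \int[mu]_(x in A) f x <= \int[mu]_(x in B) f x.
Proof.
move=> f0 AB; rewrite [leLHS]integral_mkcond [leRHS]integral_mkcond.
have p0 (D : set T) x : 0 <= (f \_ D) x by rewrite patchE; case: ifP.
apply: le_int_any => x _; rewrite ?p0//.
rewrite [in leLHS]patchE; case: ifPn => // /set_mem/AB Bx.
by rewrite patchE mem_set.
Qed.

Lemma compact_sub_hcube (K : set V) : compact K ->
  exists b s, (0 < s)%R /\ K `<=` hcube b s.
Proof.
move=> /compact_bounded[M [_ MK]].
pose N := (`|M| + 1)%R; have MN : (M < N)%R by rewrite /N ltr_pwDr// ler_norm.
have N0 : (0 < N + 1)%R by rewrite /N addr_gt0// ltr_pwDr.
exists (- const_mx (N + 1))%R, (2 * (N + 1))%R; split; first by rewrite mulr_gt0.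
move=> x Kx i; have xN := MK N MN x Kx.
have : ball (0%R : V) (N + 1)%R x.
  by rewrite -ball_normE /ball_/= sub0r normrN (le_lt_trans xN)// ltrDl.
move=> [_ /(_ 0%R i)]; rewrite /ball/= !mxE sub0r normrN ltr_norml => /andP[x1 x2].
by apply/andP; split; lra.
Qed.

Lemma hcube_sub_compact b s : exists2 K : set V, compact K & hcube b s `<=` K.
Proof.
exists [set v : V | forall i, `[b 0%R i, (b 0%R i + s)%R]%classic (v ord0 i)].
  apply: (@rV_compact _ _ (fun i => `[b 0%R i, (b 0%R i + s)%R]%classic)) => i.
  exact: segment_compact.
by move=> x xb i /=; have /andP[x1 x2] := xb i; rewrite in_itv/= x1 ltW.
Qed.

Lemma locfin_locally_integrable u : locfin u -> locally_integrable_Rn (fun x => (u x)%:E).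
Proof.
move=> lu; have nu := nnm_locfin lu; split; first exact: nnm_m nu.
move=> K /compact_sub_hcube[b [s [s0 Ks]]].
have /andP[_] := locfin_hcube b lu s0; apply: le_lt_trans.
rewrite (_ : (fun x => `|(u x)%:E|) = (fun x => (u x)%:E)).
  by apply: int_subset_any Ks => x; exact: nnm_ge0 nu x.
by apply/funext => x; rewrite gee0_abs// (nnm_ge0 nu).
Qed.

Lemma avg_hav b s u : (0 < s)%R -> posm u ->
  avg (box b (b + const_mx s)%R) (fun x => (u x)%:E) = hav b s u.
Proof. by move=> s0 pu; rewrite avg_box//; exact: posm_nnm. Qed.

Lemma ess_sup_in_le b s u (y : R) : {ae mu, forall x, box b (b + const_mx s)%R x -> (u x <= y)%R} ->
  ess_sup_in (box b (b + const_mx s)%R) (fun x : T => (u x)%:E) <= y%:E.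
Proof.
move=> H; apply: ereal_inf_lbound => /=; apply: filterS H => x h bx.
by rewrite lee_fin h.
Qed.

Lemma conjugate_fin (r : R) : r != 0%R -> r != 1%R ->
  hoelder_conjugate r%:E = (r / (r - 1))%:E.
Proof.
move=> r0 r1; rewrite /hoelder_conjugate/= eqe (negbTE r0) -EFinB inver.
by rewrite subr_eq0 (negbTE r1) EFinM.
Qed.

Section fixed.
Context (t : R).
Hypothesis t0 : (0 < t)%R.

Let t1 : (0 <= t^-1)%R. Proof. by rewrite invr_ge0 ltW. Qed.

(** The mean [M] of [u^(1/t)], which appears in both weight constants, is compared with the bracket:
    from above by raising the order [c1] to [t], from below by Hoelder's inequality for
    [u * u^-1 = 1]. *)
Lemma bracket_avg c1 c2 K u : posm u -> (0 <= c1 <= t)%R -> (0 <= c2)%R ->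
  bracket c1 c2 K u -> forall b s, (0 < s)%R -> exists M N1 N2 : R,
  [/\ [/\ (0 < M)%R, (0 < N1)%R & (0 < N2)%R],
      hav b s (fun x => u x `^ t^-1)%R = M%:E, (M <= N1 `^ t^-1)%R, (M^-1 <= N2 `^ t^-1)%R &
      [/\ (N1 * N2 <= K)%R, nle c1 b s u N1 & nle c2 b s (fun x => (u x)^-1)%R N2]].
Proof.
move=> pu /andP[c10 c1t] c20 br b s s0; have [N1 [N2 [N10 N20 NK H1 H2]]] := br b s s0.
have tc : (t = c1 + (t - c1))%R by ring.
have : nle t b s u N1.
  by rewrite tc; apply: (nle_addr s0 pu c10 _ (ltW N10) H1); rewrite subr_ge0.
rewrite nle_pos//; have := hav_gt0 b s0 (posm_pow t^-1 pu).
case ME : (hav b s (fun x => u x `^ t^-1)%R) => [M| |]//; rewrite lte_fin lee_fin => M0 MN.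
exists M, N1, N2; split=> //.
have nM : nle t b s u (M `^ t).
  by rewrite nle_pos// -powRrM divff ?gt_eqF// powRr1 ?ME// ltW.
have := nle_mul s0 pu (posm_inv pu) (ltW t0) c20 (powR_ge0 _ _) (ltW N20) nM H2.
rewrite (_ : (fun x => _) = fun=> 1%R); last first.
  by apply/funext => x; rewrite divff// gt_eqF//; case: pu.
move=> /(nle_one_le s0 (addr_ge0 (ltW t0) c20)) H.
have {}H := H (mulr_ge0 (powR_ge0 _ _) (ltW N20)).
have : (1 `^ t^-1 <= (M `^ t * N2) `^ t^-1)%R.
  by rewrite ge0_ler_powR ?nnegrE ?mulr_ge0 ?powR_ge0 ?(ltW N20).
rewrite powR1 powRM ?powR_ge0 ?(ltW N20)// -powRrM divff ?gt_eqF// powRr1 ?(ltW M0)//.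
by rewrite mulrC -ler_pdivrMr// mul1r.
Qed.

Lemma pow_le c1 N1 N2 K : (0 < N1)%R -> (0 < N2)%R -> (N1 * N2 <= K)%R ->
  ((N1 `^ t^-1) * (N2 `^ t^-1) <= K `^ t^-1)%R.
Proof.
move=> N10 N20 NK; rewrite -powRM ?(ltW N10) ?(ltW N20)//.
rewrite ge0_ler_powR ?nnegrE ?NK ?mulr_ge0 ?(ltW N10) ?(ltW N20)//.
by apply: le_trans NK; rewrite mulr_ge0 ?ltW.
Qed.

(** With [t = 1/p] and [c2 = 1/p_- - 1/p] the index is [p/p_-]. Its dual power turns [u^(1/t)] into
    [u^(-1/c2)]; index 1 corresponds to [c2 = 0] and the essential supremum. *)
Lemma A_const_le c1 c2 K u : posm u -> (0 <= c1 <= t)%R -> (0 <= c2)%R ->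
  bracket c1 c2 K u ->
  A_const ((t + c2) / t)%:E (fun x => (u x `^ t^-1)%:E) <= (K `^ t^-1)%:E.
Proof.
move=> pu ct c20 br; have br' := bracket_avg pu ct c20 br.
have pv := posm_pow t^-1 pu; have [_ u0] := pu.
rewrite /A_const; case: eqVneq => [r1|r1].
  have c2E : c2 = 0%R.
    have := r1 => /(congr1 (fun z => z * t)%R); rewrite divfK ?gt_eqF// mul1r; lra.
  apply: ge_ereal_sup => _ [_ [b [s [s0 ->]]] <-].
  have [M [N1 [N2 [[M0 N10 N20] ME MN1 MN2 [NK H1 H2]]]]] := br' b s s0.
  rewrite avg_hav// ME.
  rewrite (_ : (fun x => _) = (fun x => ((u x)^-1 `^ t^-1)%:E)); last first.
    apply/funext => x; rewrite inver gt_eqF ?powR_gt0//.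
    by rewrite -(powR_inv1 (ltW (u0 x))) -powRrM mulN1r powRN.
  apply: (@le_trans _ _ (M%:E * (N2 `^ t^-1)%:E)).
    rewrite lee_wpmul2l ?lee_fin ?(ltW M0)//; apply: ess_sup_in_le.
    move: H2; rewrite c2E nle0 => H2; apply: filterS H2 => x h bx.
    by rewrite ge0_ler_powR ?nnegrE ?h ?invr_ge0 ?(ltW (u0 x)) ?(ltW N20) ?(ltW t0).
  by rewrite -EFinM lee_fin (le_trans _ (pow_le c1 N10 N20 NK))// ler_wpM2r ?powR_ge0.
have c2p : (0 < c2)%R.
  rewrite lt0r c20 andbT; apply: contra_neq r1 => ->.
  by rewrite addr0 divff ?gt_eqF.
have tc0 : (0 < t + c2)%R by rewrite addr_gt0.
apply: ge_ereal_sup => _ [_ [b [s [s0 ->]]] <-].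
have [M [N1 [N2 [[M0 N10 N20] ME MN1 MN2 [NK H1 H2]]]]] := br' b s s0.
rewrite avg_hav// ME.
have rE : (1 - fine (hoelder_conjugate ((t + c2) / t)%:E) = - (t / c2))%R.
  rewrite conjugate_fin//= ?gt_eqF ?divr_gt0//.
  by field; rewrite !gt_eqF// (_ : t + c2 - t = c2)%R//; ring.
rewrite rE (_ : (fun x => _) = (fun x => ((u x)^-1 `^ c2^-1)%:E)); last first.
  apply/funext => x; rewrite poweR_EFin -(powR_inv1 (ltW (u0 x))) -!powRrM.
  by congr (_ `^ _)%:E; field; rewrite !gt_eqF.
have pw := posm_pow c2^-1 (posm_inv pu).
rewrite avg_hav// (_ : (t + c2) / t - 1 = c2 / t)%R; last by field; rewrite gt_eqF.
apply: (@le_trans _ _ (M%:E * (N2 `^ t^-1)%:E)).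
  rewrite lee_wpmul2l ?lee_fin ?(ltW M0)//.
  rewrite nle_pos// in H2.
  apply: (le_trans (lee_poweR (divr_ge0 (ltW c2p) (ltW t0)) (hav_ge0 b s0 pw) H2)).
  rewrite poweR_EFin lee_fin -powRrM (_ : c2^-1 * (c2 / t) = t^-1)%R//.
  by field; rewrite !gt_eqF.
by rewrite -EFinM lee_fin (le_trans _ (pow_le c1 N10 N20 NK))// ler_wpM2r ?powR_ge0.
Qed.

(** With [t = 1/p] and [d = 1/p_+] the reverse Hoelder index is [t / (t - d)], which turns [u^(1/t)]
    into [u^(1/(t-d))]; for [d = t] it is [+oo]. *)
Lemma RH_const_le d c2 K u : posm u -> (0 < d <= t)%R -> (0 <= c2)%R ->
  bracket (t - d) c2 K u ->
  RH_const (hoelder_conjugate (t / d)%:E) (fun x => (u x `^ t^-1)%:E) <= (K `^ t^-1)%:E.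
Proof.
move=> pu /andP[d0 dt] c20 br.
have ct : (0 <= t - d <= t)%R by rewrite subr_ge0 dt gerBl ltW.
have br' := bracket_avg pu ct c20 br.
have pv := posm_pow t^-1 pu; have [_ u0] := pu.
have fin b s M : (0 < M)%R -> hav b s (fun x => u x `^ t^-1)%R = M%:E ->
    (hav b s (fun x => u x `^ t^-1)%R)^-1 = (M^-1)%:E.
  by move=> M0 ->; rewrite inver gt_eqF.
have [tE|td] := eqVneq t d.
  rewrite -tE divff ?gt_eqF// hoelder_conjugate1 /RH_const /=.
  apply: ge_ereal_sup => _ [_ [b [s [s0 ->]]] <-].
  have [M [N1 [N2 [[M0 N10 N20] ME MN1 MN2 [NK H1 H2]]]]] := br' b s s0.
  rewrite avg_hav// (fin b s M)//.
  apply: (@le_trans _ _ ((N1 `^ t^-1)%:E * (M^-1)%:E)).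
    rewrite lee_wpmul2r ?lee_fin ?invr_ge0 ?(ltW M0)//; apply: ess_sup_in_le.
    move: H1; rewrite -tE subrr nle0 => H1; apply: filterS H1 => x h bx.
    by rewrite ge0_ler_powR ?nnegrE ?h ?(ltW (u0 x)) ?(ltW N10).
  by rewrite -EFinM lee_fin (le_trans _ (pow_le 0%R N10 N20 NK))// ler_wpM2l ?powR_ge0.
have td0 : (0 < t - d)%R by rewrite subr_gt0 lt_neqAle eq_sym td.
have td1 : (t / d != 1)%R.
  by apply: contra_neq td => /(congr1 (fun z => z * d)%R); rewrite divfK ?gt_eqF// mul1r.
have sE : (t / d / (t / d - 1) = t / (t - d))%R by field; rewrite !gt_eqF.
rewrite conjugate_fin//; last by rewrite gt_eqF// divr_gt0.
rewrite sE /RH_const.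
have s1 : (t / (t - d) != 1)%R.
  by apply: contra_neq (lt0r_neq0 d0) => /(congr1 (fun z => z * (t - d))%R);
    rewrite divfK ?gt_eqF// mul1r; lra.
rewrite eqe (negbTE s1).
apply: ge_ereal_sup => _ [_ [b [s [s0 ->]]] <-].
have [M [N1 [N2 [[M0 N10 N20] ME MN1 MN2 [NK H1 H2]]]]] := br' b s s0.
have pw := posm_pow (t - d)^-1 pu.
rewrite (_ : (fun x => _ `^ (t / (t - d))) = (fun x => (u x `^ (t - d)^-1)%:E)); last first.
  apply/funext => x; rewrite poweR_EFin -powRrM.
  by congr (_ `^ _)%:E; field; rewrite !gt_eqF.
rewrite !avg_hav// (fin b s M)//.
apply: (@le_trans _ _ ((N1 `^ t^-1)%:E * (M^-1)%:E)).
  rewrite lee_wpmul2r ?lee_fin ?invr_ge0 ?(ltW M0)//.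
  rewrite nle_pos// in H1.
  have e0 : (0 <= (t / (t - d))^-1)%R by rewrite invr_ge0 divr_ge0 ?ltW.
  apply: (le_trans (lee_poweR e0 (hav_ge0 b s0 pw) H1)).
  rewrite poweR_EFin lee_fin -powRrM (_ : (t - d)^-1 * (t / (t - d))^-1 = t^-1)%R//.
  by field; rewrite !gt_eqF.
by rewrite -EFinM lee_fin (le_trans _ (pow_le 0%R N10 N20 NK))// ler_wpM2l ?powR_ge0.
Qed.

(** A weaker bracket in which both orders are positive, even if [c1] or [c2] is zero, so that the
    maximal function theory of pairs applies. *)
Lemma bracket_enlarge c1 c2 K u : posm u -> (0 <= c1 <= t)%R -> (0 <= c2)%R ->
  bracket c1 c2 K u -> bracket t (c2 + 1) K u.
Proof.
move=> pu /andP[c10 c1t] c20 br; have tc : (t = c1 + (t - c1))%R by ring.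
by rewrite tc; apply: bracket_addr => //; rewrite subr_ge0.
Qed.

Lemma Ainfty_const_le c1 c2 K : (0 <= c1 <= t)%R -> (0 <= c2)%R -> exists C : R,
  forall u, posm u -> bracket c1 c2 K u ->
  Ainfty_const (fun x => (u x `^ t^-1)%:E) <= C%:E.
Proof.
move=> ct c20; have c21 : (0 < c2 + 1)%R by rewrite ltr_pwDr.
have [C HC] := @pair_fujii R n _ _ K t0 c21.
exists C => u pu /(bracket_enlarge pu ct c20) br.
have [lW lS WS AK] := bracket_pair t0 c21 pu br.
exact: HC lW lS WS AK.
Qed.

Lemma bracket_locfin c1 c2 K u : posm u -> (0 <= c1 <= t)%R -> (0 <= c2)%R ->
  bracket c1 c2 K u -> locfin (fun x => u x `^ t^-1)%R.
Proof.
move=> pu ct c20 /(bracket_enlarge pu ct c20) br.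
have c21 : (0 < c2 + 1)%R by rewrite ltr_pwDr.
by have [] := bracket_pair t0 c21 pu br.
Qed.

Lemma RH_const_lty c1 c2 K u : posm u -> (0 <= c1 <= t)%R -> (0 <= c2)%R ->
  bracket c1 c2 K u ->
  exists2 r : R, (1 < r)%R & RH_const r%:E (fun x => (u x `^ t^-1)%:E) < +oo.
Proof.
move=> pu ct c20 /(bracket_enlarge pu ct c20) br.
have c21 : (0 < c2 + 1)%R by rewrite ltr_pwDr.
have [lW lS WS AK] := bracket_pair t0 c21 pu br.
have [del del0 [C HC]] := pair_reverse_hoelder t0 c21 lW lS WS AK.
have d1 : (0 < 1 + del)%R by rewrite addr_gt0.
exists (1 + del)%R; first by rewrite ltrDl.
apply: (@le_lt_trans _ _ (`|C| `^ (1 + del)^-1)%:E); last exact: ltry.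
rewrite /RH_const eqe gt_eqF ?ltrDl//.
have pv := posm_pow t^-1 pu.
apply: ge_ereal_sup => _ [_ [b [s [s0 ->]]] <-].
rewrite (_ : (fun x => _ `^ (1 + del)) = (fun x => ((u x `^ t^-1) `^ (1 + del))%:E)); last first.
  by apply/funext => x; rewrite poweR_EFin.
have pw := posm_pow (1 + del) pv.
rewrite !avg_hav//; have := HC b s s0.
have := hav_gt0 b s0 pw; have := hav_gt0 b s0 pv.
have := locfin_hcube b lW s0 => /andP[_ Wfin].
have : hav b s (fun x => u x `^ t^-1)%R < +oo.
  rewrite /hav; move: Wfin; have := nnm_int_ge0 mu (hcube b s) (posm_nnm pv).
  by case: (\int[mu]_(x in _) _) => // z _ _; exact: ltry.
case: (hav b s (fun x => u x `^ t^-1)%R) => // h _; rewrite lte_fin => h0.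
case: (hav b s _) => [g| |]//; rewrite ?lte_fin => g0.
rewrite poweR_EFin -EFinM lee_fin => gh.
rewrite poweR_EFin inver gt_eqF// -EFinM lee_fin ler_pdivrMr//.
have e1 : (h = (h `^ (1 + del)) `^ (1 + del)^-1)%R.
  by rewrite -powRrM divff ?gt_eqF// powRr1// ltW.
rewrite e1 -powRM ?powR_ge0// ge0_ler_powR ?nnegrE ?invr_ge0 ?(ltW d1) ?(ltW g0)//.
  by rewrite mulr_ge0 ?powR_ge0.
by apply: le_trans gh _; rewrite ler_wpM2r ?powR_ge0// ler_norm.
Qed.

Lemma posm_weight u : posm u -> weight (fun x : T => (u x `^ t^-1)%:E).
Proof.
move=> pu; have pv := posm_pow t^-1 pu; split; first exact: nnm_m (posm_nnm pv).
by have [_ v0] := pv; apply: aeW => x; rewrite lte_fin ltry andbT; exact: v0.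
Qed.

End fixed.
End constants.

Section classes.
Context {R : realType} {n : nat}.
Local Notation V := ('rV[R]_n.+1).
Local Notation T := (Rn R n).
Local Notation mu := (@lebesgue_Rn R n).
Implicit Types (u v : T -> R) (b : V) (c k e s t N p : R).

Lemma poweR_posm p u : (fun x : T => (u x)%:E `^ p) = (fun x => (u x `^ (p^-1)^-1)%:E).
Proof. by apply/funext => x; rewrite invrK poweR_EFin. Qed.

(** For [pm = 0] the class only asks for some finite index, which [c2] provides, and the constant to
    be bounded is that of A_infinity. *)
Lemma bracket_A_class (pm : \bar R) p c1 c2 (K : R) : 0 <= pm -> pm <= p%:E -> (0 < p)%R ->
  (0 <= c1 <= p^-1)%R -> (0 <= c2)%R -> (pm != 0 -> c2 = (fine pm^-1 - p^-1)%R) ->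
  exists K1 : R, forall u, posm u -> bracket c1 c2 K u ->
    A_class (p%:E / pm) (fun x => (u x)%:E `^ p) /\
    A_const (p%:E / pm) (fun x => (u x)%:E `^ p) <= K1%:E.
Proof.
move=> pm0 pmp p0 c1p c20 c2E; have t0 : (0 < p^-1)%R by rewrite invr_gt0.
have r1 : (1 <= (p^-1 + c2) / p^-1)%R by rewrite ler_pdivlMr// mul1r lerDl.
have [pmE|pm_n0] := eqVneq pm 0.
  have [C HC] := @Ainfty_const_le R n _ t0 c1 c2 K c1p c20.
  exists C => u pu br; rewrite pmE inve0 gt0_muley ?lte_fin// poweR_posm; split; last exact: HC.
  exists ((p^-1 + c2) / p^-1)%R; split=> //; first exact: posm_weight.
  by apply: le_lt_trans (A_const_le t0 pu c1p c20 br) _; exact: ltry.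
exists (K `^ (p^-1)^-1)%R => u pu br.
have rE : p%:E / pm = ((p^-1 + c2) / p^-1)%:E.
  rewrite c2E//; move: pm pm0 pmp pm_n0 {c2E} => [m| |]//; rewrite ?leye_eq//.
  move=> _ _; rewrite eqe => m0; rewrite inver (negbTE m0)/= -EFinM; congr (_%:E).
  by field; rewrite m0 gt_eqF.
have H := A_const_le t0 pu c1p c20 br.
rewrite rE poweR_posm; split; last exact: H.
split; [exact: r1|exact: posm_weight|].
by apply: le_lt_trans H _; exact: ltry.
Qed.

(** For [pp = +oo] the index is 1: the constant is that of A_infinity, while membership asks for
    some reverse Hoelder index above 1, given by [RH_const_lty]. *)
Lemma bracket_RH_class (pp : \bar R) p c2 (K : R) : p%:E <= pp -> (0 < p)%R -> (0 <= c2)%R ->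
  exists K2 : R, forall u, posm u -> bracket (p^-1 - fine pp^-1) c2 K u ->
    RH_class (hoelder_conjugate (pp / p%:E)) (fun x => (u x)%:E `^ p) /\
    RH_const (hoelder_conjugate (pp / p%:E)) (fun x => (u x)%:E `^ p) <= K2%:E.
Proof.
move=> ppp p0 c20; have t0 : (0 < p^-1)%R by rewrite invr_gt0.
move: pp ppp => [P| |]//= ppp.
  rewrite lee_fin in ppp; have P0 : (0 < P)%R by exact: lt_le_trans ppp.
  rewrite inver gt_eqF//=; have d0 : (0 < P^-1 <= p^-1)%R by rewrite invr_gt0 P0/= lef_pV2 ?posrE.
  have ct : (0 <= p^-1 - P^-1 <= p^-1)%R.
    by case/andP: d0 => d0 dp; rewrite subr_ge0 dp gerBl ltW.
  exists (K `^ (p^-1)^-1)%R => u pu br.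
  have sE : hoelder_conjugate (P%:E / p%:E) = hoelder_conjugate (p^-1 / P^-1)%:E.
    by rewrite inver gt_eqF// -EFinM invrK mulrC.
  have H := RH_const_le t0 pu d0 c20 br.
  rewrite sE poweR_posm; split=> //.
  have s1 : 1 < hoelder_conjugate (p^-1 / P^-1)%:E :> \bar R.
    have Pp1 : (1 <= p^-1 / P^-1)%R by rewrite invrK mulrC ler_pdivlMr// mul1r.
    have [E1|n1] := eqVneq (p^-1 / P^-1)%R 1%R; first by rewrite E1 hoelder_conjugate1 ltry.
    rewrite conjugate_fin// ?gt_eqF ?(lt_le_trans _ Pp1)// lte_fin ltr_pdivlMr.
      by rewrite mul1r ltrBlDr ltrDl.
    by rewrite subr_gt0 lt_neqAle eq_sym n1.
  rewrite /RH_class (gt_eqF s1); split; first exact: s1.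
  - exact: posm_weight.
  - by apply: locfin_locally_integrable; exact: bracket_locfin br.
  - by apply: le_lt_trans H _; exact: ltry.
rewrite subr0 inver gt_eqF// gt0_mulye ?lte_fin ?invr_gt0// hoelder_conjugatey.
have ct : (0 <= p^-1 <= p^-1)%R by rewrite lexx ltW.
have [C HC] := @Ainfty_const_le R n _ t0 _ c2 K ct c20.
exists C => u pu br; rewrite poweR_posm /RH_const /RH_class eqxx; split; last exact: HC.
have [r r1 Hr] := RH_const_lty t0 pu ct c20 br.
exists r%:E; split; [exact: r1|exact: posm_weight| |exact: Hr].
by apply: locfin_locally_integrable; exact: bracket_locfin br.
Qed.

Lemma avg_ae b s u (f : T -> \bar R) : (0 < s)%R -> nnm f -> posm u ->
  {ae mu, forall x, f x = (u x)%:E} -> avg (box b (b + const_mx s)%R) f = hav b s u.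
Proof.
move=> s0 nf pu fu; rewrite -avg_hav// /avg; congr (_ * _).
by apply: int_ae_eq => //; [exact: measurable_box|exact: posm_nnm].
Qed.

Lemma maximal_ae (f g : T -> \bar R) : nnm f -> nnm g -> {ae mu, forall x, f x = g x} ->
  maximal f = maximal g.
Proof.
move=> nf ng fg; apply/funext => x.
have E (Q : set T) : cubes Q /\ Q x -> avg Q (fun y => `|f y|) = avg Q (fun y => `|g y|).
  move=> [[b [s [s0 ->]]] _]; rewrite /avg; congr (_ * _).
  rewrite (_ : (fun y => `|f y|) = f); last by apply/funext => y; rewrite gee0_abs// (nnm_ge0 nf).
  rewrite (_ : (fun y => `|g y|) = g); last by apply/funext => y; rewrite gee0_abs// (nnm_ge0 ng).
  exact: int_ae_eq (measurable_box _ _) nf ng fg.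
exact: (congr1 (@ereal_sup R) (eq_imagel E)).
Qed.

Lemma Ainfty_const_ae (f g : T -> \bar R) : nnm f -> nnm g ->
  {ae mu, forall x, f x = g x} -> Ainfty_const f = Ainfty_const g.
Proof.
move=> nf ng fg.
have E (Q : set T) : cubes Q -> (\int[mu]_(x in Q) f x)^-1 * \int[mu]_(x in Q) maximal (f \_ Q) x =
    (\int[mu]_(x in Q) g x)^-1 * \int[mu]_(x in Q) maximal (g \_ Q) x.
  move=> [b [s [s0 QE]]]; have mQ : measurable Q by rewrite QE; exact: measurable_box.
  rewrite (int_ae_eq mQ nf ng fg) (maximal_ae (nnm_restrict mQ nf) (nnm_restrict mQ ng))//.
  by apply: filterS fg => y fy; rewrite !patchE fy.
exact: (congr1 (@ereal_sup R) (eq_imagel E)).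
Qed.

Lemma RH_class_locally_integrable (r : \bar R) (v : T -> \bar R) : RH_class r v ->
  weight v /\ locally_integrable_Rn v.
Proof. by rewrite /RH_class; case: eqP => _ => [[r' []]|[]]. Qed.

Lemma locally_integrable_locfin u (f : T -> \bar R) : nnm f -> posm u ->
  {ae mu, forall x, f x = (u x)%:E} -> locally_integrable_Rn f -> locfin u.
Proof.
move=> nf pu fu [_ li]; have [um u0] := pu; split=> // b s s0.
rewrite -(int_ae_eq (measurable_hcube b s) nf (posm_nnm pu) fu).
have [K cK sK] := hcube_sub_compact b s.
apply: le_lt_trans (li K cK).
rewrite (_ : (fun x => `|f x|) = f); last by apply/funext => x; rewrite gee0_abs// (nnm_ge0 nf).
by apply: int_subset_any sK => x; exact: nnm_ge0 nf x.
Qed.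

(** * From the constants of a weight back to a bracket *)

Section input.
Context (p : R).
Hypothesis p0 : (0 < p)%R.
Let t := (p^-1)%R.

(** The norm of [u] of order [1/p - 1/p_+] is bounded relative to the mean [M] of [u^p]. For
    [pp = +oo] this order is [1/p] and the bound is an equality with constant 1. *)
Lemma RH_nle (pp : \bar R) K2 : p%:E < pp -> exists2 K' : R, (0 <= K')%R &
  forall u (wp : T -> \bar R), posm u -> nnm wp -> {ae mu, forall x, wp x = (u x `^ p)%:E} ->
  RH_const (hoelder_conjugate (pp / p%:E)) wp <= K2%:E ->
  forall b s M, (0 < s)%R -> (0 < M)%R -> hav b s (fun x => u x `^ p)%R = M%:E ->
  exists N, [/\ (0 < N)%R, (N <= K' * M `^ t)%R & nle (t - fine pp^-1) b s u N].
Proof.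
have t0 : (0 < t)%R by rewrite invr_gt0.
have tV : (t^-1 = p)%R by rewrite invrK.
case: pp => [P| |] ppP; last (by []); last first.
  exists 1%R; first exact: ler01.
  move=> u wp pu _ _ _ b s M s0 M0 ME; exists (M `^ t)%R; split;
    [exact: powR_gt0|by rewrite mul1r|].
  by rewrite invey subr0 nle_pos// tV ME -powRrM mulVf ?gt_eqF// powRr1 ?lexx// (ltW M0).
rewrite lte_fin in ppP; have P0 : (0 < P)%R by exact: lt_trans ppP.
have c0 : (0 < t - P^-1)%R by rewrite subr_gt0 ltf_pV2.
exists (`|K2| `^ t)%R; first exact: powR_ge0.
move=> u wp pu nwp wpE; rewrite !inver !gt_eqF// -EFinM conjugate_fin; last 2 first.
- by rewrite gt_eqF// divr_gt0.
- by rewrite gt_eqF// ltr_pdivlMr// mul1r.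
rewrite (_ : P / p / (P / p - 1) = t / (t - P^-1))%R; last first.
  by rewrite /t; field; rewrite !gt_eqF// mulN1r subr_gt0.
rewrite /RH_const eqe gt_eqF; last by rewrite ltr_pdivlMr// mul1r gtrBl invr_gt0.
move=> H b s M s0 M0 ME; set c := (t - P^-1)%R in c0 H *.
have pw := posm_pow c^-1 pu.
have {H} H : (avg (box b (b + const_mx s)%R) (fun x => wp x `^ (t / c))) `^ (t / c)^-1 *
    (avg (box b (b + const_mx s)%R) wp)^-1 <= K2%:E.
  by apply: le_trans H; apply: ereal_sup_ubound; exists (box b (b + const_mx s)%R) => //;
    exists b, s.
move: H; rewrite (avg_ae b s0 nwp (posm_pow p pu) wpE) ME inver gt_eqF//.
rewrite (avg_ae b s0 (nnm_pow (t / c) nwp) pw); last first.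
  apply: filterS wpE => x ->; rewrite poweR_EFin -powRrM; congr (_ `^ _)%:E.
  by rewrite /t; field; rewrite !gt_eqF.
have := hav_gt0 b s0 pw.
have e0 : (0 < (t / c)^-1)%R by rewrite invr_gt0 divr_gt0.
case XE : (hav b s (fun x => u x `^ c^-1)%R) => [X| |]// X0; last first.
  by rewrite poweRyr ?gt_eqF// gt0_mulye// lte_fin invr_gt0.
rewrite lte_fin in X0; rewrite poweR_EFin -EFinM lee_fin ler_pdivrMr// => H.
exists (X `^ c)%R; split; first exact: powR_gt0.
  have XX : (X `^ c = (X `^ (t / c)^-1) `^ t)%R.
    by rewrite -powRrM; congr (_ `^ _)%R; field; rewrite !gt_eqF.
  rewrite XX -powRM ?(ltW M0)// ge0_ler_powR ?nnegrE ?powR_ge0 ?mulr_ge0 ?(ltW M0) ?(ltW t0)//.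
  by apply: le_trans H _; rewrite ler_wpM2r ?(ltW M0)// ler_norm.
by rewrite nle_pos// XE -powRrM divff ?gt_eqF// powRr1// ltW.
Qed.

(** For [pm = 0] the order [c2] is not prescribed: [fujii_pair] yields [t / del] with [del]
    depending on [K1], and adding [c0] makes it as large as the later decrease of the order
    requires. *)
Lemma A_nle (pm : \bar R) K1 c0 : 0 <= pm -> pm < p%:E -> (0 <= c0)%R ->
  exists c2 K', [/\ (0 < c2)%R, (0 <= K')%R, (pm != 0 -> c2 = (fine pm^-1 - t)%R),
    (pm = 0 -> (c0 <= c2)%R) &
  forall u (wp : T -> \bar R), posm u -> nnm wp -> {ae mu, forall x, wp x = (u x `^ p)%:E} ->
  locfin (fun x => u x `^ p)%R -> A_const (p%:E / pm) wp <= K1%:E ->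
  forall b s, (0 < s)%R -> exists M N, [/\ (0 < M)%R, (0 < N)%R,
    hav b s (fun x => u x `^ p)%R = M%:E, (M `^ t * N <= K')%R & nle c2 b s (fun x => (u x)^-1)%R
      N]].
Proof.
move=> pm0 pmp c00; have t0 : (0 < t)%R by rewrite invr_gt0.
have hfin u b s : locfin u -> (0 < s)%R -> exists2 M, (0 < M)%R & hav b s u = M%:E.
  move=> lu s0; have [a a0 aE] := locfin_fine b lu s0.
  by exists ((s ^+ n.+1)^-1 * a)%R; rewrite ?mulr_gt0 ?invr_gt0 ?exprn_gt0// /hav aE EFinM.
have [pmE|pm_n0] := eqVneq pm 0.
  have K10 : (0 < `|K1| + 1)%R by rewrite ltr_pwDr.
  have [del [C [del0 HC]]] := @fujii_pair R n _ K10.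
  exists (t / del + c0)%R, (`|C| `^ t)%R; split=> //.
  - by rewrite ltr_pwDl// divr_gt0.
  - by rewrite lerDr divr_ge0 ?ltW.
  move=> u wp pu nwp wpE lV; rewrite pmE inve0 gt0_muley ?lte_fin//= => HA.
  have pV := posm_pow p pu.
  have VK : Ainfty_const (fun x => (u x `^ p)%:E) <= (`|K1| + 1)%:E.
    rewrite -(Ainfty_const_ae nwp (posm_nnm pV) wpE); apply: le_trans HA _.
    by rewrite lee_fin (le_trans (ler_norm _))// lerDl.
  have [lS VS VA] := HC _ lV VK.
  have br : bracket 1 del^-1 C (fun x => u x `^ p)%R.
    apply: (pair_bracket ltr01 _ pV lV lS _ _ VA) => [|x|x]; first by rewrite invr_gt0.
      by rewrite invr1 powRr1 ?powR_ge0.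
    by rewrite invrK powRN -powR_inv1 ?powR_ge0// -powRrM mulN1r powRN.
  move=> b s s0; have [M M0 ME] := hfin _ b s lV s0.
  have [N1 [N2 [N10 N20 NC]]] := br b s s0; rewrite nle_pos// invr1.
  rewrite (_ : (fun x => _) = (fun x => u x `^ p)%R); last first.
    by apply/funext => x; rewrite powRr1 ?powR_ge0.
  rewrite ME lee_fin powRr1 ?(ltW N10)// => MN1 H2.
  exists M, (N2 `^ t)%R; split=> //; first exact: powR_gt0.
    rewrite -powRM ?(ltW M0) ?(ltW N20)//.
    rewrite ge0_ler_powR ?nnegrE ?(ltW t0) ?mulr_ge0 ?(ltW M0) ?(ltW N20)//.
    by apply: le_trans (le_trans NC (ler_norm _)); rewrite ler_wpM2r ?(ltW N20).
  have d0 : (0 <= del^-1)%R by rewrite invr_ge0 ltW.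
  have := nle_pow (posm_inv pV) (ltW t0) d0 (ltW N20) H2.
  rewrite (_ : (fun x => _) = (fun x => (u x)^-1)%R); last first.
    apply/funext => x; have [_ u0] := pu.
    rewrite -(powR_inv1 (powR_ge0 (u x) p)) -!powRrM -[RHS]powR_inv1 ?(ltW (u0 x))//.
    by congr (_ `^ _)%R; rewrite /t; field; rewrite gt_eqF.
  move=> H3; apply: (nle_addr s0 (posm_inv pu) _ c00 (powR_ge0 _ _) H3).
  by rewrite mulr_ge0// ltW.
move: pm pm0 pmp pm_n0 => [m| |]//; rewrite lee_fin lte_fin eqe => m0 mp mn0.
have mp0 : (0 < m)%R by rewrite lt0r mn0.
rewrite inver (negbTE mn0) /=.
have c0' : (0 < m^-1 - t)%R by rewrite subr_gt0 ltf_pV2.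
exists (m^-1 - t)%R, (`|K1| `^ t)%R; split=> //.
  by move=> [mE]; rewrite mE eqxx in mn0.
move=> u wp pu nwp wpE lV; rewrite gt_eqF; last by rewrite ltr_pdivlMr// mul1r.
move=> H b s s0; have [M M0 ME] := hfin _ b s lV s0.
set c := (m^-1 - t)%R in c0' H *.
have rE : (1 - fine (hoelder_conjugate (p / m)%:E) = - (t / c))%R.
  rewrite conjugate_fin; last 2 first.
  - by rewrite gt_eqF// divr_gt0.
  - by rewrite gt_eqF// ltr_pdivlMr// mul1r.
  by rewrite /= /c /t; field; rewrite mn0 (gt_eqF p0) mulN1r subr_eq0 (gt_eqF mp).
have r1 : (p / m - 1 = c / t)%R by rewrite /c /t; field; rewrite !gt_eqF.
have {}H : avg (box b (b + const_mx s)%R) wp *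
    avg (box b (b + const_mx s)%R) (fun x => wp x `^ (- (t / c))) `^ (c / t) <= K1%:E.
  by rewrite -rE -r1; apply: le_trans H; apply: ereal_sup_ubound;
    exists (box b (b + const_mx s)%R) => //; exists b, s.
have pw := posm_pow c^-1 (posm_inv pu).
move: H; rewrite (avg_ae b s0 nwp (posm_pow p pu) wpE) ME.
rewrite (avg_ae b s0 (nnm_pow (- (t / c)) nwp) pw); last first.
  have [_ u0] := pu; apply: filterS wpE => x ->; rewrite poweR_EFin -(powR_inv1 (ltW (u0 x)))
    -!powRrM.
  by congr (_ `^ _)%:E; rewrite /t; field; rewrite !gt_eqF.
have := hav_gt0 b s0 pw.
have e0 : (0 < c / t)%R by rewrite divr_gt0.
case XE : (hav b s (fun x => (u x)^-1 `^ c^-1)%R) => [X| |]// X0; last first.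
  by rewrite poweRyr ?gt_eqF// gt0_muley// lte_fin.
rewrite lte_fin in X0; rewrite poweR_EFin -EFinM lee_fin => H.
exists M, (X `^ c)%R; split=> //; first exact: powR_gt0.
  have XX : (X `^ c = (X `^ (c / t)) `^ t)%R.
    by rewrite -powRrM; congr (_ `^ _)%R; field; rewrite !gt_eqF.
  rewrite XX -powRM ?powR_ge0 ?(ltW M0)// ge0_ler_powR ?nnegrE ?(ltW t0) ?mulr_ge0 ?powR_ge0
    ?(ltW M0)//.
  exact: le_trans H (ler_norm _).
by rewrite nle_pos// XE -powRrM divff ?gt_eqF// powRr1// ltW.
Qed.

(** The reverse Hoelder and Muckenhoupt bounds are both relative to the mean of [u^p], which cancels
    in the product. *)
Lemma weight_bracket (pm pp : \bar R) K1 K2 c0 : 0 <= pm -> pm < p%:E -> p%:E < pp -> (0 <= c0)%R ->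
  exists c2 K, [/\ (0 < c2)%R, (pm != 0 -> c2 = (fine pm^-1 - t)%R), (pm = 0 -> (c0 <= c2)%R) &
  forall w : T -> \bar R, weight w ->
  A_class (p%:E / pm) (fun x => w x `^ p) ->
  RH_class (hoelder_conjugate (pp / p%:E)) (fun x => w x `^ p) ->
  A_const (p%:E / pm) (fun x => w x `^ p) <= K1%:E ->
  RH_const (hoelder_conjugate (pp / p%:E)) (fun x => w x `^ p) <= K2%:E ->
  exists u, [/\ posm u, {ae mu, forall x, w x = (u x)%:E} & bracket (t - fine pp^-1) c2 K u]].
Proof.
move=> pm0 pmp ppp c00; have [K' K'0 HRH] := RH_nle K2 ppp.
have [c2 [K'' [c20 K''0 c2E c2c HA]]] := A_nle K1 pm0 pmp c00.
exists c2, (K' * K'')%R; split=> // w [wm wpos] Acl RHcl Ale RHle.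
have [u [um u0 wu]] := pos_real_version wm wpos.
have pu : posm u by [].
have [[wpm _] li] := RH_class_locally_integrable RHcl.
have nwp : nnm (fun x => w x `^ p) by apply/nnmP; split=> // x; exact: poweR_ge0.
have wpE : {ae mu, forall x, w x `^ p = (u x `^ p)%:E}.
  by apply: filterS wu => x ->; rewrite poweR_EFin.
have lV := locally_integrable_locfin nwp (posm_pow p pu) wpE li.
exists u; split=> // b s s0.
have [M [N2 [M0 N20 ME MN H2]]] := HA u _ pu nwp wpE lV Ale b s s0.
have [N1 [N10 N1M H1]] := HRH u _ pu nwp wpE RHle b s M s0 M0 ME.
exists N1, N2; split=> //; apply: (@le_trans _ _ (K' * M `^ t * N2)%R).
  by rewrite ler_wpM2r// ltW.
by rewrite -mulrA ler_wpM2l.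
Qed.

End input.

End classes.

(** * Extrapolation *)

Section extrapolation.
Context {R : realType} {n : nat}.
Local Notation V := ('rV[R]_n.+1).
Local Notation T := (Rn R n).
Local Notation mu := (@lebesgue_Rn R n).
Implicit Types (u w h : T -> R) (f g X : T -> \bar R) (al be k e s t eps K C : R).

(** With [W = w^(1/al)] and [X = G^P W], the majorant is [h = H^P W]. Then [w h^(-eps)] equals
    [w^(1 - eps/al) H^(-P eps)], and [bracket_A1] shifts the orders by exactly [eps]. One [h] serves
    every [eps]. *)
Lemma rdf_weight al be K : (0 < al)%R -> (0 < be)%R -> exists2 C : R, (0 < C)%R &
  forall w, posm w -> bracket al be K w -> forall X, nnm X ->
  0 < \int[mu]_x X x < +oo -> exists h, [/\ posm h,
    {ae mu, forall x, X x <= (h x)%:E},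
    \int[mu]_x (h x)%:E <= C%:E * \int[mu]_x X x &
    forall eps, (0 <= eps <= al)%R ->
      bracket (al - eps) (be + eps) (K `^ (1 - eps / al) * C `^ ((al + be) / al * eps))
        (fun x => w x * h x `^ (- eps))%R].
Proof.
move=> al0 be0; have [C C0 HC] := @rdf_exists R n al be K al0 be0.
exists C => // w pw br X nX IX.
have [lW lS WS AK] := bracket_pair al0 be0 pw br.
set W := (fun x => w x `^ al^-1)%R in lW WS AK.
have pW : posm W := posm_pow al^-1 pw; have [_ W0] := pW; have [_ w0] := pw.
pose P := ((al + be) / al)%R; have P0 : (0 < P)%R by rewrite divr_gt0 ?addr_gt0.
pose G x := (X x * ((W x)^-1)%:E) `^ P^-1.
have nG : nnm G := nnm_pow P^-1 (nnm_mul nX (posm_nnm (posm_inv pW))).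
have GX x : G x `^ P * (W x)%:E = X x.
  rewrite /G -poweRrM mulVf ?gt_eqF// poweRe1; last first.
    by rewrite mule_ge0 ?(nnm_ge0 nX)// lee_fin invr_ge0 ltW.
  by rewrite -muleA -EFinM mulVf ?gt_eqF// mule1.
have EG : \int[mu]_x (G x `^ P * (W x)%:E) = \int[mu]_x X x by apply: eq_integral => x _; exact: GX.
have IG : 0 < \int[mu]_x (G x `^ P * (W x)%:E) < +oo by rewrite EG.
have [H [lH GH HI HA]] := HC W _ lW lS WS AK G nG IG.
have pH : posm H by case: lH.
have [_ H0] := pH.
exists (fun x => H x `^ P * W x)%R; split.
- exact: posm_mul (posm_pow P pH) pW.
- apply: filterS GH => x GHx; rewrite -GX EFinM -poweR_EFin lee_wpmul2r ?lee_fin ?(ltW (W0 x))//.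
  by apply: (lee_poweR (ltW P0) _ GHx); exact: nnm_ge0 nG x.
- move: HI; rewrite EG; apply: le_trans; rewrite le_eqVlt; apply/orP; left; apply/eqP.
  by apply: eq_integral => x _; rewrite poweR_EFin EFinM.
move=> eps /andP[e0 ea].
have k0 : (0 <= 1 - eps / al)%R by rewrite subr_ge0 ler_pdivrMr// mul1r.
have ee0 : (0 <= (al + be) / al * eps)%R by rewrite mulr_ge0// ltW.
have Hf b s : (0 < s)%R -> hav b s H < +oo.
  move=> s0; rewrite /hav; have [a a0 ->] := locfin_fine b lH s0.
  by rewrite -EFinM ltry.
have := bracket_A1 pw pH (ltW al0) (ltW be0) k0 ee0 (ltW C0) br Hf HA.
rewrite (_ : (1 - eps / al) * al = al - eps)%R; last by field; rewrite gt_eqF.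
rewrite (_ : (1 - eps / al) * be + (al + be) / al * eps = be + eps)%R; last by field;
  rewrite gt_eqF.
congr bracket; apply/funext => x.
rewrite powRM ?powR_ge0// -!powRrM mulrCA -{2}(powRr1 (ltW (w0 x))) -powRD; last first.
  by apply/implyP => _; rewrite gt_eqF.
rewrite mulrC; congr (_ `^ _ * _ `^ _)%R; rewrite /P; first by ring.
by rewrite mulrN mulrC.
Qed.

(** Reciprocal exponents are used, [s = 1/q] and [t = 1/p], because extrapolation shifts both by
    [eps]. *)
Definition est s t C f g u : Prop :=
  (\int[mu]_x (f x * (u x)%:E) `^ s^-1) `^ s <= C%:E * (\int[mu]_x (g x * (u x)%:E) `^ t^-1) `^ t.

Lemma poweR_shift (y : \bar R) (h eps t t' : R) : 0 <= y -> (0 < h)%R -> (0 < t)%R -> (0 < t')%R ->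
  (y * (h `^ eps)%:E) `^ t'^-1 = (y `^ t^-1) `^ (t / t') * (h%:E `^ (eps / t')).
Proof.
move=> y0 h0 t0 t'0; rewrite poweRM ?lee_fin ?powR_ge0// -(poweRrM y).
rewrite (_ : t^-1 * (t / t') = t'^-1)%R; last by field; rewrite !gt_eqF.
by congr (_ * _); rewrite !poweR_EFin -powRrM.
Qed.

Lemma int_hoelder_shift f h eps t : nnm f -> posm h -> (0 < t)%R -> (0 < eps)%R ->
  (\int[mu]_x (f x * (h x `^ eps)%:E) `^ (t + eps)^-1) `^ (t + eps) <=
  (\int[mu]_x f x `^ t^-1) `^ t * (\int[mu]_x (h x)%:E) `^ eps.
Proof.
move=> nf ph t0 e0; have te0 : (0 < t + eps)%R by rewrite addr_gt0.
have [_ h0] := ph; have nh := posm_nnm ph; have nft := nnm_pow t^-1 nf.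
have th01 : (0 < t / (t + eps) < 1)%R.
  by rewrite divr_gt0//= ltr_pdivrMr// mul1r ltrDl.
have th1 : (1 - t / (t + eps) = eps / (t + eps))%R by field; rewrite gt_eqF.
have := int_hoelder mu measurableT nft nh th01; rewrite th1 => H.
rewrite (eq_integral (fun x => (f x `^ t^-1) `^ (t / (t + eps)) * (h x)%:E `^ (eps / (t +
  eps)))); last first.
  by move=> x _; rewrite (poweR_shift eps _ (h0 x) t0 te0) ?(nnm_ge0 nf).
have I0 : 0 <= \int[mu]_x ((f x `^ t^-1) `^ (t / (t + eps)) * (h x)%:E `^ (eps / (t + eps))).
  exact: nnm_int_ge0 (nnm_mul (nnm_pow _ nft) (nnm_pow _ nh)).
have := lee_poweR (ltW te0) I0 H; rewrite poweRM ?poweR_ge0//.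
by rewrite -(poweRrM (\int[mu]_x f x `^ t^-1)) -(poweRrM (\int[mu]_x (h x)%:E)) !divfK ?gt_eqF.
Qed.

(** With [y = g^(1/(t+eps))] the left-hand integrand is [y * (y/h)^(eps/t)], and [y <= h]. *)
Lemma int_le_shift g h eps t : nnm g -> posm h -> (0 <= eps)%R -> (0 < t)%R ->
  {ae mu, forall x, g x `^ (t + eps)^-1 <= (h x)%:E} ->
  \int[mu]_x (g x * (h x `^ (- eps))%:E) `^ t^-1 <= \int[mu]_x g x `^ (t + eps)^-1.
Proof.
move=> ng ph e0 t0 gh; have te0 : (0 < t + eps)%R by rewrite ltr_pwDl.
have [_ h0] := ph; have nh := posm_nnm (posm_pow (- eps) ph).
apply: ae_ge0_le_integral; first exact: measurableT.
- by move=> x _; exact: poweR_ge0.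
- exact: nnm_m (nnm_pow t^-1 (nnm_mul ng nh)).
- by move=> x _; exact: poweR_ge0.
- exact: nnm_m (nnm_pow _ ng).
apply: filterS gh => x gh _.
rewrite (poweR_shift (- eps) (nnm_ge0 ng x) (h0 x) te0 t0).
move: gh; have := poweR_ge0 (g x) (t + eps)^-1.
case: (g x `^ (t + eps)^-1) => [y| |]//; rewrite !lee_fin => y0 yh.
have r0 : (0 <= eps / t)%R by rewrite divr_ge0// ltW.
rewrite (_ : (t + eps) / t = 1 + eps / t)%R; last by field; rewrite gt_eqF.
rewrite powRD; last by apply/implyP; rewrite gt_eqF// ltr_pwDl.
rewrite powRr1// -mulrA ler_piMr// mulNr powRN ler_pdivrMr ?powR_gt0// mul1r.
by rewrite ge0_ler_powR ?nnegrE ?(ltW (h0 x)).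
Qed.

(** An input for the algorithm when the right-hand side vanishes and any single admissible weight is
    enough. *)
Lemma unit_cube_int : 0 < \int[mu]_x (\1_(hcube (0 : V) 1) x : R)%:E < +oo.
Proof.
rewrite integral_indic//; last exact: measurable_hcube.
by rewrite setIT [X in 0 < X < _]lebesgue_Rn_hcube// expr1n lte_fin ltr01 ltry.
Qed.

Section pairs.
Context (F : set ((T -> \bar R) * (T -> \bar R))).
Hypothesis nF : forall f g, F (f, g) -> nnm f /\ nnm g.

(** Vanishing almost everywhere does not depend on the weight or the exponent, so an estimate for
    one weight [w'] settles the degenerate case for all of them. *)
Lemma est_zero f g w w' s t s' t' C : nnm f -> nnm g -> posm w -> posm w' ->
  (0 < s)%R -> (0 < t)%R -> (0 < s')%R -> (0 < t')%R ->
  \int[mu]_x (g x * (w x)%:E) `^ t^-1 = 0 -> est s' t' C f g w' ->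
  (\int[mu]_x (f x * (w x)%:E) `^ s^-1) `^ s = 0.
Proof.
move=> nf ng pw pw' s0 t0 s'0 t'0 g0.
have z0 (z : R) (y : \bar R) (r : R) : (0 < r)%R -> 0 <= y -> (0 < z)%R
  -> (y * z%:E) `^ r^-1 = 0 <-> y = 0.
  move=> r0 y0 u0; split=> [/poweR_eq0_eq0|->]; last by rewrite mul0e poweR0r// invr_eq0 gt_eqF.
  have z0 : 0 <= z%:E by rewrite lee_fin ltW.
  move=> /(_ (mule_ge0 y0 z0)) /eqP; rewrite mule_eq0 => /orP[/eqP//|].
  by rewrite eqe gt_eqF.
have nz v (k : T -> \bar R) r : nnm k -> posm v -> nnm (fun x => (k x * (v x)%:E) `^ r^-1).
  by move=> nk pv; exact: nnm_pow (nnm_mul nk (posm_nnm pv)).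
have zi v (k : T -> \bar R) r : nnm k -> posm v -> (0 < r)%R ->
    {ae mu, forall x, k x = 0} -> \int[mu]_x (k x * (v x)%:E) `^ r^-1 = 0.
  move=> nk pv r0 k0; apply: int_ae0 => //; first exact: nz.
  by apply: filterS k0 => x kx _; have [_ v0] := pv; apply/(z0 _ _ _ r0 (nnm_ge0 nk x) (v0 x)).
have iz v (k : T -> \bar R) r : nnm k -> posm v -> (0 < r)%R ->
    \int[mu]_x (k x * (v x)%:E) `^ r^-1 = 0 -> {ae mu, forall x, k x = 0}.
  move=> nk pv r0 /(int_eq0 measurableT (nz v k r nk pv)) H.
  by apply: filterS H => x /(_ I); have [_ v0] := pv; move/(z0 _ _ _ r0 (nnm_ge0 nk x) (v0 x)).
rewrite /est (zi w' g t' ng pw' t'0 (iz w g t ng pw t0 g0)) poweR0r ?gt_eqF// mule0 => H.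
have f0 : \int[mu]_x (f x * (w' x)%:E) `^ s'^-1 = 0.
  apply: (@poweR_eq0_eq0 _ _ s'); first exact: (nnm_int_ge0 _ _ (nz w' f s' nf pw')).
  by apply/eqP; rewrite eq_le H poweR_ge0.
by rewrite (zi w f s nf pw s0 (iz w' f s' nf pw' s'0 f0)) poweR0r ?gt_eqF.
Qed.

(** If the mass [N] of [X] is infinite, the right-hand side is; if it is zero, [est_zero] applies.
    Otherwise [h^(-eps)] does not increase the integral of [g] because [X <= h], and Hoelder's
    inequality restores [h^eps] on the side of [f] at the price [(Cr N)^eps]. *)
Lemma extrapolate_up al be eps s t : (0 < eps)%R -> (eps <= al)%R -> (0 < be)%R ->
  (0 < s)%R -> (0 < t)%R ->
  (forall K, exists2 C, (0 < C)%R & forall u, posm u -> bracket (al - eps) (be + eps) K u ->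
     forall f g, F (f, g) -> est s t C f g u) ->
  forall K, exists2 C, (0 < C)%R & forall w, posm w -> bracket al be K w ->
     forall f g, F (f, g) -> est (s + eps) (t + eps) C f g w.
Proof.
move=> e0 ea be0 s0 t0 hyp K; have al0 : (0 < al)%R := lt_le_trans e0 ea.
have e01 : (0 <= eps <= al)%R by rewrite ea ltW.
have te0 : (0 < t + eps)%R by rewrite addr_gt0.
have se0 : (0 < s + eps)%R by rewrite addr_gt0.
have [Cr Cr0 HCr] := rdf_weight K al0 be0.
have [C0 C00 HC0] := hyp (K `^ (1 - eps / al) * Cr `^ ((al + be) / al * eps))%R.
exists (C0 * Cr `^ eps)%R; first by rewrite mulr_gt0// powR_gt0.
move=> w pw br f g Ffg; have [nf ng] := nF Ffg; have nw := posm_nnm pw.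
have ngw := nnm_mul ng nw; have nfw := nnm_mul nf nw.
pose X x := (g x * (w x)%:E) `^ (t + eps)^-1.
have nX : nnm X := nnm_pow _ ngw.
have IX0 : 0 <= \int[mu]_x X x := nnm_int_ge0 _ _ nX.
case XE : (\int[mu]_x X x) => [N| |]; last by rewrite XE in IX0.
- rewrite XE lee_fin le_eqVlt in IX0; move: IX0 => /predU1P[N0|N0].
    have nI : nnm (fun x : T => (\1_(hcube (0 : V) 1) x : R)%:E).
      by apply: nnm_EFin => //; apply: measurable_indic; exact: measurable_hcube.
    have [h [ph _ _ /(_ _ e01) hb]] := HCr w pw br _ nI unit_cube_int.
    have := HC0 _ (posm_mul pw (posm_pow (- eps) ph)) hb f g Ffg.
    move=> /(est_zero nf ng pw (posm_mul pw (posm_pow (- eps) ph)) se0 te0 s0 t0) H.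
    by rewrite /est H ?mule_ge0 ?poweR_ge0 ?lee_fin ?mulr_ge0 ?powR_ge0 ?(ltW C00)// -/X XE -N0.
  have IX : 0 < \int[mu]_x X x < +oo by rewrite XE lte_fin N0 ltry.
  have [h [ph Xh hI /(_ _ e01) hb]] := HCr w pw br X nX IX.
  have [_ h0] := ph; have pu := posm_mul pw (posm_pow (- eps) ph).
  have := HC0 _ pu hb f g Ffg; rewrite /est.
  set J0 := \int[mu]_x (g x * _) `^ t^-1.
  have J0N : J0 <= N%:E.
    rewrite -XE; apply: le_trans (int_le_shift ngw ph (ltW e0) t0 Xh).
    by rewrite /J0 le_eqVlt; apply/orP; left; apply/eqP; apply: eq_integral => x _;
      rewrite EFinM muleA.
  have J00 : 0 <= J0 by exact: nnm_int_ge0 (nnm_pow _ (nnm_mul ng (posm_nnm pu))).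
  move=> est0.
  have nfu := nnm_mul nf (posm_nnm pu).
  have := int_hoelder_shift nfu ph s0 e0.
  rewrite (eq_integral (fun x => (f x * (w x)%:E) `^ (s + eps)^-1)); last first.
    move=> x _; rewrite -muleA -EFinM -mulrA -powRD; last by apply/implyP => _; rewrite gt_eqF.
    by rewrite addNr powRr0 mulr1.
  move=> /le_trans; apply.
  apply: (@le_trans _ _ ((C0%:E * N%:E `^ t) * (Cr%:E * N%:E) `^ eps)).
    apply: lee_pmul; [exact: poweR_ge0|exact: poweR_ge0| |].
      apply: le_trans est0 _; rewrite lee_wpmul2l ?lee_fin ?(ltW C00)//.
      exact: (lee_poweR (ltW t0) J00 J0N).
    rewrite XE in hI; exact: (lee_poweR (ltW e0) (nnm_int_ge0 _ _ (posm_nnm ph)) hI).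
  rewrite -/X XE.
  change ((C0 * N `^ t * (Cr * N) `^ eps)%:E <= (C0 * Cr `^ eps * N `^ (t + eps))%:E).
  rewrite lee_fin powRM ?(ltW Cr0) ?(ltW N0)//.
  rewrite powRD; last by apply/implyP => _; rewrite gt_eqF.
  by rewrite le_eqVlt; apply/orP; left; apply/eqP; ring.
by rewrite /est -/X XE poweRyr ?gt_eqF// gt0_muley ?leey// lte_fin mulr_gt0 ?powR_gt0.
Qed.

(** Cut in height and in space: the mass is finite, and the truncations increase to [X]. *)
Definition truncation X m : T -> \bar R :=
  (fun x => Order.min (X x) (m%:R)%:E) \_ (hcube (bigc m) (2 * m%:R)%R : set T).

Lemma nnm_truncation X m : nnm X -> nnm (truncation X m).
Proof.
move=> nX; apply: nnm_restrict; first exact: measurable_hcube.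
apply/nnmP; split=> [|x]; last by rewrite le_min (nnm_ge0 nX) lee_fin ler0n.
by apply: measurable_mine; [exact: nnm_m nX|exact: measurable_cst].
Qed.

Lemma truncation_le X m x : nnm X -> truncation X m x <= X x.
Proof.
move=> nX; rewrite /truncation patchE; case: ifPn => _; last exact: nnm_ge0 nX x.
by rewrite ge_min lexx.
Qed.

Lemma truncation_homo X x : nnm X -> {homo (truncation X)^~ x : m k / (m <= k)%N >-> m <= k}.
Proof.
move=> nX m k mk; rewrite /truncation !patchE.
case: ifPn => [/set_mem xm|_]; last first.
  by case: ifPn => // _; rewrite le_min (nnm_ge0 nX) lee_fin ler0n.
rewrite mem_set; last exact: bigc_sub mk _ xm.
by rewrite le_min !ge_min lexx/= lee_fin ler_nat mk orbT.
Qed.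

Lemma truncation_lty X m : nnm X -> \int[mu]_x truncation X m x < +oo.
Proof.
move=> nX; rewrite -integral_mkcond.
have mh : measurable (hcube (bigc m) (2 * m%:R)%R : set T) by exact: measurable_hcube.
apply: (@le_lt_trans _ _ (\int[mu]_(x in hcube (bigc m) (2 * m%:R)%R) (m%:R)%:E)).
  apply: ge0_le_integral; first exact: mh.
  - by move=> x _; rewrite le_min (nnm_ge0 nX) lee_fin ler0n.
  - by apply: measurable_mine; [apply: measurable_funTS; exact: nnm_m nX|exact: measurable_cst].
  - exact: measurable_cst.
  - by move=> x _; rewrite ge_min lexx orbT.
have [->|m0] := posnP m; first by rewrite integral0.
by rewrite integral_cst// [X in _ * X]lebesgue_Rn_hcube ?mulr_gt0 ?ltr0n// -EFinM ltry.
Qed.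

Lemma truncation_sup X x : nnm X -> X x <= ereal_sup [set truncation X m x | m in [set: nat]].
Proof.
move=> nX; have [N N0 /box_sub_hcube xN] := bigc_cover x.
have tE m : (N <= m)%N -> truncation X m x = Order.min (X x) (m%:R)%:E.
  by move=> Nm; rewrite /truncation patchE mem_set//; exact: bigc_sub Nm _ xN.
have ub m : (N <= m)%N -> Order.min (X x) (m%:R)%:E <=
    ereal_sup [set truncation X m x | m in [set: nat]].
  by move=> Nm; rewrite -tE//; apply: ereal_sup_ubound; exists m.
have := nnm_ge0 nX x; case XE : (X x) => [r| |]// r0.
  have [k kr] : exists k : nat, (r <= k%:R)%R.
    by exists (Num.truncn r).+1; apply: ltW; exact: truncnS_gt.
  apply: le_trans (ub (maxn N k) (leq_maxl _ _)); rewrite XE le_min lexx/= lee_fin.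
  by apply: le_trans kr _; rewrite ler_nat leq_maxr.
rewrite leye_eq; apply/eqP/eq_infty => r.
have [k kr] : exists k : nat, (r <= k%:R)%R.
  by exists (Num.truncn r).+1; apply: ltW; exact: truncnS_gt.
apply: le_trans (ub (maxn N k) (leq_maxl _ _)); rewrite XE le_min leey/= lee_fin.
by apply: le_trans kr _; rewrite ler_nat leq_maxr.
Qed.

(** The algorithm is applied to [1/w] and to a truncation [Z] of [X = (f w)^(1/s)], of mass [I].
    Since [X] and [h] both dominate [Z], so does [(f w h^eps)^(1/(s+eps))]; this bounds [I] by the
    left-hand side of the hypothesis for [w h^eps]. *)
Lemma extrapolate_down al be eps s t : (0 < eps)%R -> (eps <= be)%R -> (0 < al)%R ->
  (0 < s)%R -> (0 < t)%R ->
  (forall K, exists2 C, (0 < C)%R & forall u, posm u -> bracket (al + eps) (be - eps) K u ->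
     forall f g, F (f, g) -> est (s + eps) (t + eps) C f g u) ->
  forall K, exists2 C, (0 < C)%R & forall w, posm w -> bracket al be K w ->
     forall f g, F (f, g) -> est s t C f g w.
Proof.
move=> e0 eb al0 s0 t0 hyp K; have be0 : (0 < be)%R := lt_le_trans e0 eb.
have e01 : (0 <= eps <= be)%R by rewrite eb ltW.
have te0 : (0 < t + eps)%R by rewrite addr_gt0.
have se0 : (0 < s + eps)%R by rewrite addr_gt0.
have [Cr Cr0 HCr] := rdf_weight K be0 al0.
have [C0 C00 HC0] := hyp (K `^ (1 - eps / be) * Cr `^ ((be + al) / be * eps))%R.
exists (C0 * Cr `^ eps)%R; first by rewrite mulr_gt0// powR_gt0.
move=> w pw br f g Ffg; have [nf ng] := nF Ffg; have nw := posm_nnm pw.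
have ngw := nnm_mul ng nw; have nfw := nnm_mul nf nw.
pose X x := (f x * (w x)%:E) `^ s^-1.
have nX : nnm X := nnm_pow _ nfw.
rewrite /est -/X; set Y := (\int[mu]_x (g x * (w x)%:E) `^ t^-1) `^ t.
have Y0 : 0 <= Y by exact: poweR_ge0.
set D := (C0 * Cr `^ eps)%R; have D0 : (0 < D)%R by rewrite mulr_gt0// powR_gt0.
have DY0 : 0 <= D%:E * Y by rewrite mule_ge0// lee_fin ltW.
have step m : (\int[mu]_x truncation X m x) `^ s <= D%:E * Y.
  have nZ := nnm_truncation m nX; set Z := truncation X m in nZ *.
  have ZX x : Z x <= X x := truncation_le m x nX.
  have := truncation_lty m nX; have := nnm_int_ge0 mu setT nZ; rewrite -/Z.
  case ZE : (\int[mu]_x Z x) => [I| |]//; rewrite lee_fin => I0 _.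
  move: I0; rewrite le_eqVlt => /predU1P[<-|I0]; first by rewrite poweR0r ?gt_eqF.
  have IZ : 0 < \int[mu]_x Z x < +oo by rewrite ZE lte_fin I0 ltry.
  have [h [ph Zh hI /(_ _ e01) hb]] := HCr _ (posm_inv pw) (bracket_swap br) Z nZ IZ.
  have [_ h0] := ph; have [_ w0] := pw; have pu := posm_mul pw (posm_pow eps ph).
  have hb' : bracket (al + eps) (be - eps) (K `^ (1 - eps / be) * Cr `^ ((be + al) / be * eps))
      (fun x => w x * h x `^ eps)%R.
    have := bracket_swap hb; congr bracket; apply/funext => x.
    by rewrite invfM invrK powRN invrK.
  have := HC0 _ pu hb' f g Ffg; rewrite /est.
  set I0' := \int[mu]_x (f x * _) `^ _; set J0 := \int[mu]_x (g x * _) `^ _ => est0.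
  have IJ : I%:E <= I0'.
    rewrite -ZE /I0'; apply: ae_ge0_le_integral; first exact: measurableT.
    - by move=> x _; exact: nnm_ge0 nZ x.
    - exact: nnm_m nZ.
    - by move=> x _; exact: poweR_ge0.
    - exact: nnm_m (nnm_pow _ (nnm_mul nf (posm_nnm pu))).
    apply: filterS Zh => x Zhx _; rewrite EFinM muleA.
    rewrite (poweR_shift eps (nnm_ge0 nfw x) (h0 x) s0 se0) -/(X x).
    have Z0 := nnm_ge0 nZ x.
    have r1 : (0 <= s / (s + eps))%R by rewrite divr_ge0 ?ltW.
    have r2 : (0 <= eps / (s + eps))%R by rewrite divr_ge0 ?ltW.
    apply: (@le_trans _ _ (Z x `^ (s / (s + eps)) * Z x `^ (eps / (s + eps)))); last first.
      apply: lee_pmul; [exact: poweR_ge0|exact: poweR_ge0| |].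
        exact: lee_poweR r1 Z0 (ZX x).
      exact: lee_poweR r2 Z0 Zhx.
    move: Z0 Zhx; case: (Z x) => // z; rewrite !lee_fin => z0 _.
    rewrite -powRD; last first.
    by rewrite -mulrDl divff; [rewrite oner_eq0|rewrite gt_eqF].
    by rewrite -mulrDl divff ?gt_eqF// powRr1.
  have JY : J0 `^ (t + eps) <= Y * (Cr%:E * I%:E) `^ eps.
    have J0E : J0 = \int[mu]_x ((g x * (w x)%:E) * (h x `^ eps)%:E) `^ (t + eps)^-1.
      by apply: eq_integral => x _; rewrite EFinM muleA.
    rewrite J0E; apply: le_trans (int_hoelder_shift ngw ph t0 e0) _.
    rewrite lee_wpmul2l// -ZE.
    exact: (lee_poweR (ltW e0) (nnm_int_ge0 _ _ (posm_nnm ph)) hI).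
  (* As [I] is finite and positive, the factor [I^eps] can be divided out, leaving a bound on [I^s]
     uniform in [m]. *)
  have : I%:E `^ (s + eps) <= C0%:E * (Y * (Cr%:E * I%:E) `^ eps).
    apply: (le_trans (lee_poweR (ltW se0) _ IJ)); first by rewrite lee_fin ltW.
    by apply: le_trans est0 _; rewrite lee_wpmul2l// lee_fin ltW.
  move: Y0 {DY0 JY}; case: (Y) => [y| |]//; last first.
    by rewrite gt0_muley ?leey// lte_fin.
  rewrite lee_fin => y0.
  change (((I `^ (s + eps))%:E <= (C0 * (y * (Cr * I) `^ eps))%:E) ->
    ((I `^ s)%:E <= (D * y)%:E)).
  rewrite !lee_fin powRD; last by apply/implyP => _; rewrite gt_eqF.
  rewrite powRM ?(ltW Cr0) ?(ltW I0)// => H.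
  have Ie : (0 < I `^ eps)%R by rewrite powR_gt0.
  rewrite -(ler_pM2r Ie); apply: le_trans H _.
  by rewrite le_eqVlt; apply/orP; left; apply/eqP; rewrite /D; ring.
have s'0 : (0 <= s^-1)%R by rewrite invr_ge0 ltW.
have le1 : \int[mu]_x X x <= (D%:E * Y) `^ s^-1.
  apply: (@le_trans _ _ (\int[mu]_x ereal_sup [set truncation X m x | m in [set: nat]])).
    apply: le_int_any => x _; [exact: nnm_ge0 nX x| |exact: truncation_sup].
    by apply: le_trans (nnm_ge0 nX x) _; exact: truncation_sup.
  apply: int_sup_le => m.
  - exact: nnm_truncation.
  - exact: truncation_homo.
  have I0 := nnm_int_ge0 mu setT (nnm_truncation m nX).
  have := lee_poweR s'0 (poweR_ge0 _ _) (step m).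
  by rewrite -poweRrM divff ?gt_eqF// poweRe1.
have := lee_poweR (ltW s0) (nnm_int_ge0 _ _ nX) le1.
by rewrite -(poweRrM (D%:E * Y)) mulVf ?gt_eqF// poweRe1.
Qed.

End pairs.
End extrapolation.

Lemma est_pow (R : realType) (n : nat) (q p C : R) (f g : Rn R n -> \bar R) (u : Rn R n -> R) :
  (forall x, 0 <= f x) -> (forall x, 0 <= g x) -> posm u ->
  est q^-1 p^-1 C f g u =
  ((\int[@lebesgue_Rn R n]_x (f x `^ q * (u x)%:E `^ q)) `^ q^-1 <=
   C%:E * (\int[@lebesgue_Rn R n]_x (g x `^ p * (u x)%:E `^ p)) `^ p^-1).
Proof.
move=> f0 g0 [_ u0]; rewrite /est !invrK.
have E (k : Rn R n -> \bar R) (r : R) : (forall x, 0 <= k x) ->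
    \int[@lebesgue_Rn R n]_x (k x * (u x)%:E) `^ r =
    \int[@lebesgue_Rn R n]_x (k x `^ r * (u x)%:E `^ r).
  by move=> k0; apply: eq_integral => x _; rewrite poweRM ?lee_fin ?(ltW (u0 x)).
by rewrite !E.
Qed.

Lemma fine_inv_le (R : realType) (p : R) (pp : \bar R) : (0 < p)%R -> p%:E <= pp ->
  (0 <= p^-1 - fine pp^-1 <= p^-1)%R.
Proof.
move=> p0; case: pp => [P| |]//; rewrite ?lee_fin => pP; last first.
  by rewrite invey subr0 lexx invr_ge0 ltW.
have P0 : (0 < P)%R by exact: lt_le_trans pP.
by rewrite inver gt_eqF//= subr_ge0 lef_pV2// pP gerBl invr_ge0 ltW.
Qed.

Lemma estimate_bracket (R : realType) (n : nat) (pm pp : \bar R) (p q c : R)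
    (F : set ((Rn R n -> \bar R) * (Rn R n -> \bar R))) :
  0 <= pm -> pm <= p%:E -> p%:E <= pp -> (0 < p)%R -> (0 <= c)%R ->
  (pm != 0 -> c = (fine pm^-1 - p^-1)%R) ->
  (forall f g, F (f, g) -> nnm f /\ nnm g) ->
  weighted_estimate pm pp p q F ->
  forall K : R, exists2 C : R, (0 < C)%R & forall u, posm u ->
    bracket (p^-1 - fine pp^-1) c K u -> forall f g, F (f, g) -> est q^-1 p^-1 C f g u.
Proof.
move=> pm0 pmp ppp p0 c0 cE nF hyp K.
have [K1 HA] := @bracket_A_class R n _ _ _ _ K pm0 pmp p0 (fine_inv_le p0 ppp) c0 cE.
have [K2 HRH] := @bracket_RH_class R n _ _ _ K ppp p0 c0.
have [C C0 HC] := hyp K1 K2; exists C => // u pu br f g Ffg.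
have [nf ng] := nF f g Ffg.
rewrite est_pow//; [|exact: nnm_ge0 nf|exact: nnm_ge0 ng].
have [Acl Ale] := HA u pu br; have [RHcl RHle] := HRH u pu br.
apply: HC => //; split; first exact: nnm_m (posm_nnm pu).
by have [_ u0] := pu; apply: aeW => x; rewrite lte_fin ltry andbT; exact: u0.
Qed.

Theorem corollary1p12 (R : realType) (n : nat) (pm pp : \bar R)
    (hpm : 0 <= pm) (hpmpp : pm < pp)
    (F : set ((Rn R n -> \bar R) * (Rn R n -> \bar R)))
    (hF : forall f g, F (f, g) ->
       [/\ measurable_fun [set: Rn R n] f, measurable_fun [set: Rn R n] g,
           (forall x, 0 <= f x) & (forall x, 0 <= g x)])
    (p0 q0 : R) (hp0 : (0 < p0)%R) (hq0 : (0 < q0)%R)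
    (hpmp0 : pm <= p0%:E) (hp0pp : p0%:E <= pp)
    (hpq0 : 0 <= q0^-1%:E - p0^-1%:E + pp^-1)
    (hyp : weighted_estimate pm pp p0 q0 F) :
  forall p q : R, pm < p%:E -> p%:E < pp -> (0 < q)%R ->
    (p^-1 - q^-1 = p0^-1 - q0^-1)%R ->
    weighted_estimate pm pp p q F.
Proof.
move=> p q pmp ppp q_gt0 pq.
have p_gt0 : (0 < p)%R by rewrite -lte_fin (le_lt_trans hpm).
have nF f g : F (f, g) -> nnm f /\ nnm g by move=> /hF[mf mg f0 g0]; split; exact/nnmP.
have t0 : (0 < p^-1)%R by rewrite invr_gt0.
have t00 : (0 < p0^-1)%R by rewrite invr_gt0.
have s0 : (0 < q^-1)%R by rewrite invr_gt0.
have s00 : (0 < q0^-1)%R by rewrite invr_gt0.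
rewrite /weighted_estimate; cbv zeta => K1 K2.
(* The lower bound [1/p0] requested for [c] when [pm = 0] makes the order [c + 1/p - 1/p0] at p0
   nonnegative; for [pm != 0] this follows from [hpmp0]. *)
have [c [K [c_gt0 cE cc HK]]] := @weight_bracket R n p p_gt0 pm pp K1 K2 _ hpm pmp ppp (ltW t00).
have d1 : (0 < p^-1 - fine pp^-1)%R.
  case: pp ppp {hpmpp hp0pp hpq0 hyp HK} => [P| |]//; rewrite ?lte_fin => pP.
    have P0 : (0 < P)%R by exact: lt_trans pP.
    by rewrite inver gt_eqF//= subr_gt0 ltf_pV2.
  by rewrite invey subr0.
have /andP[d0 _] := fine_inv_le hp0 hp0pp.
have c'0 : (0 <= c + p^-1 - p0^-1)%R.
  have [pmE|pm_n0] := eqVneq pm 0; first by have := cc pmE; lra.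
  rewrite cE// subrK subr_ge0; case: pm hpm hpmp0 pm_n0 {hpmpp hyp pmp cE cc HK} => [m| |]//.
  rewrite !lee_fin eqe => m0 mp mn0.
  by rewrite inver (negbTE mn0)/= lef_pV2// posrE lt0r mn0.
have c'E : pm != 0 -> (c + p^-1 - p0^-1 = fine pm^-1 - p0^-1)%R by move=> /cE ->; rewrite subrK.
have core := estimate_bracket hpm hpmp0 hp0pp hp0 c'0 c'E nF hyp.
have [C C0 HC] : exists2 C : R, (0 < C)%R & forall u, posm u ->
    bracket (p^-1 - fine pp^-1) c K u -> forall f g, F (f, g) -> est q^-1 p^-1 C f g u.
  have [tt|tt|tt] := ltgtP p0^-1%R p^-1%R.
  (* The shift [eps] is the distance between [1/p] and [1/p0]; by the relation [pq] it is also the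
     distance between [1/q] and [1/q0]. *)
  - have := @extrapolate_up R n F nF (p^-1 - fine pp^-1)%R c (p^-1 - p0^-1)%R q0^-1%R p0^-1%R.
    rewrite (_ : q0^-1 + (p^-1 - p0^-1) = q^-1)%R; last by lra.
    rewrite (_ : p0^-1 + (p^-1 - p0^-1) = p^-1)%R; last by lra.
    rewrite (_ : p^-1 - fine pp^-1 - (p^-1 - p0^-1) = p0^-1 - fine pp^-1)%R; last by lra.
    rewrite (_ : c + (p^-1 - p0^-1) = c + p^-1 - p0^-1)%R; last by lra.
    apply=> //; first by rewrite subr_gt0.
    by rewrite lerD2l lerN2; lra.
  - have := @extrapolate_down R n F nF (p^-1 - fine pp^-1)%R c (p0^-1 - p^-1)%R q^-1%R p^-1%R.
    rewrite (_ : q^-1 + (p0^-1 - p^-1) = q0^-1)%R; last by lra.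
    rewrite (_ : p^-1 + (p0^-1 - p^-1) = p0^-1)%R; last by lra.
    rewrite (_ : p^-1 - fine pp^-1 + (p0^-1 - p^-1) = p0^-1 - fine pp^-1)%R; last by lra.
    rewrite (_ : c - (p0^-1 - p^-1) = c + p^-1 - p0^-1)%R; last by lra.
    apply=> //; first by rewrite subr_gt0.
    by lra.
  - have := core K; rewrite tt (_ : q0^-1 = q^-1)%R; last by lra.
    by rewrite addrK.
exists C => // w ww Acl RHcl Ale RHle f g Ffg.
have [u [pu wu br]] := HK w ww Acl RHcl Ale RHle.
have [nf ng] := nF f g Ffg.
have := HC u pu br f g Ffg; rewrite est_pow//; [|exact: nnm_ge0 nf|exact: nnm_ge0 ng].
have E (k : Rn R n -> \bar R) (r : R) : nnm k ->
    \int[@lebesgue_Rn R n]_x (k x `^ r * (u x)%:E `^ r) =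
    \int[@lebesgue_Rn R n]_x (k x `^ r * w x `^ r).
  move=> nk; have nwr : nnm (fun x => w x `^ r).
    apply/nnmP; split=> [|x]; last exact: poweR_ge0.
    by case: ww => wm _; exact: (measurableT_comp (measurable_poweR r)).
  apply: int_ae_eq.
  - exact: measurableT.
  - exact: nnm_mul (nnm_pow r nk) (nnm_pow r (posm_nnm pu)).
  - exact: nnm_mul (nnm_pow r nk) nwr.
  - by apply: filterS wu => x ->.
by rewrite !E.
Qed.
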